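(* Let $0<p<1$, $\alpha>0$, and $\beta\in\mathbb{N}\cup(1/p-1,\infty)$. There is a constant $C$ (independent of $f$ and $n$) such that for every $f$ with $f,f^{(\alpha)}\in L_1(\mathbb{T})$ and every $n\in\mathbb{N}$, $$\omega_\beta\left(f^{(\alpha)},\frac1n\right)_p\le C\left(\frac1{n^{\beta p}}\sum_{\nu=0}^n(\sigma_{\alpha,p}(\nu+1))^p(\nu+1)^{\beta p-1}E_\nu(f)_p^p+\sum_{\nu=n+1}^\infty(\sigma_{\alpha,p}(\nu))^p\nu^{-1}E_\nu(f)_p^p\right)^{1/p},$$ where $$\sigma_{\alpha,p}(n)=\begin{cases} n^{\alpha}, & \alpha\in\mathbb{N}\ \text{or}\ \alpha\notin\mathbb{N}\ \text{and}\ \alpha>\frac1p-1,\\ n^{\frac1p-1}\log^{\frac1p}(n+1), & \alpha=\frac1p-1\notin\mathbb{N},\\ n^{\frac1p-1}, & \alpha\notin\mathbb{N}\ \text{and}\ \alpha<\frac1p-1.\end{cases}$$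
   Context: $\mathbb{T}\cong[0,2\pi)$; $L_p(\mathbb{T})$, $0<p<\infty$, is the space of measurable complex $2\pi$-periodic functions with $\|f\|_p=\left(\frac1{2\pi}\int_{\mathbb{T}}|f(x)|^p\,dx\right)^{1/p}<\infty$. $\mathbb{N}$ is the set of positive integers. $\mathcal{T}_n$ is the set of trigonometric polynomials of order at most $n$ ($\mathcal{T}_0$ being the constants), and $E_n(f)_p=\inf_{T\in\mathcal{T}_n}\|f-T\|_p$. For $\alpha>0$, $\Delta_\delta^\alpha f(x)=\sum_{\nu=0}^\infty\binom{\alpha}{\nu}(-1)^\nu f(x-\nu\delta)$, where $\binom{\alpha}{\nu}=\frac{\alpha(\alpha-1)\dots(\alpha-\nu+1)}{\nu!}$ for $\nu\ge1$ and $\binom{\alpha}{0}=1$; the modulus of smoothness of order $\alpha$ is $\omega_\alpha(f,h)_p=\sup_{|\delta|<h}\|\Delta_\delta^\alpha f\|_p$. For $f\in L_1(\mathbb{T})$ and $\alpha\in\mathbb{R}$ the Weyl derivative $f^{(\alpha)}$ (fractional integral if $\alpha<0$) is given by $f^{(\alpha)}(x)\sim\sum_{k\in\mathbb{Z}\setminus\{0\}}(ik)^\alpha\widehat{f}_k e^{ikx}$, where $(ik)^\alpha=|k|^\alpha e^{i\frac{\alpha\pi}{2}\operatorname{sign}k}$ and $\widehat f_k=\frac1{2\pi}\int_0^{2\pi}f(x)e^{-ikx}dx$; $f^{(\alpha)}\in L_1(\mathbb{T})$ means that this series is the Fourier series of a function in $L_1(\mathbb{T})$, denoted $f^{(\alpha)}$.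 *)

(* Defs.v *)
From HB Require Import structures.
From mathcomp Require Import all_boot all_order all_algebra.
From mathcomp Require Import all_classical all_reals all_analysis.
From mathcomp Require Export complex.

Set Implicit Arguments.
Unset Strict Implicit.
Unset Printing Implicit Defensive.

Import Order.TTheory GRing.Theory Num.Theory.
Import numFieldNormedType.Exports.

Import ComplexField.Normc.

Local Open Scope classical_set_scope.
Local Open Scope complex_scope.
Local Open Scope ring_scope.

Definition is_posnat (R : realType) (x : R) : bool :=
  (x \is a Num.nat) && (0 < x).

Definition expi (R : realType) (t : R) : R[i] := cos t +i* sin t.

(* A fundamental domain: functions on the torus are represented by
   2 pi-periodic functions on the whole line, integrated over [0, 2 pi). *)
Definition torus (R : realType) : set R := `[0, 2 * pi[.
Arguments torus : clear implicits.

(* For 0 < p; the value is +oo when f is measurable but not in L_p. *)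
Definition Lp_norm (R : realType) (p : R) (f : R -> R[i]) : \bar R :=
  ((((2 * pi)^-1)%:E *
    \int[lebesgue_measure]_(x in torus R) (normc (f x) `^ p)%:E) `^ p^-1)%E.

Definition Lp_torus (R : realType) (p : R) (f : R -> R[i]) : Prop :=
  [/\ measurable_fun setT (fun x : R => complex.Re (f x)),
      measurable_fun setT (fun x : R => complex.Im (f x)),
      (forall x, f (x + 2 * pi) = f x)
    & (Lp_norm p f < +oo)%E].

Definition trig_poly (R : realType) (n : nat) : set (R -> R[i]) :=
  [set T | exists c : int -> R[i], forall x,
     T x = \sum_(j < n.*2.+1)
             c (j%:Z - n%:Z) * expi ((j%:Z - n%:Z)%:~R * x)].

Definition best_approx (R : realType) (p : R) (f : R -> R[i]) (n : nat) :
    \bar R :=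
  ereal_inf [set Lp_norm p (fun x => f x - T x) | T in trig_poly n].

Definition gbinom (R : realType) (alpha : R) (nu : nat) : R :=
  (\prod_(j < nu) (alpha - j%:R)) / (nu`!)%:R.

(* For f in L_1 and alpha > 0 the series converges absolutely for almost every
   x; elsewhere [limn] returns an arbitrary value. The regular algebra R[i]^o
   carries the topology of the complex plane. *)
Definition fdiff (R : realType) (alpha delta : R) (f : R -> R[i]) (x : R) :
    R[i] :=
  limn (series (fun nu : nat =>
    (gbinom alpha nu * (-1) ^+ nu)%:C * f (x - nu%:R * delta) : R[i]^o)).

Definition modulus (R : realType) (alpha p : R) (f : R -> R[i]) (h : R) :
    \bar R :=
  ereal_sup [set Lp_norm p (fdiff alpha delta f) |
             delta in [set delta : R | `|delta| < h]].

Definition torus_integral (R : realType) (f : R -> R[i]) : R[i] :=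
  (\int[lebesgue_measure]_(x in torus R) complex.Re (f x)) +i*
  (\int[lebesgue_measure]_(x in torus R) complex.Im (f x)).

Definition fourier_coef (R : realType) (f : R -> R[i]) (k : int) : R[i] :=
  ((2 * pi)^-1)%:C * torus_integral (fun x => f x * expi (- (k%:~R * x))).

Definition ik_pow (R : realType) (alpha : R) (k : int) : R[i] :=
  ((`|k|%:~R : R) `^ alpha)%:C * expi (alpha * pi / 2 * (sgz k)%:~R).

(* g is (a representative of) the Weyl derivative of order alpha of f, that is,
   the series sum_{k <> 0} (ik)^alpha f^_k e^{ikx} is the Fourier series of g. *)
Definition is_weyl_derivative (R : realType) (alpha : R) (f g : R -> R[i]) :
    Prop :=
  Lp_torus 1 g /\
  forall k : int,
    fourier_coef g k = if k == 0 then 0 else ik_pow alpha k * fourier_coef f k.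

Definition sigma (R : realType) (alpha p : R) (n : nat) : R :=
  if is_posnat alpha || (p^-1 - 1 < alpha) then n%:R `^ alpha
  else if alpha == p^-1 - 1 then n%:R `^ (p^-1 - 1) * ln (n.+1)%:R `^ p^-1
  else n%:R `^ (p^-1 - 1).

(* Main.v *)
(* Put A_M f = (M / 2 pi)^alpha Delta_h^alpha f with h = 2 pi / M. On this grid
   the difference is a combination of M translates, whose coefficients are those
   of (1 - z)^alpha summed over the residue classes mod M; hence A_M is bounded on
   L_p, 0 < p < 1, with constant C sigma(M). It replaces the Weyl derivative:
   - A_M f tends to f^(alpha) in L_1. This is clear for trigonometric polynomials,
     hence for Cesaro means, and it passes to the limit because the coefficients of
     ((1 - z^m) / (1 - z))^alpha have absolute sum O(m^alpha), which gives
     |A_M T|_1 <= C |T^(alpha)|_1 for every trigonometric polynomial T.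
   - If T has order N and M >= C N, then |A_(M m) T|_p <= C |A_M T|_p. Indeed
     (1 - y^m)^alpha = m^alpha R^alpha (1 - y)^alpha, with R the mean of the powers
     y^l, l < m, and R acts on T as an average of small translations, which a kernel
     argument (Bernstein's inequality in L_p) shows to be close to the identity.
   If T_k is a near best approximation of order 2^k, the telescoping sum
   A_M T_K = sum_k A_M (T_k - T_(k-1)), with M = c 2^K, is estimated termwise, using
   |Delta_d^beta T|_p <= C min(1, N |d|)^beta |T|_p; a comparison of dyadic sums
   and K -> oo conclude. *)

Require Import Defs.
From mathcomp Require Import all_boot all_order all_algebra.
From mathcomp Require Import all_classical all_reals all_analysis.
From mathcomp Require Import measurable_realfun zify lra ring.

Set Implicit Arguments.
Unset Strict Implicit.
Unset Printing Implicit Defensive.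

Import Order.TTheory GRing.Theory Num.Theory.
Import numFieldNormedType.Exports.
Import ComplexField.Normc.

Local Open Scope classical_set_scope.
Local Open Scope complex_scope.
Local Open Scope ring_scope.

(** * Complex numbers and series *)

(** In L_p with p < 1 a function and its derivative are decoupled: polynomials may tend to 0 in L_p
    while their derivatives tend to 1. The derivative of f therefore cannot be recovered as an L_p
    limit of derivatives of the T_k. The membership of f^(alpha) in L_1 is what ties it to f: A_M f
    converges to it in L_1, hence in L_p. For a fixed M the operator A_M is continuous on L_p, so
    replacing f by T_K inside A_M costs only sigma(2^K)^p E_{2^K}(f)^p, one more term of the dyadic
    sum. The three cases of sigma are those of the sum of (j + 1)^(-(1 + alpha) p) over j < M:
    bounded, logarithmic, or a power of M. The cut at j < M is the effect of the grid, where
    periodicity folds the series. The condition M >= C N keeps k h small for all frequencies k of T.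
    The arguments of 1 - y^m, R and 1 - y then stay within (-pi/2, pi/2), so that principal powers
    multiply, and R is close enough to the identity for its fractional power to be inverted by
    absorption. Integrals of |f|^p are estimated without the root, because they are subadditive for
    p <= 1. *)

Section complex_basics.
Variable R : realType.
Implicit Types (x y : R[i]) (r s t : R).

Lemma normc_ge0 x : 0 <= normc x.
Proof. by case: x => a b; rewrite /= sqrtr_ge0. Qed.

Lemma normcD x y : normc (x + y) <= normc x + normc y.
Proof. exact: le_normcD. Qed.

Lemma normcN' x : normc (- x) = normc x.
Proof. exact: normcN. Qed.

Lemma normcB x y : normc (x - y) <= normc x + normc y.
Proof. by rewrite -(normcN' y) normcD. Qed.

Lemma normc_distC x y : normc (x - y) = normc (y - x).
Proof. by rewrite -normcN' opprB. Qed.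

Lemma normc_real r : normc r%:C = `|r|.
Proof. by rewrite /= expr0n /= addr0 sqrtr_sqr. Qed.

Lemma normc_sum (I : Type) (s : seq I) (P : pred I) (F : I -> R[i]) :
  normc (\sum_(i <- s | P i) F i) <= \sum_(i <- s | P i) normc (F i).
Proof.
elim/big_ind2: _ => //; first by rewrite normc0.
by move=> a b c d ab cd; rewrite (le_trans (normcD _ _)) ?lerD.
Qed.

Lemma normcX x n : normc (x ^+ n) = normc x ^+ n.
Proof. by elim: n => [|n ih]; rewrite ?expr0 ?normc1 // !exprS normcM ih. Qed.

Lemma normcE x : normc x = Num.sqrt (complex.Re x ^+ 2 + complex.Im x ^+ 2).
Proof. by case: x. Qed.

Lemma normc_sqr x : normc x ^+ 2 = complex.Re x ^+ 2 + complex.Im x ^+ 2.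
Proof. by rewrite normcE sqr_sqrtr // addr_ge0 ?sqr_ge0. Qed.

Lemma normc_ge_Re x : `|complex.Re x| <= normc x.
Proof.
by rewrite normcE -sqrtr_sqr ler_wsqrtr// lerDl sqr_ge0.
Qed.

Lemma normc_ge_Im x : `|complex.Im x| <= normc x.
Proof.
by rewrite normcE -sqrtr_sqr ler_wsqrtr// lerDr sqr_ge0.
Qed.

Lemma normc_le_ReIm x : normc x <= `|complex.Re x| + `|complex.Im x|.
Proof.
case: x => a b /=; rewrite -(ler_pXn2r (n := 2)) ?nnegrE ?sqrtr_ge0 ?addr_ge0//.
rewrite sqr_sqrtr ?addr_ge0 ?sqr_ge0// sqrrD !real_normK ?num_real//.
by rewrite lerD2r lerDl mulrn_wge0// mulr_ge0.
Qed.

Lemma ReD x y : complex.Re (x + y) = complex.Re x + complex.Re y.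
Proof. by case: x y => a b [c d]. Qed.

Lemma ImD x y : complex.Im (x + y) = complex.Im x + complex.Im y.
Proof. by case: x y => a b [c d]. Qed.

Lemma ReN x : complex.Re (- x) = - complex.Re x.
Proof. by case: x. Qed.

Lemma ImN x : complex.Im (- x) = - complex.Im x.
Proof. by case: x. Qed.

Lemma ReM x y : complex.Re (x * y) =
  complex.Re x * complex.Re y - complex.Im x * complex.Im y.
Proof. by case: x y => a b [c d]. Qed.

Lemma ImM x y : complex.Im (x * y) =
  complex.Re x * complex.Im y + complex.Im x * complex.Re y.
Proof. by case: x y => a b [c d]. Qed.

Lemma Re_sum (I : Type) (s : seq I) (P : pred I) (F : I -> R[i]) :
  complex.Re (\sum_(i <- s | P i) F i) = \sum_(i <- s | P i) complex.Re (F i).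
Proof. by elim/big_ind2: _ => // a b c d <- <-; rewrite ReD. Qed.

Lemma Im_sum (I : Type) (s : seq I) (P : pred I) (F : I -> R[i]) :
  complex.Im (\sum_(i <- s | P i) F i) = \sum_(i <- s | P i) complex.Im (F i).
Proof. by elim/big_ind2: _ => // a b c d <- <-; rewrite ImD. Qed.

Lemma complex_eqP x y :
  complex.Re x = complex.Re y -> complex.Im x = complex.Im y -> x = y.
Proof. by case: x y => a b [c d] /= -> ->. Qed.

Lemma expiD s t : expi (s + t) = expi s * expi t.
Proof.
apply: complex_eqP; rewrite /expi ?ReM ?ImM /= ?cosD ?sinD//.
by rewrite addrC.
Qed.

Lemma expi0 : expi (0 : R) = 1.
Proof. by rewrite /expi cos0 sin0. Qed.

Lemma normc_expi t : normc (expi t) = 1.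
Proof. by rewrite /= cos2Dsin2 sqrtr1. Qed.

Lemma expi_neq0 t : expi t != 0.
Proof.
by apply/eqP => e0; have := normc_expi t; rewrite e0 normc0 => /esym/eqP; rewrite oner_eq0.
Qed.

Lemma expiMn n t : expi (n%:R * t) = expi t ^+ n.
Proof.
elim: n => [|n ih]; first by rewrite mul0r expi0.
by rewrite -natr1 mulrDl mul1r expiD ih exprSr.
Qed.

Lemma expiN t : expi (- t) = (expi t)^-1.
Proof.
by apply: (mulIf (expi_neq0 t)); rewrite mulVf ?expi_neq0// -expiD addNr expi0.
Qed.

Lemma expi_2pi : expi (2 * pi) = 1 :> R[i].
Proof. by rewrite /expi mulr_natl cos2pi sin2pi. Qed.

Lemma expi_2piMn (n : nat) : expi (n%:R * (2 * pi)) = 1 :> R[i].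
Proof. by rewrite expiMn expi_2pi expr1n. Qed.

Lemma expi_2piMz (k : int) : expi (k%:~R * (2 * pi)) = 1 :> R[i].
Proof.
case: k => n; first exact: expi_2piMn.
by rewrite NegzE mulrNz mulNr expiN expi_2piMn invr1.
Qed.

End complex_basics.

(** * Sums of [p]-th powers, [p <= 1] *)

Section real_sums.
Variable R : realType.
Implicit Types (a b : nat -> R) (p : R).

(** Summability of a nonnegative sequence, expressed by a bound on all partial sums: the bound is
    the quantity that is carried along, and no limit has to exist beforehand. *)
Definition bsum (a : nat -> R) (B : R) := forall n, \sum_(i < n) a i <= B.

Lemma bsum_ge0 a B : bsum a B -> 0 <= B.
Proof. by move/(_ 0%N); rewrite big_ord0. Qed.

(** For [0 < t <= 1] one has [t <= t^p]; this is applied to the fractions [x / (x + y)] and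
    [y / (x + y)], whose sum is 1. *)
Lemma powR_subadd p (x y : R) : 0 < p -> p <= 1 -> 0 <= x -> 0 <= y ->
  (x + y) `^ p <= x `^ p + y `^ p.
Proof.
move=> p0 p1 x0 y0; have [xy0|] := ltP 0 (x + y); last first.
  move=> xy; have -> : x + y = 0 by apply/eqP; rewrite eq_le xy addr_ge0.
  by rewrite powR0 ?gt_eqF// addr_ge0// powR_ge0.
have key z : 0 <= z -> z <= x + y ->
    z / (x + y) * (x + y) `^ p <= z `^ p.
  move=> z0 zxy; have [->|zn0] := eqVneq z 0; first by rewrite !mul0r powR_ge0.
  have zp : 0 < z by rewrite lt_neqAle eq_sym zn0.
  have -> : z `^ p = (z / (x + y)) `^ p * (x + y) `^ p.
    by rewrite -powRM ?divr_ge0 ?(ltW xy0)// divfK ?gt_eqF.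
  rewrite ler_wpM2r ?powR_ge0// ger1_powR//.
  by rewrite divr_gt0//= ler_pdivrMr// mul1r.
have -> : (x + y) `^ p = x / (x + y) * (x + y) `^ p + y / (x + y) * (x + y) `^ p.
  by rewrite -mulrDl -mulrDl divff ?mul1r// gt_eqF.
by apply: lerD; apply: key => //; rewrite ?lerDl ?lerDr.
Qed.

Lemma powR_sum_subadd p (I : Type) (s : seq I) (P : pred I) (F : I -> R) :
  0 < p -> p <= 1 -> (forall i, P i -> 0 <= F i) ->
  (\sum_(i <- s | P i) F i) `^ p <= \sum_(i <- s | P i) F i `^ p.
Proof.
move=> p0 p1 F0.
suff [_ //] : 0 <= \sum_(i <- s | P i) F i /\
   (\sum_(i <- s | P i) F i) `^ p <= \sum_(i <- s | P i) F i `^ p.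
elim/big_rec2: _ => [|i y1 y2 Pi [y20 ih]]; first by rewrite powR0 ?gt_eqF.
split; first by rewrite addr_ge0// F0.
by rewrite (le_trans (powR_subadd _ _ _ _))// ?F0// lerD2l.
Qed.

Lemma ler_powR2 p (x y : R) : 0 <= p -> 0 <= x -> x <= y -> x `^ p <= y `^ p.
Proof.
by move=> p0 x0 xy; apply: ge0_ler_powR => //; rewrite nnegrE// (le_trans x0).
Qed.

Lemma powR_inv_le p (x y : R) : 0 < p -> 0 <= x -> 0 <= y ->
  x `^ p <= y -> x <= y `^ p^-1.
Proof.
move=> p0 x0 y0 xy; have := ler_powR2 (ltW (_ : 0 < p^-1)) (powR_ge0 x p) xy.
by rewrite invr_gt0 -powRrM mulfV ?gt_eqF// powRr1// => /(_ p0).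
Qed.

Lemma powRVK p (y : R) : 0 < p -> 0 <= y -> (y `^ p^-1) `^ p = y.
Proof. by move=> p0 y0; rewrite -powRrM mulVf ?gt_eqF// powRr1. Qed.

End real_sums.

Section complex_series.
Variable R : realType.
Implicit Types (u v : nat -> R[i]) (S T : R[i]) (p B : R).

(* Convergence of a complex series, stated without the topology of [R[i]]. *)
Definition has_csum u S := forall e : R, 0 < e ->
  exists n0, forall n, (n0 <= n)%N -> normc (\sum_(i < n) u i - S) <= e.

Lemma has_csum_unique u S T : has_csum u S -> has_csum u T -> S = T.
Proof.
move=> hS hT; apply/eqP; rewrite -subr_eq0; apply/eqP/eq0_normc/eqP.
rewrite eq_le normc_ge0 andbT; apply/ler_addgt0Pl => e e0; rewrite addr0.
have e20 : 0 < e / 2 by rewrite divr_gt0.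
have [n hn] := hS _ e20; have [m hm] := hT _ e20.
pose k := maxn n m.
have -> : S - T = (\sum_(i < k) u i - T) - (\sum_(i < k) u i - S).
  by ring.
rewrite (le_trans (normcB _ _))// (splitr e) lerD//.
  by apply: hm; rewrite leq_maxr.
by apply: hn; rewrite leq_maxl.
Qed.

Lemma has_csumD u v S T : has_csum u S -> has_csum v T ->
  has_csum (fun n => u n + v n) (S + T).
Proof.
move=> hS hT e e0; have e20 : 0 < e / 2 by rewrite divr_gt0.
have [n hn] := hS _ e20; have [m hm] := hT _ e20.
exists (maxn n m) => k; rewrite geq_max => /andP[nk mk].
rewrite big_split/= opprD addrACA (le_trans (normcD _ _))// (splitr e).
by rewrite lerD// ?hn ?hm.
Qed.

Lemma has_csumZ u S (c : R[i]) : has_csum u S ->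
  has_csum (fun n => c * u n) (c * S).
Proof.
move=> hS e e0; have c1 : 0 < normc c + 1 by rewrite ltr_wpDl ?normc_ge0.
have [n hn] := hS _ (divr_gt0 e0 c1); exists n => k nk.
rewrite -mulr_sumr -mulrBr normcM.
rewrite (le_trans (ler_wpM2l (normc_ge0 _) (hn _ nk)))//.
rewrite mulrC -mulrA ler_piMr ?(ltW e0)//.
by rewrite mulrC ler_pdivrMr// mul1r lerDl.
Qed.

Lemma has_csum_ext u v S : u =1 v -> has_csum u S -> has_csum v S.
Proof. by move=> /funext ->. Qed.

Lemma has_csum_fin u (n : nat) : (forall k, (n <= k)%N -> u k = 0) ->
  has_csum u (\sum_(i < n) u i).
Proof.
move=> un e e0; exists n => k nk.
rewrite -(subnKC nk) big_split_ord/= addrAC subrr add0r big1 ?normc0 ?ltW//.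
by move=> i _; rewrite un// leq_addr.
Qed.

Lemma has_csum_sum (I : Type) (s : seq I) (U : I -> nat -> R[i]) (V : I -> R[i]) :
  (forall i, has_csum (U i) (V i)) ->
  has_csum (fun n => \sum_(i <- s) U i n) (\sum_(i <- s) V i).
Proof.
move=> h; elim: s => [|i s ih].
  rewrite big_nil; under [X in has_csum X]funext do rewrite big_nil.
  by have := @has_csum_fin (fun=> 0) 0 (fun _ _ => erefl); rewrite big_ord0.
rewrite big_cons; apply: has_csum_ext (has_csumD (h i) ih) => n.
by rewrite big_cons.
Qed.

Lemma has_csum_le u S B : has_csum u S -> bsum (fun n => normc (u n)) B -> normc S <= B.
Proof.
move=> hS hB; apply/ler_addgt0Pr => e e0; have [n hn] := hS _ e0.
have -> : S = (\sum_(i < n) u i) - (\sum_(i < n) u i - S) by ring.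
apply: le_trans (normcB _ _) _; apply: lerD; last exact: hn (leqnn _).
exact: le_trans (normc_sum _ _ _) (hB n).
Qed.

(** For [p <= 1] a sum of moduli is at most the [p]-th root of the sum of their [p]-th powers, and
    this bound passes to the limit. *)
Lemma has_csum_powR_le p u S B : 0 < p -> p <= 1 -> has_csum u S ->
  bsum (fun n => normc (u n) `^ p) B -> normc S `^ p <= B.
Proof.
move=> p0 p1 hS hB; have B0 := bsum_ge0 hB.
rewrite -(powRVK p0 B0) ler_powR2 ?(ltW p0) ?normc_ge0//.
apply: has_csum_le hS _ => n; apply: powR_inv_le => //.
  by apply: sumr_ge0 => i _; exact: normc_ge0.
rewrite (le_trans (powR_sum_subadd _ p0 p1 _)) ?hB// => i _; exact: normc_ge0.
Qed.

Lemma bsum_powR p (a : nat -> R) B : 0 < p -> p <= 1 -> (forall n, 0 <= a n) ->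
  bsum (fun n => a n `^ p) B -> bsum a (B `^ p^-1).
Proof.
move=> p0 p1 a0 hB n; apply: powR_inv_le => //; [exact: sumr_ge0| exact: bsum_ge0 hB|].
by rewrite (le_trans (powR_sum_subadd _ p0 p1 _)).
Qed.

Lemma bsum_tail (a : nat -> R) B : (forall n, 0 <= a n) -> bsum a B ->
  forall e, 0 < e -> exists n0, forall n m, (n0 <= n)%N -> (n <= m)%N ->
    \sum_(n <= i < m) a i <= e.
Proof.
move=> a0 hB e e0.
have ndS : nondecreasing_seq (series a).
  by apply/nondecreasing_seqP => n; rewrite seriesSr lerDl.
have cS : cvgn (series a).
  apply: nondecreasing_is_cvgn => //; exists B => _ [n _ <-].
  by rewrite /series/= big_mkord.
have /cvgrPdist_le /(_ _ e0) [n0 _ hn0] := cS.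
exists n0 => n m nn nm; have := hn0 n nn; rewrite ler_distl => /andP[_ h].
by rewrite -sub_series_geq// lerBlDl (le_trans (nondecreasing_cvgn_le ndS cS m)).
Qed.

Lemma csum_exists u B : bsum (fun n => normc (u n)) B -> exists S, has_csum u S.
Proof.
move=> hB.
have part (f : R[i] -> R) : (forall x, `|f x| <= normc x) -> cvgn (series (f \o u)).
  move=> fle; apply: (@normed_cvg _ R^o); apply: nondecreasing_is_cvgn.
    by apply/nondecreasing_seqP => n; rewrite /= /series/= big_nat_recr//= lerDl.
  exists B => _ [n _ <-]; rewrite /= /series/= big_mkord.
  by rewrite (le_trans _ (hB n))//; apply: ler_sum => i _ /=; exact: fle.
have cR := part _ (@normc_ge_Re R); have cI := part _ (@normc_ge_Im R).
exists (limn (series (@complex.Re R \o u)) +i* limn (series (@complex.Im R \o u))).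
move=> e e0; have e20 : 0 < e / 2 by rewrite divr_gt0.
have /cvgrPdist_le /(_ _ e20) [n _ hn] := cR.
have /cvgrPdist_le /(_ _ e20) [m _ hm] := cI.
exists (maxn n m) => k; rewrite geq_max => /andP[nk mk].
rewrite (le_trans (normc_le_ReIm _))// (splitr e) ReD ImD ReN ImN /= Re_sum Im_sum.
rewrite lerD// distrC; [move: (hn k nk)|move: (hm k mk)];
by rewrite /series /= big_mkord.
Qed.

End complex_series.

(** * Binomial coefficients of fractional order *)

Section conv.
Variable R : realType.
Implicit Types (u v w : nat -> R) (p B : R).

Definition conv (T : pzSemiRingType) (u v : nat -> T) (n : nat) : T :=
  \sum_(i < n.+1) u i * v (n - i)%N.

(** Up to a given rank a Cauchy product is a product of truncated polynomials; commutativity and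
    associativity are inherited from polynomials. *)
Lemma conv_coef (T : comNzRingType) (u v : nat -> T) n N : (n < N)%N ->
  conv u v n = ((\poly_(i < N) u i) * (\poly_(i < N) v i))`_n.
Proof.
move=> nN; rewrite coefM; apply: eq_bigr => i _; rewrite !coef_poly.
have hi : (i < N)%N by rewrite (leq_ltn_trans _ nN)// -ltnS.
by rewrite hi (leq_ltn_trans (leq_subr _ _) nN).
Qed.

Lemma convC (T : comNzRingType) (u v : nat -> T) n : conv u v n = conv v u n.
Proof. by rewrite !(@conv_coef _ _ _ n n.+1)// mulrC. Qed.

Lemma convA (T : comNzRingType) (u v w : nat -> T) n :
  conv u (conv v w) n = conv (conv u v) w n.
Proof.
pose P (f : nat -> T) := \poly_(i < n.+1) f i.
transitivity ((P u * (P v * P w))`_n); last rewrite mulrA.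
  rewrite coefM; apply: eq_bigr => i _; rewrite coef_poly ltn_ord.
  by rewrite (conv_coef _ _ (N := n.+1))// ltnS leq_subr.
rewrite coefM; apply: eq_bigr => i _; rewrite [(P w)`_ _]coef_poly ltnS leq_subr.
by rewrite (conv_coef _ _ (N := n.+1))// ltn_ord.
Qed.

Lemma conv_delta (T : comNzRingType) (u : nat -> T) n :
  conv (fun k => (k == 0)%:R) u n = u n.
Proof.
rewrite /conv big_ord_recl/= mul1r subn0 big1 ?addr0// => i _.
by rewrite mul0r.
Qed.

Lemma sum_conv (T : comNzRingType) (u v : nat -> T) N :
  \sum_(n < N) conv u v n = \sum_(i < N) u i * \sum_(j < N - i) v j.
Proof.
elim: N => [|N ih]; first by rewrite !big_ord0.
rewrite big_ord_recr/= ih [RHS]big_ord_recr/= subSn// subnn big_ord1.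
under [X in _ = X + _]eq_bigr => i _ do
  rewrite subSn ?(ltnW (ltn_ord i))// big_ord_recr/= mulrDr.
by rewrite big_split/= -addrA; congr +%R; rewrite /conv big_ord_recr/= subnn.
Qed.

Lemma bsum_conv u v A B : (forall k, 0 <= u k) -> (forall k, 0 <= v k) ->
  bsum u A -> bsum v B -> bsum (conv u v) (A * B).
Proof.
move=> u0 v0 hA hB n; rewrite sum_conv.
apply: (@le_trans _ _ (\sum_(i < n) u i * B)).
  by apply: ler_sum => i _; rewrite ler_wpM2l.
by rewrite -mulr_suml ler_wpM2r// (bsum_ge0 hB).
Qed.

End conv.

Section cauchy_product.
Variable R : realType.
Implicit Types (u v : nat -> R[i]).

(** Mertens' argument. For [i < n0] the inner partial sum of [v] is close to [T]; the remaining
    [u i] have a small total modulus, and their inner sums stay bounded; what is left is the error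
    of the partial sum of [u], times [T]. *)
Lemma has_csum_conv u v S T A B : has_csum u S -> has_csum v T ->
  bsum (fun n => normc (u n)) A -> bsum (fun n => normc (v n)) B ->
  has_csum (conv u v) (S * T).
Proof.
move=> hS hT hA hB e e0.
have A0 := bsum_ge0 hA; have B0 := bsum_ge0 hB.
have K0 : 0 < A + B + normc T + 1.
  by rewrite ltr_wpDl// addr_ge0 ?normc_ge0// addr_ge0.
pose d := e / (3 * (A + B + normc T + 1)).
have d0 : 0 < d by rewrite divr_gt0// mulr_gt0.
have [n1 h1] := hS _ d0; have [n2 h2] := hT _ d0.
have [n3 h3] := bsum_tail (fun n => normc_ge0 (u n)) hA d0.
pose n0 := maxn n1 n3; exists (n0 + maxn n2 n1)%N => N hN.
have n0N : (n0 <= N)%N := leq_trans (leq_addr _ _) hN.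
rewrite sum_conv.
have -> : \sum_(i < N) u i * (\sum_(j < N - i) v j) - S * T =
   \sum_(i < N) u i * (\sum_(j < N - i) v j - T) + (\sum_(i < N) u i - S) * T.
  rewrite mulrBl mulr_suml addrA; congr (_ - _); rewrite -big_split/=.
  by apply: eq_bigr => i _; rewrite mulrBr subrK.
have hT' k : normc (\sum_(j < k) v j - T) <= B + normc T.
  rewrite (le_trans (normcB _ _))// lerD2r.
  by rewrite (le_trans (normc_sum _ _ _)).
have -> : e = (A * d + d * (B + normc T) + d * normc T) +
   (e - (A * d + d * (B + normc T) + d * normc T)) by ring.
rewrite -[leLHS]addr0 lerD//; last first.
  rewrite subr_ge0 (_ : _ + _ = d * (A + B + normc T + normc T)); last by ring.
  rewrite /d mulrAC ler_pdivrMr ?mulr_gt0// ler_wpM2l ?(ltW e0)//.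
  have := normc_ge0 T; lra.
rewrite (le_trans (normcD _ _))// lerD//; last first.
  rewrite normcM ler_wpM2r ?normc_ge0//; apply: h1.
  by rewrite (leq_trans _ n0N)// leq_maxl.
rewrite -(subnKC n0N) big_split_ord/= subnKC// (le_trans (normcD _ _))// lerD//.
  rewrite (le_trans (normc_sum _ _ _))//.
  apply: (@le_trans _ _ (\sum_(i < n0) normc (u i) * d)); last first.
    by rewrite -mulr_suml ler_wpM2r ?(ltW d0).
  apply: ler_sum => i _; rewrite normcM ler_wpM2l ?normc_ge0//; apply: h2.
  rewrite leq_subRL ?(leq_trans (ltnW (ltn_ord i)))//.
  rewrite (leq_trans _ hN)// leq_add ?leq_maxl//.
  exact: ltnW.
rewrite (le_trans (normc_sum _ _ _))//.
apply: (@le_trans _ _ (\sum_(i < N - n0) normc (u (n0 + i)%N) * (B + normc T))).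
  by apply: ler_sum => i _; rewrite normcM ler_wpM2l ?normc_ge0 ?hT'.
rewrite -mulr_suml ler_wpM2r ?addr_ge0 ?normc_ge0//.
have := h3 n0 N (leq_maxr _ _) n0N.
rewrite -{1}(add0n n0) big_addn big_mkord.
by under eq_bigr do rewrite addnC.
Qed.

Lemma bsum_normc_conv u v A B :
  bsum (fun n => normc (u n)) A -> bsum (fun n => normc (v n)) B ->
  bsum (fun n => normc (conv u v n)) (A * B).
Proof.
move=> hA hB n.
apply: le_trans (bsum_conv (fun k => normc_ge0 (u k)) (fun k => normc_ge0 (v k)) hA hB n).
apply: ler_sum => i _; rewrite (le_trans (normc_sum _ _ _))//.
by apply: ler_sum => j _; rewrite normcM.
Qed.

End cauchy_product.

Section gbinom_theory.
Variable R : realType.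
Implicit Types (a b : R) (n : nat).

(* Coefficients of [(1 - z)^a]. *)
Definition dcoef a n : R := gbinom a n * (-1) ^+ n.

Lemma gbinom0 a : gbinom a 0 = 1.
Proof. by rewrite /gbinom big_ord0 fact0 divr1. Qed.

Lemma gbinomS a n : n.+1%:R * gbinom a n.+1 = (a - n%:R) * gbinom a n.
Proof.
rewrite /gbinom big_ord_recr/= factS natrM invfM mulrACA [in RHS]mulrA.
rewrite mulrA [n.+1%:R * _]mulrCA -[in RHS]mulrA [in RHS]mulrCA.
have n0 : n.+1%:R != 0 :> R by rewrite pnatr_eq0.
by field; rewrite pnatr_eq0 -lt0n fact_gt0 addrC natr1 n0.
Qed.

Lemma dcoef0 a : dcoef a 0 = 1.
Proof. by rewrite /dcoef gbinom0 mulr1. Qed.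

Lemma dcoefS a n : n.+1%:R * dcoef a n.+1 = (n%:R - a) * dcoef a n.
Proof. by rewrite /dcoef exprS mulrA gbinomS; ring. Qed.

Lemma dcoefS' a n : dcoef a n.+1 = (n%:R - a) / n.+1%:R * dcoef a n.
Proof.
by rewrite mulrAC -dcoefS mulrAC divff ?mul1r// pnatr_eq0.
Qed.

(** Vandermonde's identity, by induction on the recurrence [dcoefS]: multiplication by
    [n + 1 = i + (n + 1 - i)] splits each product of coefficients in two, and the recurrence lowers
    one index in each. *)
Lemma dcoefD a b n : dcoef (a + b) n = conv (dcoef a) (dcoef b) n.
Proof.
elim: n => [|n ih]; first by rewrite /conv big_ord1 !dcoef0 mulr1.
have n0 : n.+1%:R != 0 :> R by rewrite pnatr_eq0.
apply: (mulfI n0); rewrite dcoefS ih /conv.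
transitivity (\sum_(i < n.+2) i%:R * dcoef a i * dcoef b (n.+1 - i)%N +
    \sum_(i < n.+2) dcoef a i * ((n.+1 - i)%N%:R * dcoef b (n.+1 - i)%N)); last first.
  rewrite -big_split mulr_sumr/=; apply: eq_bigr => i _.
  have hi : (i <= n.+1)%N by rewrite -ltnS.
  by rewrite natrB//; ring.
rewrite [X in _ = X + _]big_ord_recl/= !mul0r add0r [X in _ = _ + X]big_ord_recr/= subnn mul0r mulr0 addr0.
rewrite -big_split mulr_sumr/=; apply: eq_bigr => i _.
have hi : (i <= n)%N by rewrite -ltnS.
rewrite /bump/= add1n dcoefS subSS subSn// dcoefS natrB//; ring.
Qed.

Lemma dcoef1 n : dcoef 1 n = if n is 0 then 1 else if n is 1 then -1 else 0 :> R.
Proof.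
case: n => [|[|n]]; rewrite ?dcoef0//.
  by rewrite dcoefS' dcoef0 sub0r mulr1 divr1.
elim: n => [|n ih]; first by rewrite dcoefS' subrr !mul0r.
by rewrite dcoefS' ih mulr0.
Qed.

Lemma dcoef_a0 n : dcoef 0 n = (n == 0)%:R :> R.
Proof.
case: n => [|n]; first by rewrite dcoef0.
elim: n => [|n ih]; first by rewrite dcoefS' subr0 !mul0r.
by rewrite dcoefS' ih mulr0.
Qed.


Lemma powR_le_expR (x r : R) : 0 <= x -> 0 <= r -> (1 + x) `^ r <= expR (r * x).
Proof.
move=> x0 r0; have x1 : 0 < 1 + x by rewrite ltr_pwDl.
rewrite /powR gt_eqF// ler_expR ler_wpM2l// le_ln1Dx// (lt_le_trans _ x0)//.
Qed.

(* From rank [a] on, [|dcoef a n| (n+1)^(a+1)] decreases. *)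
Lemma dcoef_decay a : 0 < a -> exists2 C, 0 < C &
  forall n, `|dcoef a n| <= C * n.+1%:R `^ (- (1 + a)).
Proof.
move=> a0; have a10 : 0 <= 1 + a by rewrite addr_ge0 ?ltW.
pose w n := `|dcoef a n| * n.+1%:R `^ (1 + a).
have wn0 n : 0 <= w n by rewrite mulr_ge0 ?powR_ge0.
have wS n : a <= n%:R -> w n.+1 <= w n.
  move=> an; rewrite /w dcoefS' normrM mulrAC [leRHS]mulrC ler_wpM2r//.
  rewrite normf_div ger0_norm ?subr_ge0// ger0_norm// mulrAC ler_pdivrMr// mulrC.
  have -> : n.+2%:R = (1 + n.+1%:R^-1) * n.+1%:R :> R.
    by rewrite mulrDl mulVf ?pnatr_eq0// mul1r natr1.
  rewrite powRM ?addr_ge0 ?invr_ge0//.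
  set x := n.+1%:R^-1; have x0 : 0 <= x by rewrite invr_ge0.
  have -> : n%:R - a = (1 - (1 + a) * x) * n.+1%:R.
    by rewrite mulrBl -mulrA mulVf ?pnatr_eq0// -natr1; ring.
  have -> : forall b c d f : R, b * c * (d * f) = b * d * (c * f) by move=> *; ring.
  rewrite ler_piMl ?mulr_ge0 ?powR_ge0//.
  (* With [x = 1 / (n + 1)] the quotient of consecutive values of [w] is
     [(1 + x)^(1 + a) (1 - (1 + a) x)]; its factors are at most [exp ((1 + a) x)] and
     [exp (- (1 + a) x)]. *)
  rewrite (le_trans (_ : _ <= expR ((1 + a) * x) * expR (- ((1 + a) * x))))//; last first.
    by rewrite -expRD subrr expR0.
  rewrite (@le_trans _ _ (expR ((1 + a) * x) * (1 - (1 + a) * x)))//.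
    rewrite ler_wpM2r ?powR_le_expR//.
    have -> : 1 - (1 + a) * x = (n%:R - a) * x.
      by rewrite /x -natr1; field; rewrite natr1 pnatr_eq0.
    by rewrite mulr_ge0// subr_ge0.
  by rewrite ler_wpM2l ?expR_ge0// expR_ge1Dx.
pose N0 := Num.bound a.
have aN : a <= N0%:R by rewrite ltW// archi_boundP// ltW.
exists (1 + \sum_(i < N0.+1) w i) => [|n]; first by rewrite ltr_pwDl// sumr_ge0.
rewrite powRN ler_pdivlMr ?powR_gt0//.
rewrite -/(w n).
suff : w n <= \sum_(i < N0.+1) w i by move=> h; rewrite (le_trans h)// lerDr.
have small m : (m <= N0)%N -> w m <= \sum_(i < N0.+1) w i.
  move=> mN; rewrite (bigD1 (Ordinal (_ : m < N0.+1)%N))//=.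
  by rewrite lerDl sumr_ge0.
have [/small//|/ltnW/subnKC <-] := leqP n N0.
elim: (n - N0)%N => [|k ih]; first by rewrite addn0 small.
rewrite addnS (le_trans (wS _ _))// natrD (le_trans aN)// lerDl//.
Qed.

Lemma dcoef_le0 a n : 0 < a -> a <= 1 -> dcoef a n.+1 <= 0.
Proof.
move=> a0 a1; elim: n => [|n ih].
  by rewrite dcoefS' dcoef0 sub0r mulr1 divr1 oppr_le0 ltW.
rewrite dcoefS' mulr_ge0_le0// divr_ge0// subr_ge0.
by rewrite (le_trans a1)// ler1n.
Qed.

(** Taking partial sums is division by [1 - z]. *)
Lemma sum_dcoef a n : \sum_(i < n.+1) dcoef a i = dcoef (a - 1) n.
Proof.
elim: n => [|n ih]; first by rewrite big_ord1 !dcoef0.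
rewrite big_ord_recr/= ih.
have -> : dcoef a n.+1 = dcoef (a - 1) n.+1 - dcoef (a - 1) n.
  have {1}-> : a = 1 + (a - 1) by ring.
  rewrite (dcoefD 1 (a - 1)) /conv !big_ord_recl big1 ?addr0; last first.
    by move=> i _; rewrite dcoef1 mul0r.
  by rewrite !dcoef1 mul1r mulN1r lift0 subn0 subSS subn0.
by rewrite addrC subrK.
Qed.

Lemma dcoef_sub1_ge0 a n : 0 < a -> a <= 1 -> 0 <= dcoef (a - 1) n.
Proof.
move=> a0 a1; elim: n => [|n ih]; first by rewrite dcoef0.
rewrite dcoefS' mulr_ge0// divr_ge0//.
by rewrite subr_ge0 (le_trans (_ : _ <= 0)) ?subr_le0.
Qed.

(** All coefficients after the first are nonpositive while the partial sums of the whole series are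
    nonnegative, so the negative mass never exceeds the leading coefficient 1. *)
Lemma bsum_dcoefS a : 0 < a -> a <= 1 -> bsum (fun n => `|dcoef a n.+1|) 1.
Proof.
move=> a0 a1 n; under eq_bigr => i _ do rewrite ler0_norm ?dcoef_le0//.
have := sum_dcoef a n; rewrite big_ord_recl/= dcoef0 => h.
rewrite sumrN -subr_ge0 opprK h.
exact: dcoef_sub1_ge0.
Qed.

(* Domination in the order, for continuity of [(1 - z)^a] in [a]. *)
Lemma dcoef_dom a b n : 0 < a -> a <= b -> b <= 1 ->
  `|dcoef b n.+1| <= a^-1 * `|dcoef a n.+1|.
Proof.
move=> a0 ab b1; have b0 : 0 < b := lt_le_trans a0 ab.
elim: n => [|n ih].
  rewrite !dcoefS' !dcoef0 !sub0r !mulr1 !divr1 !normrN !gtr0_norm//.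
  by rewrite mulVf ?gt_eqF.
have h1 : 0 <= n.+1%:R - b by rewrite subr_ge0 (le_trans b1)// ler1n.
have h2 : n.+1%:R - b <= n.+1%:R - a by rewrite lerD2l lerN2.
have E c : `|dcoef c n.+2| = `|(n.+1%:R - c) / n.+2%:R| * `|dcoef c n.+1|.
  by rewrite dcoefS' normrM.
rewrite !E [leRHS]mulrCA; apply: ler_pM => //.
rewrite !normf_div ler_wpM2r ?invr_ge0// ger0_norm// (le_trans h2)//.
exact: ler_norm.
Qed.

Lemma dcoef_nat (m n : nat) : (m < n)%N -> dcoef m%:R n = 0.
Proof.
elim: n => // n ih; rewrite ltnS leq_eqVlt => /orP[/eqP ->|/ih h].
  by rewrite dcoefS' subrr !mul0r.
by rewrite dcoefS' h mulr0.
Qed.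

End gbinom_theory.

(** * Fractional powers of 1 - z *)

Section real_embedding.
Variable R : realType.
Implicit Types r s : R.

Lemma realcD r s : (r + s)%:C = r%:C + s%:C :> R[i].
Proof. by apply: complex_eqP => //=; rewrite addr0. Qed.

Lemma realcN r : (- r)%:C = - r%:C :> R[i].
Proof. by apply: complex_eqP => //=; rewrite oppr0. Qed.

Lemma realcM r s : (r * s)%:C = r%:C * s%:C :> R[i].
Proof. by apply: complex_eqP; rewrite ?ReM ?ImM /= ?mulr0 ?mul0r ?subr0 ?addr0. Qed.

Lemma realc_sum (I : Type) (t : seq I) (P : pred I) (F : I -> R) :
  (\sum_(i <- t | P i) F i)%:C = \sum_(i <- t | P i) (F i)%:C :> R[i].
Proof. by elim/big_rec2: _ => // i x y _ <-; rewrite realcD. Qed.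

Lemma realc_nat n : (n%:R : R)%:C = n%:R :> R[i].
Proof. by elim: n => // n ih; rewrite -!natr1 realcD ih. Qed.

End real_embedding.

Section binomial_series.
Variable R : realType.
Implicit Types (a b rho phi : R) (z w : R[i]) (n : nat).

Definition bterm a z n : R[i] := (dcoef a n)%:C * z ^+ n.

Lemma normc_bterm a z n : normc z <= 1 -> normc (bterm a z n) <= `|dcoef a n|.
Proof.
by move=> z1; rewrite normcM normc_real normcX ler_piMr// exprn_ile1// normc_ge0.
Qed.

Lemma bsum_bterm a z B : normc z <= 1 -> bsum (fun n => `|dcoef a n|) B ->
  bsum (fun n => normc (bterm a z n)) B.
Proof.
by move=> z1 hB n; rewrite (le_trans _ (hB n))//; apply: ler_sum => i _; exact: normc_bterm.
Qed.

Lemma conv_bterm a b z n : conv (bterm a z) (bterm b z) n = bterm (a + b) z n.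
Proof.
rewrite /bterm dcoefD /conv realc_sum mulr_suml; apply: eq_bigr => i _.
have hi : (i <= n)%N by rewrite -ltnS.
by rewrite mulrACA -exprD subnKC// realcM.
Qed.

Lemma bsum_dcoef1 a : 0 < a -> a <= 1 -> bsum (fun n => `|dcoef a n|) 2.
Proof.
move=> a0 a1 [|n]; first by rewrite big_ord0.
rewrite big_ord_recl dcoef0 normr1 -[leRHS]/(1 + 1) lerD2l.
by under eq_bigr do rewrite lift0; exact: bsum_dcoefS.
Qed.

(** The order is halved until it is at most 1; each doubling back is a Cauchy square, which squares
    the bound. *)
Lemma bsum_dcoef a : 0 < a -> exists B, bsum (fun n => `|dcoef a n|) B.
Proof.
move=> a0.
have half (c B : R) : 0 < c -> bsum (fun n => `|dcoef c n|) B ->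
    exists B', bsum (fun n => `|dcoef (c *+ 2) n|) B'.
  move=> c0 hB; exists (B * B) => n.
  apply: le_trans (bsum_conv (fun k => normr_ge0 (dcoef c k)) (fun k => normr_ge0 (dcoef c k)) hB hB n).
  apply: ler_sum => i _; rewrite mulr2n dcoefD (le_trans (ler_norm_sum _ _ _))//.
  by apply: ler_sum => j _; rewrite normrM.
have : exists k : nat, a / 2 ^+ k <= 1.
  have /cvgrPdist_le /(_ _ ltr01) [k _ hk] : (a * (2^-1) ^+ k) @[k --> \oo] --> (0 : R).
    by apply: cvg_geometric; rewrite ger0_norm ?invr_ge0// invf_lt1// ltr1n.
  by exists k; have := hk k (leqnn k); rewrite sub0r normrN exprVn => /(le_trans (ler_norm _)).
case=> k; elim: k a a0 => [|k ih] a a0.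
  by rewrite expr0 divr1 => a1; exists 2; exact: bsum_dcoef1.
rewrite exprS invfM mulrA => h.
have a20 : 0 < a / 2 by rewrite divr_gt0.
have [B hB] := ih _ a20 h; have [B' hB'] := half _ _ a20 hB.
have E : a / 2 *+ 2 = a by rewrite -[LHS]mulr_natr divfK// pnatr_eq0.
by exists B'; rewrite E in hB'.
Qed.

(* [(1 - z)^a] *)
Definition bser a z : R[i] :=
  xget 0 [set S | has_csum (bterm a z) S].

Lemma bserP a z : 0 < a -> normc z <= 1 -> has_csum (bterm a z) (bser a z).
Proof.
move=> a0 z1; have [B hB] := bsum_dcoef a0.
have [S hS] := csum_exists (bsum_bterm z1 hB).
by rewrite /bser; case: xgetP => [S' -> //|/(_ S)].
Qed.

Lemma bserE a z S : 0 < a -> normc z <= 1 -> has_csum (bterm a z) S -> bser a z = S.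
Proof. by move=> a0 z1; apply: has_csum_unique; exact: bserP. Qed.

Lemma bserD a b z : 0 < a -> 0 < b -> normc z <= 1 ->
  bser (a + b) z = bser a z * bser b z.
Proof.
move=> a0 b0 z1; apply: bserE; rewrite ?addr_gt0//.
have [A hA] := bsum_dcoef a0; have [B hB] := bsum_dcoef b0.
have := has_csum_conv (bserP a0 z1) (bserP b0 z1) (bsum_bterm z1 hA) (bsum_bterm z1 hB).
by apply: has_csum_ext => n; exact: conv_bterm.
Qed.

Lemma bser1 z : normc z <= 1 -> bser 1 z = 1 - z.
Proof.
move=> z1; apply: bserE => //.
have -> : 1 - z = \sum_(i < 2) bterm 1 z i.
  rewrite !big_ord_recl big_ord0 /bterm lift0 !dcoef1 expr0 expr1 addr0.
  by rewrite realcN mul1r mulN1r.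
by apply: has_csum_fin => -[|[|k]]// _; rewrite /bterm dcoef1 mul0r.
Qed.

Lemma bserMn a z n : 0 < a -> normc z <= 1 -> bser (a *+ n.+1) z = bser a z ^+ n.+1.
Proof.
move=> a0 z1; elim: n => [|n ih]; first by rewrite mulr1n expr1.
by rewrite mulrS exprS bserD// ?ih// pmulrn_lgt0.
Qed.

(** Some multiple of [a] exceeds 1, so a power of [bser a 1] contains the factor [1 - z] at
    [z = 1]. *)
Lemma bser_z0 a : 0 < a -> bser a 1 = 0.
Proof.
move=> a0; pose n := Num.bound a^-1.
have n1 : normc (1 : R[i]) <= 1 by rewrite normc1.
have an : 0 < a *+ n.+1 - 1.
  rewrite subr_gt0 -mulr_natr -ltr_pdivrMl// mulr1.
  by rewrite (lt_le_trans (archi_boundP _)) ?invr_ge0 ?(ltW a0)// ler_nat.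
have := bserMn n a0 n1; rewrite -(subrKC 1 (a *+ n.+1)) bserD// bser1// subrr mul0r.
by move=> /esym/eqP; rewrite expf_eq0/= => /eqP.
Qed.

Lemma normc_bserB1 a z : 0 < a -> a <= 1 -> normc z <= 1 -> normc (bser a z - 1) <= 1.
Proof.
move=> a0 a1 z1; apply/ler_addgt0Pr => e e0.
have [n0 hn] := bserP a0 z1 e0.
have := hn n0.+1 (leqnSn _); rewrite big_ord_recl /bterm dcoef0 expr0 mulr1.
set s := \sum_(i < n0) _ => h.
have -> : bser a z - 1 = s - ((1%:C + s) - bser a z) by ring.
rewrite (le_trans (normcB _ _))// lerD//.
rewrite (le_trans (normc_sum _ _ _))// (le_trans _ (bsum_dcoefS a0 a1 n0))//.
by apply: ler_sum => i _; rewrite lift0; exact: normc_bterm.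
Qed.

(** The closed disc of centre 1 and radius 1 meets the imaginary axis only at 0. With [normc_bserB1]
    and [bser_neq0] this keeps the sums of order at most 1 in the open right half-plane, where
    square roots are unique. *)
Lemma Re_gt0_of_near1 w : normc (w - 1) <= 1 -> w != 0 -> 0 < complex.Re w.
Proof.
move=> w1 w0.
have : normc (w - 1) ^+ 2 <= 1 by rewrite expr_le1// normc_ge0.
have : 0 < normc w ^+ 2.
  rewrite exprn_gt0// lt_neqAle normc_ge0 andbT eq_sym.
  by apply/eqP => /eq0_normc/eqP; apply/negP.
rewrite !normc_sqr ReD ImD ReN ImN /= subr0; lra.
Qed.

(** Multiplication by [(1 - z)^(n + 1 - a)] gives a power of [1 - z], which is nonzero. *)
Lemma bser_neq0 a z : 0 < a -> normc z <= 1 -> z != 1 -> bser a z != 0.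
Proof.
move=> a0 z1 zn1; apply/eqP => ba0.
pose n := Num.bound a.
have an : 0 < n.+1%:R - a.
  by rewrite subr_gt0 (lt_le_trans (archi_boundP (ltW a0)))// ler_nat.
have := bserMn n (ltr01 : 0 < 1 :> R) z1.
rewrite -[1 *+ n.+1]/(n.+1%:R) -(subrKC a n.+1%:R) bserD// ba0 mul0r bser1//.
by move=> /esym/eqP; rewrite expf_eq0/= subr_eq0 eq_sym (negbTE zn1).
Qed.

Lemma Re_bser_gt0 a z : 0 < a -> a <= 1 -> normc z <= 1 -> z != 1 ->
  0 < complex.Re (bser a z).
Proof.
by move=> a0 a1 z1 zn1; apply: Re_gt0_of_near1; [exact: normc_bserB1|exact: bser_neq0].
Qed.

Lemma sqrt_uniq (v w : R[i]) : v ^+ 2 = w ^+ 2 -> 0 < complex.Re v ->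
  0 < complex.Re w -> v = w.
Proof.
move=> /eqP; rewrite eqf_sqr => /orP[/eqP//|/eqP -> ]; rewrite ReN oppr_gt0.
by move=> h1 h2; have := lt_trans h1 h2; rewrite ltxx.
Qed.

(** The principal power [w^a] of [w = rho e^(i phi)] when [|phi| < pi / 2]. Modulus and argument are
    kept apart, so that powers add in [a] without any choice of a logarithm. *)
Definition polar (rho phi a : R) : R[i] := (rho `^ a)%:C * expi (a * phi).

Lemma polarD rho phi a b : 0 < rho ->
  polar rho phi (a + b) = polar rho phi a * polar rho phi b.
Proof.
move=> r0; have h : (a + b == 0) ==> (rho != 0) by apply/implyP => _; rewrite gt_eqF.
by rewrite /polar powRD// realcM mulrDl expiD mulrACA.
Qed.

Lemma polarMn rho phi a n : 0 < rho ->
  polar rho phi (a *+ n) = polar rho phi a ^+ n.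
Proof.
move=> r0; elim: n => [|n ih]; last by rewrite mulrS exprS polarD// ih.
by rewrite mulr0n /polar powRr0 mul0r expi0 mulr1.
Qed.

Lemma Re_polar_gt0 rho phi a : 0 < rho -> `|phi| < pi / 2 -> 0 < a -> a <= 1 ->
  0 < complex.Re (polar rho phi a).
Proof.
move=> r0 hphi a0 a1; rewrite /polar ReM /= mul0r subr0 mulr_gt0 ?powR_gt0//.
apply: cos_gt0_pihalf; rewrite -ltr_norml normrM gtr0_norm//.
by rewrite (le_lt_trans _ hphi)// ler_piMl.
Qed.

(** Orders [1 / 2^k] are reached by successive square roots: both sides have the same square and lie
    in the right half-plane. Integer powers then give all dyadic orders. *)
Lemma bser_polar_dyadic rho phi (k n : nat) : 0 < rho -> `|phi| < pi / 2 ->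
  normc (1 - polar rho phi 1) <= 1 ->
  bser (n.+1%:R / 2 ^+ k) (1 - polar rho phi 1) = polar rho phi (n.+1%:R / 2 ^+ k).
Proof.
move=> r0 hphi z1; set z := 1 - _.
have d0 j : 0 < (2 ^+ j)^-1 :> R by rewrite invr_gt0 exprn_gt0.
have d1 j : (2 ^+ j)^-1 <= 1 :> R by rewrite invf_le1 ?exprn_gt0// exprn_ege1// ler1n.
have zn1 : z != 1.
  rewrite /z -subr_eq0 addrAC subrr add0r oppr_eq0; apply/eqP => h.
  by have := Re_polar_gt0 r0 hphi (ltr01 : 0 < 1 :> R) (lexx 1); rewrite h ltxx.
have base : bser (2 ^+ k)^-1 z = polar rho phi (2 ^+ k)^-1.
  elim: k => [|k ih].
    by rewrite expr0 invr1 bser1// /z opprB addrC subrK.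
  apply: sqrt_uniq; [|exact: Re_bser_gt0|exact: Re_polar_gt0].
  rewrite -bserMn// -polarMn//.
  have -> : (2 ^+ k.+1)^-1 *+ 2 = (2 ^+ k)^-1 :> R.
    by rewrite exprS; field; rewrite expf_neq0// pnatr_eq0.
  exact: ih.
by rewrite mulr_natl bserMn// polarMn// base.
Qed.

End binomial_series.

Section binomial_polar.
Variable R : realType.
Implicit Types (a b rho phi : R) (z w : R[i]) (n : nat).

Lemma has_csum_tail (u : nat -> R[i]) S n0 e : has_csum u S ->
  (forall m, (n0 <= m)%N -> \sum_(n0 <= i < m) normc (u i) <= e) ->
  normc (S - \sum_(i < n0) u i) <= e.
Proof.
move=> hS he; apply/ler_addgt0Pr => d d0; have [n1 h1] := hS _ d0.
pose m := maxn n0 n1; have n0m : (n0 <= m)%N by rewrite leq_maxl.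
have -> : S - \sum_(i < n0) u i = (\sum_(n0 <= i < m) u i) - (\sum_(i < m) u i - S).
  have -> : \sum_(i < m) u i = \sum_(i < n0) u i + \sum_(n0 <= i < m) u i.
    by rewrite -!(big_mkord xpredT) -big_cat_nat.
  by ring.
apply: le_trans (normcB _ _) _; apply: lerD; last by apply: h1; rewrite leq_maxr.
by apply: le_trans (normc_sum _ _ _) _; exact: he.
Qed.

Lemma cvg_dcoef (b : nat -> R) a n : b k @[k --> \oo] --> a ->
  dcoef (b k) n @[k --> \oo] --> dcoef a n.
Proof.
move=> hb; elim: n => [|n ih].
  by under eq_fun do rewrite dcoef0; rewrite dcoef0; exact: cvg_cst.
under eq_fun do rewrite dcoefS'; rewrite dcoefS'.
apply: cvgM => //; apply: cvgM; last exact: cvg_cst.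
by apply: cvgB => //; exact: cvg_cst.
Qed.

(** The orders approach [a] from above, where the coefficients of order [a] dominate those of order
    [b k] up to the factor [1 / a]. Tails are thus uniformly small, and each of the finitely many
    remaining coefficients is continuous in the order. *)
Lemma bser_cvg (b : nat -> R) a z : 0 < a -> normc z <= 1 ->
  (forall k, a <= b k <= 1) -> b k @[k --> \oo] --> a ->
  normc (bser (b k) z - bser a z) @[k --> \oo] --> (0 : R).
Proof.
move=> a0 z1 hb cb; apply/cvgrPdist_le => e e0.
have a1 : a <= 1 by have /andP[] := hb 0%N; exact: le_trans.
have e30 : 0 < e / 3 by rewrite divr_gt0.
have [n0 hn0] := bsum_tail (fun n => normr_ge0 _) (bsum_dcoefS a0 a1) (mulr_gt0 a0 e30).
have tail c : a <= c -> c <= 1 ->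
    normc (bser c z - \sum_(i < n0.+1) bterm c z i) <= e / 3.
  move=> ac c1; apply: has_csum_tail; first exact: bserP (lt_le_trans a0 ac) z1.
  move=> [//|m] hm; rewrite big_add1/= -(ler_pM2l a0) mulr_sumr.
  rewrite (le_trans _ (hn0 n0 m (leqnn _) hm))//; apply: ler_sum => i _.
  rewrite mulrC -ler_pdivlMr// mulrC.
  exact: le_trans (normc_bterm _ _ z1) (dcoef_dom _ a0 ac c1).
have fin : \sum_(i < n0.+1) `|dcoef (b k) i - dcoef a i| @[k --> \oo] --> (0 : R).
  rewrite [X in _ --> X](_ : 0 = \sum_(i < n0.+1) `|dcoef a i - dcoef a i|); last first.
    by rewrite big1// => i _; rewrite subrr normr0.
  apply: cvg_big => [|i _]; first exact: add_continuous.
  apply: cvg_norm; apply: cvgB; last exact: cvg_cst.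
  exact: cvg_dcoef.
have /cvgrPdist_le /(_ _ e30) := fin; apply: filterS => k.
rewrite !sub0r !normrN (ger0_norm (normc_ge0 _)) ger0_norm ?sumr_ge0// => hk.
have /andP[h1 h2] := hb k.
have -> : bser (b k) z - bser a z = (bser (b k) z - \sum_(i < n0.+1) bterm (b k) z i)
  + (\sum_(i < n0.+1) bterm (b k) z i - \sum_(i < n0.+1) bterm a z i)
  - (bser a z - \sum_(i < n0.+1) bterm a z i) by ring.
have -> : e = e / 3 + e / 3 + e / 3 by field.
apply: le_trans (normcB _ _) _; apply: lerD; last exact: tail.
apply: le_trans (normcD _ _) _; apply: lerD; first exact: tail.
rewrite -sumrB (le_trans (normc_sum _ _ _))// (le_trans _ hk)//.
apply: ler_sum => i _; rewrite /bterm -mulrBl -realcN -realcD normcM normc_real normcX.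
by rewrite ler_piMr// exprn_ile1// normc_ge0.
Qed.

Lemma polar_cvg (b : nat -> R) a rho phi : 0 < rho -> b k @[k --> \oo] --> a ->
  normc (polar rho phi (b k) - polar rho phi a) @[k --> \oo] --> (0 : R).
Proof.
move=> r0 cb.
pose F c := `|complex.Re (polar rho phi c) - complex.Re (polar rho phi a)|
  + `|complex.Im (polar rho phi c) - complex.Im (polar rho phi a)|.
have cF : F (b k) @[k --> \oo] --> (0 : R).
  have -> : 0 = F a by rewrite /F !subrr normr0 addr0.
  have cp : rho `^ (b k) @[k --> \oo] --> rho `^ a.
    have E c : rho `^ c = expR (c * ln rho) by rewrite /powR (gt_eqF r0).
    under eq_fun do rewrite E; rewrite E.
    apply: continuous_cvg; first exact: continuous_expR.
    by apply: cvgM => //; exact: cvg_cst.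
  have cc : cos (b k * phi) @[k --> \oo] --> cos (a * phi).
    apply: continuous_cvg; first exact: continuous_cos.
    by apply: cvgM => //; exact: cvg_cst.
  have cs : sin (b k * phi) @[k --> \oo] --> sin (a * phi).
    apply: continuous_cvg; first exact: continuous_sin.
    by apply: cvgM => //; exact: cvg_cst.
  rewrite /F /polar; under eq_fun do rewrite !ReM !ImM /= !mul0r !subr0 !addr0.
  rewrite !ReM !ImM /= !mul0r !subr0 !addr0.
  by apply: cvgD; apply: cvg_norm; apply: cvgB; (try exact: cvg_cst); apply: cvgM.
apply: (@squeeze_cvgr _ _ _ _ (fun=> 0) (fun k => F (b k))) => //; last exact: cvg_cst.
apply: nearW => k; apply/andP; split; first exact: normc_ge0.
by rewrite (le_trans (normc_le_ReIm _))// ReD ImD ReN ImN.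
Qed.

Lemma bser_polar_half rho phi a : 0 < rho -> `|phi| < pi / 2 ->
  normc (1 - polar rho phi 1) <= 1 -> 0 < a -> a <= 2^-1 ->
  bser a (1 - polar rho phi 1) = polar rho phi a.
Proof.
move=> r0 hphi z1 a0 a1; set z := 1 - _.
(* [b k] is a dyadic number just above [a]: rounding up keeps it at least [a], as [bser_cvg]
   requires, and [a <= 1 / 2] keeps it at most 1. *)
pose nn k := Num.trunc (a * 2 ^+ k.+1).
pose b k : R := (nn k).+1%:R / 2 ^+ k.+1.
have p0 k : 0 < 2 ^+ k.+1 :> R by rewrite exprn_gt0.
have hb k : a <= b k <= a + 2^-1 ^+ k.+1.
  have := Num.Theory.truncn_itv (_ : 0 <= a * 2 ^+ k.+1).
  rewrite mulr_ge0 ?(ltW a0) ?(ltW (p0 k))// => /(_ isT) /andP[h1 h2].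
  rewrite /b ler_pdivlMr ?(ltW h2)//= -natr1 mulrDl lerD ?exprVn ?mul1r//.
  by rewrite ler_pdivrMr.
have cb : b k @[k --> \oo] --> a.
  apply: (@squeeze_cvgr _ _ _ _ (fun=> a) (fun k => a + 2^-1 ^+ k.+1)).
  - by apply: nearW.
  - exact: cvg_cst.
  - rewrite -[X in _ --> X]addr0; apply: cvgD; first exact: cvg_cst.
    rewrite (cvg_shiftS (fun k => 2^-1 ^+ k : R)); apply: cvg_expr.
    by rewrite ger0_norm ?invr_ge0// invf_lt1// ltr1n.
have hb1 k : a <= b k <= 1.
  have /andP[-> h] /= := hb k; rewrite (le_trans h)//.
  rewrite [leRHS](splitr 1) lerD ?div1r// exprS ler_piMr ?invr_ge0//.
  by rewrite exprn_ile1 ?invr_ge0// invf_le1// ler1n.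
have c1 := bser_cvg a0 z1 hb1 cb.
have c2 := polar_cvg phi r0 cb.
apply/eqP; rewrite -subr_eq0; apply/eqP/eq0_normc/eqP.
rewrite eq_le normc_ge0 andbT.
apply/ler_addgt0Pr => e e0; have e20 : 0 < e / 2 by rewrite divr_gt0.
have /cvgrPdist_le /(_ _ e20) [k1 _ h1] := c1.
have /cvgrPdist_le /(_ _ e20) [k2 _ h2] := c2.
pose k := maxn k1 k2.
have := h1 k (leq_maxl _ _); have := h2 k (leq_maxr _ _).
rewrite !sub0r !normrN !(ger0_norm (normc_ge0 _)) => h3 h4; rewrite add0r (splitr e).
have -> : bser a z - polar rho phi a = (polar rho phi (b k) - polar rho phi a) -
    (bser (b k) z - bser a z).
  by rewrite bser_polar_dyadic//; ring.
by apply: le_trans (normcB _ _) _; apply: lerD.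
Qed.

(* The binomial series sums to the principal power. *)
Lemma bser_polar rho phi a : 0 < rho -> `|phi| < pi / 2 ->
  normc (1 - polar rho phi 1) <= 1 -> 0 < a ->
  bser a (1 - polar rho phi 1) = polar rho phi a.
Proof.
move=> r0 hphi z1 a0; pose n := Num.bound (a * 2).
have n0 : 0 < n.+1%:R :> R by [].
have -> : a = (a / n.+1%:R) *+ n.+1 by rewrite -[RHS]mulr_natr divfK// gt_eqF.
rewrite bserMn ?divr_gt0// polarMn// bser_polar_half// ?divr_gt0//.
rewrite ler_pdivrMr// -ler_pdivrMl ?invr_gt0// invrK mulrC.
by rewrite (le_trans (ltW (archi_boundP _))) ?ler_nat// mulr_ge0// ltW.
Qed.

End binomial_polar.

Local Notation "z ^*" := (conjc z) : ring_scope.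

(** * Inequalities on the unit circle *)

Section trig_bounds.
Variable R : realType.
Implicit Types (t x u : R).

Lemma sin_MVT x : 0 < x -> exists2 c, 0 < c < x & sin x = cos c * x.
Proof.
move=> x0.
have [|c] := @MVT R sin cos 0 x x0 (fun y _ => is_derive_sin y).
  by apply: continuous_subspaceT; exact: continuous_sin.
rewrite in_itv /= => hc; rewrite sin0 !subr0 => h; by exists c.
Qed.

Lemma normr_sin_le x : `|sin x| <= `|x|.
Proof.
wlog x0 : x / 0 <= x.
  move=> h; have [/h//|/ltW xn] := leP 0 x.
  by rewrite -normrN -sinN -[leRHS]normrN h// oppr_ge0.
move: x0; rewrite le_eqVlt => /predU1P[<-|x0]; first by rewrite sin0 normr0.
have [c _ ->] := sin_MVT x0.
by rewrite normrM ler_piMl// cos_max.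
Qed.

Lemma sin_ge_xcos x : 0 <= x -> x <= pi -> x * cos x <= sin x.
Proof.
rewrite le_eqVlt => /predU1P[<- _|x0 xpi]; first by rewrite mul0r sin0.
have [c /andP[c0 cx] ->] := sin_MVT x0.
rewrite mulrC ler_wpM2r ?(ltW x0)// ltW// ltr_cos// in_itv/= ?(ltW x0)//.
by rewrite (ltW c0) ltW// (lt_le_trans cx).
Qed.

(** In [x^2 = x^2 cos^2 x + x^2 sin^2 x] the first term is at most [sin^2 x] by [sin_ge_xcos] and
    the second at most [4 sin^2 x] since [x <= 2]. The factor 3 is a bound for the square root of
    5. *)
Lemma sin_ge_third x : 0 <= x -> x <= pi / 2 -> x <= 3 * sin x.
Proof.
move=> x0 xpi.
have xpi' : x <= pi by rewrite (le_trans xpi)// ler_pdivrMr// ler_peMr ?pi_ge0// ler1n.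
have s0 : 0 <= sin x by apply: sin_ge0_pi; rewrite x0.
have c0 : 0 <= cos x.
  apply: cos_ge0_pihalf; rewrite xpi andbT (le_trans _ x0)// oppr_le0.
  by rewrite divr_ge0// pi_ge0.
have x2 : x <= 2 := le_trans xpi (ltW (@pihalf_lt2 R)).
have := sin_ge_xcos x0 xpi'; have := cos2Dsin2 x.
set s := sin x in s0 *; set c := cos x in c0 * => h1 h2.
rewrite -(ler_pXn2r (n := 2)) ?nnegrE ?mulr_ge0//.
have h3 : (x * c) ^+ 2 <= s ^+ 2 by rewrite ler_pXn2r ?nnegrE ?mulr_ge0.
have h4 : x ^+ 2 * s ^+ 2 <= 2 ^+ 2 * s ^+ 2.
  by rewrite ler_wpM2r ?sqr_ge0// ler_pXn2r// nnegrE.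
rewrite exprMn in h3; have h5 : c ^+ 2 = 1 - s ^+ 2 by lra.
rewrite h5 mulrBr mulr1 in h3; rewrite exprMn.
have := sqr_ge0 s; lra.
Qed.

Lemma half2 x : x = x / 2 + x / 2.
Proof. exact: splitr. Qed.

(** For [0 < u < pi] this is the polar form, with positive modulus and an argument strictly between
    0 and [pi / 2]. *)
Lemma one_sub_expi u :
  1 - expi (- u) = (2 * sin (u / 2))%:C * expi ((pi - u) / 2).
Proof.
have hc : cos u = 1 - 2 * sin (u / 2) ^+ 2.
  by rewrite {1}(half2 u) cosD -!expr2 cos2sin2; ring.
have hs : sin u = 2 * (sin (u / 2) * cos (u / 2)).
  by rewrite {1}(half2 u) sinD; ring.
have -> : (pi - u) / 2 = pi / 2 - u / 2 by rewrite mulrBl.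
apply: complex_eqP.
  rewrite /expi ReD ReN ReM /= mul0r subr0.
  by rewrite cosN cosB cos_pihalf sin_pihalf hc; ring.
rewrite /expi ImD ImN ImM /= mul0r addr0 add0r.
by rewrite sinN sinB cos_pihalf sin_pihalf opprK hs; ring.
Qed.

Lemma normc_one_sub_expi u : normc (1 - expi (- u)) = 2 * `|sin (u / 2)|.
Proof. by rewrite one_sub_expi normcM normc_expi mulr1 normc_real normrM ger0_norm. Qed.

Lemma normc_one_sub_expi_le u : normc (1 - expi u) <= `|u|.
Proof.
rewrite -(opprK u) normc_one_sub_expi normrN -ler_pdivlMl// mulrC.
by rewrite (le_trans (normr_sin_le _))// normrM normfV (@ger0_norm _ 2).
Qed.

Lemma normc_expiB s t : normc (expi s - expi t) <= `|s - t|.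
Proof.
have -> : expi s - expi t = expi s * (1 - expi (t - s)).
  by rewrite mulrBr mulr1 -expiD [s + _]addrC subrK.
by rewrite normcM normc_expi mul1r (le_trans (normc_one_sub_expi_le _))// distrC.
Qed.

Lemma expi_conj t : (expi t)^* = expi (- t).
Proof. by rewrite /expi cosN sinN. Qed.

End trig_bounds.

Section bser_on_circle.
Variable R : realType.
Implicit Types (a u x : R) (z w : R[i]).

Lemma normc_conj z : normc z^* = normc z.
Proof. by case: z => x y /=; rewrite sqrrN. Qed.

Lemma conjcR (r : R) : (r%:C)^* = r%:C :> R[i].
Proof. by apply: complex_eqP; rewrite //= oppr0. Qed.

Lemma conjcM z w : (z * w)^* = z^* * w^*.
Proof. exact: rmorphM. Qed.

Lemma conjcX z n : (z ^+ n)^* = z^* ^+ n.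
Proof. exact: rmorphXn. Qed.

Lemma conjc_sum (I : Type) (s : seq I) (P : pred I) (F : I -> R[i]) :
  (\sum_(i <- s | P i) F i)^* = \sum_(i <- s | P i) (F i)^*.
Proof. exact: rmorph_sum. Qed.

Lemma has_csum_conj (v : nat -> R[i]) S : has_csum v S ->
  has_csum (fun n => (v n)^*) S^*.
Proof.
move=> h e e0; have [n hn] := h _ e0; exists n => k /hn.
by rewrite -normc_conj rmorphB/= rmorph_sum.
Qed.

Lemma bser_conj a z : 0 < a -> normc z <= 1 -> bser a z^* = (bser a z)^*.
Proof.
move=> a0 z1; apply: bserE; rewrite ?normc_conj//.
apply: has_csum_ext (has_csum_conj (bserP a0 z1)) => n.
by rewrite /bterm conjcM conjcX conjcR.
Qed.

Lemma normc_expi_le1 u : normc (expi u) <= 1.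
Proof. by rewrite normc_expi. Qed.

Lemma bser_expi a u : 0 < a -> 0 < u -> u < pi ->
  bser a (expi (- u)) = polar (2 * sin (u / 2)) ((pi - u) / 2) a.
Proof.
move=> a0 u0 upi.
have s0 : 0 < sin (u / 2).
  apply: sin_gt0_pihalf; rewrite divr_gt0//=; lra.
have E : polar (2 * sin (u / 2)) ((pi - u) / 2) 1 = 1 - expi (- u).
  by rewrite /polar mul1r powRr1 ?one_sub_expi// mulr_ge0// ltW.
have -> : expi (- u) = 1 - polar (2 * sin (u / 2)) ((pi - u) / 2) 1 by rewrite E; ring.
apply: bser_polar => //.
- by rewrite mulr_gt0.
- by rewrite ger0_norm; lra.
- by rewrite E opprB addrC subrK normc_expi.
Qed.

Definition ravg (m : nat) z : R[i] := (m%:R^-1)%:C * \sum_(l < m) z ^+ l.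

Lemma normc_one_sub_ravg m u : (0 < m)%N ->
  normc (1 - ravg m (expi u)) <= m%:R * `|u|.
Proof.
move=> m0; have m0' : m%:R != 0 :> R by rewrite pnatr_eq0 -lt0n.
have -> : 1 - ravg m (expi u) = (m%:R^-1)%:C * \sum_(l < m) (1 - expi u ^+ l).
  rewrite sumrB mulrBr sumr_const card_ord; congr (_ - _).
  by rewrite -realc_nat -realcM mulVf.
rewrite normcM normc_real ger0_norm ?invr_ge0// ler_pdivrMl ?ltr0n//.
rewrite (le_trans (normc_sum _ _ _))//.
apply: (@le_trans _ _ (\sum_(l < m) m%:R * `|u|)).
  apply: ler_sum => l _; rewrite -expiMn (le_trans (normc_one_sub_expi_le _))//.
  by rewrite normrM ler_wpM2r// ger0_norm// ler_nat ltnW.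
by rewrite sumr_const card_ord -[leLHS]mulr_natl.
Qed.

Lemma ravgE m z : (0 < m)%N -> (1 - z) * (m%:R * ravg m z) = 1 - z ^+ m.
Proof.
move=> m0; rewrite /ravg mulrA -realc_nat -realcM divff ?pnatr_eq0 -?lt0n// mul1r.
by rewrite -opprB mulNr -subrX1 opprB.
Qed.

(** In [1 - y^m = m R (1 - y)] all three of [1 - y^m], [R] and [1 - y] have an argument of absolute
    value below [pi / 2] because [m |u| <= 1], and the arguments add up exactly; hence principal
    powers multiply. Conjugation reduces to one sign of [u], and at [u = 0] both sides vanish. *)
Lemma bser_refine a m u : 0 < a -> (0 < m)%N -> m%:R * `|u| <= 1 ->
  bser a (expi u ^+ m) = (m%:R `^ a)%:C * bser a (1 - ravg m (expi u)) * bser a (expi u).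
Proof.
move=> a0 m0.
have R1 v : m%:R * `|v| <= 1 -> normc (1 - ravg m (expi v)) <= 1.
  by move=> hv; rewrite (le_trans (normc_one_sub_ravg _ m0)).
wlog u0 : u / u <= 0.
  move=> h; have [/h//|/ltW u0] := leP u 0.
  move=> hu; have := h (- u); rewrite normrN oppr_le0 => /(_ u0 hu).
  have Y : expi (- u) = (expi u)^* by rewrite expi_conj.
  have cR : ravg m (expi (- u)) = (ravg m (expi u))^*.
    rewrite /ravg Y conjcM conjc_sum conjcR; congr (_ * _).
    by apply: eq_bigr => l _; rewrite conjcX.
  have -> : 1 - ravg m (expi (- u)) = (1 - ravg m (expi u))^*.
    by rewrite cR rmorphB rmorph1.
  rewrite Y -conjcX !bser_conj ?normc_expi_le1 ?R1//; last first.
    by rewrite normcX normc_expi expr1n.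
  by move=> E; apply: (can_inj (@conjcK R)); rewrite E !conjcM conjcR.
move: u0; rewrite le_eqVlt => /predU1P[-> _|].
  by rewrite expi0 expr1n bser_z0// mulr0.
move=> un; have u0 : 0 < - u by rewrite oppr_gt0.
rewrite -(opprK u) normrN; move: (- u) u0 => {un}{}u u0.
rewrite gtr0_norm// => mu1.
have m0' : 0 < m%:R :> R by rewrite ltr0n.
have mu0 : 0 < m%:R * u by rewrite mulr_gt0.
have pi2 := @pi_ge2 R.
have u1 : u <= 1 by rewrite (le_trans _ mu1)// ler_peMl ?(ltW u0)// ler1n.
have upi : u < pi by lra.
have mupi : m%:R * u < pi by lra.
rewrite -expiMn mulrN !bser_expi//.
have s1 : 0 < sin (u / 2) by apply: sin_gt0_pihalf; rewrite divr_gt0//=; lra.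
have s2 : 0 < sin (m%:R * u / 2) by apply: sin_gt0_pihalf; rewrite divr_gt0//=; lra.
(* Polar form of [ravg m (expi (- u))]: [rho] is the normalized quotient of sines of the Dirichlet
   kernel, and [phi] equals [- (m - 1) u / 2]. *)
pose rho := sin (m%:R * u / 2) / (m%:R * sin (u / 2)).
have rho0 : 0 < rho by rewrite divr_gt0// mulr_gt0.
pose phi := (pi - m%:R * u) / 2 - (pi - u) / 2.
have sE : 2 * sin (m%:R * u / 2) = 2 * sin (u / 2) * m%:R * rho.
  by rewrite /rho; field; rewrite !gt_eqF.
have E : ravg m (expi (- u)) = polar rho phi 1.
  have n1 : 1 - expi (- u) != 0.
    rewrite one_sub_expi mulf_neq0 ?expi_neq0//; apply/eqP => -[/eqP].
    by rewrite gt_eqF// mulr_gt0.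
  have n2 : m%:R != 0 :> R[i] by rewrite pnatr_eq0 -lt0n.
  apply: (mulfI n2); apply: (mulfI n1); rewrite ravgE// -expiMn mulrN !one_sub_expi.
  rewrite /polar mul1r powRr1 ?(ltW rho0)// sE !realcM realc_nat.
  have -> : (pi - m%:R * u) / 2 = (pi - u) / 2 + phi by rewrite /phi; ring.
  by rewrite expiD; ring.
rewrite E bser_polar//; last first.
- by rewrite -E; apply: R1; rewrite normrN gtr0_norm.
- rewrite /phi ltr_norml; nra.
rewrite /polar sE.
have -> : (2 * sin (u / 2) * m%:R * rho) `^ a =
  m%:R `^ a * rho `^ a * (2 * sin (u / 2)) `^ a.
  have A0 : 0 <= 2 * sin (u / 2) by rewrite mulr_ge0// ltW.
  move: (2 * sin (u / 2)) A0 => A A0.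
  have rho0' := ltW rho0; have Am : 0 <= A * m%:R by rewrite mulr_ge0.
  by rewrite (powRM _ Am rho0') (powRM _ A0 (ltW m0')); ring.
have -> : a * ((pi - m%:R * u) / 2) = a * phi + a * ((pi - u) / 2) by rewrite /phi; ring.
by rewrite expiD !realcM; ring.
Qed.

(** The principal power [(i x)^a], set to 0 at [x = 0]. It is defined for real [x] so that it can be
    rescaled by a step. *)
Definition deriv_symbol a x : R[i] :=
  if x == 0 then 0 else (`|x| `^ a)%:C * expi (a * pi / 2 * Num.sg x).

(** For [x > 0] and [v = x / (m + 1)] the scaled value has modulus [((m + 1) 2 sin (v / 2))^a] and
    argument [a (pi - v) / 2], which tend to [x^a] and [a pi / 2]. Conjugation gives [x < 0]. *)
Lemma bser_deriv a x : 0 < a ->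
  normc ((m.+1%:R `^ a)%:C * bser a (expi (- (x / m.+1%:R))) - deriv_symbol a x)
    @[m --> \oo] --> (0 : R).
Proof.
move=> a0.
wlog x0 : x / 0 <= x.
  move=> h; have [/h//|/ltW xn] := leP 0 x.
  have := h (- x); rewrite oppr_ge0 => /(_ xn).
  have -> : deriv_symbol a (- x) = (deriv_symbol a x)^*.
    rewrite /deriv_symbol oppr_eq0; case: ifP => _; first by rewrite rmorph0.
    by rewrite conjcM conjcR expi_conj normrN sgrN mulrN.
  move=> H; apply: cvg_trans H; apply: near_eq_cvg; apply: nearW => m.
  have -> : expi (- (- x / m.+1%:R)) = (expi (- (x / m.+1%:R)))^*.
    by rewrite expi_conj mulNr.
  rewrite bser_conj ?normc_expi_le1//.
  by rewrite -[LHS]normc_conj rmorphB/= conjcM conjcR !conjcK.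
move: x0; rewrite le_eqVlt => /predU1P[<-|x0].
  under eq_fun do rewrite mul0r oppr0 expi0 bser_z0// mulr0 /deriv_symbol eqxx subrr normc0.
  exact: cvg_cst.
rewrite /deriv_symbol gt_eqF// gtr0_sg// mulr1 gtr0_norm//.
pose v (m : nat) := x / m.+1%:R.
have v0 m : 0 < v m by rewrite divr_gt0.
have cv : v m @[m --> \oo] --> (0 : R).
  rewrite -[X in _ --> X](mulr0 x); apply: cvgM; first exact: cvg_cst.
  exact: cvg_harmonic.
have cv2 : v m / 2 @[m --> \oo] --> (0 : R).
  by rewrite -[X in _ --> X](mul0r 2^-1); apply: cvgM => //; exact: cvg_cst.
pose r (m : nat) := m.+1%:R * (2 * sin (v m / 2)).
have ev : \forall m \near \oo, v m <= 1.
  by have /cvgr_le/(_ _ ltr01) := cv.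
have cr : r m @[m --> \oo] --> x.
  apply: (@squeeze_cvgr _ _ _ _ (fun m => x * cos (v m / 2)) (fun=> x)).
  - apply: filterS ev => m v1.
    have v2 : 0 <= v m / 2 by rewrite divr_ge0// ltW.
    have pi2 := @pi_ge2 R.
    have E : x = m.+1%:R * (2 * (v m / 2)).
      have N0 : m.+1%:R != 0 :> R by rewrite pnatr_eq0.
      by rewrite /v; move: (m.+1%:R) N0 => N N0; field.
    apply/andP; split; last first.
      rewrite [leRHS]E /r !ler_wpM2l// (le_trans (ler_norm _))//.
      by rewrite (le_trans (normr_sin_le _))// ger0_norm.
    rewrite [X in X * _]E /r -mulrA ler_wpM2l// -mulrA ler_wpM2l//.
    apply: sin_ge_xcos => //; lra.
  - suff : x * cos (v m / 2) @[m --> \oo] --> x * cos 0 by rewrite cos0 mulr1.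
    apply: cvgM; first exact: cvg_cst.
    by apply: continuous_cvg => //; exact: continuous_cos.
  - exact: cvg_cst.
have cph : a * ((pi - v m) / 2) @[m --> \oo] --> a * pi / 2.
  suff : a * ((pi - v m) / 2) @[m --> \oo] --> a * ((pi - 0) / 2) by rewrite subr0 mulrA.
  apply: cvgM; first exact: cvg_cst.
  apply: cvgM; last exact: cvg_cst.
  by apply: cvgB => //; exact: cvg_cst.
have cp : (r m) `^ a @[m --> \oo] --> x `^ a.
  have E c : 0 < c -> c `^ a = expR (a * ln c) by move=> c0; rewrite /powR gt_eqF.
  rewrite E//; apply: (@cvg_trans _ ((fun m => expR (a * ln (r m))) @ \oo)).
    apply: near_eq_cvg; near=> m; rewrite E//.
    by near: m; have /cvgr_gt/(_ _ x0) := cr.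
  apply: continuous_cvg; first exact: continuous_expR.
  apply: cvgM; first exact: cvg_cst.
  by apply: continuous_cvg => //; exact: continuous_ln.
pose F (m : nat) := `|(r m) `^ a * cos (a * ((pi - v m) / 2)) - x `^ a * cos (a * pi / 2)|
 + `|(r m) `^ a * sin (a * ((pi - v m) / 2)) - x `^ a * sin (a * pi / 2)|.
have cF : F m @[m --> \oo] --> (0 : R).
  suff : F m @[m --> \oo] -->
     `|x `^ a * cos (a * pi / 2) - x `^ a * cos (a * pi / 2)|
     + `|x `^ a * sin (a * pi / 2) - x `^ a * sin (a * pi / 2)|.
    by rewrite !subrr normr0 addr0.
  apply: cvgD; apply: cvg_norm; apply: cvgB; (try exact: cvg_cst); apply: cvgM => //.
    by apply: continuous_cvg => //; exact: continuous_cos.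
  by apply: continuous_cvg => //; exact: continuous_sin.
apply: (@squeeze_cvgr _ _ _ _ (fun=> 0) F) => //; last exact: cvg_cst.
apply: filterS ev => m v1; apply/andP; split; first exact: normc_ge0.
have pi2 := @pi_ge2 R.
rewrite bser_expi ?(v0 m)//; last by rewrite (le_lt_trans v1)//; lra.
rewrite /polar mulrA -realcM -powRM// ?mulr_ge0//; last first.
  by apply: sin_ge0_pi; rewrite divr_ge0 ?(ltW (v0 m))//= -/(v m); lra.
rewrite -/(v m) -/(r m) (le_trans (normc_le_ReIm _))// /F.
by rewrite ReD ImD ReN ImN !ReM !ImM /= !mul0r !subr0 !addr0.
Unshelve. all: by end_near. Qed.

End bser_on_circle.

(** * L_p integrals of periodic functions *)

Section integral_tools.
Local Open Scope ereal_scope.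
Variable R : realType.
Notation mu := (@lebesgue_measure R).

(** The integral of a nonnegative function is a supremum over simple functions below it, hence
    monotone for arbitrary functions. This allows integrating [fdiff], whose value is arbitrary
    where its series diverges. *)
Lemma ge0_le_integral_nomeas (D : set R) (f g : R -> \bar R) :
  (forall x, D x -> 0 <= f x) -> (forall x, D x -> f x <= g x) ->
  \int[mu]_(x in D) f x <= \int[mu]_(x in D) g x.
Proof.
move=> f0 fg; rewrite integral_mkcond [leRHS]integral_mkcond.
have f0' x : 0 <= (f \_ D) x by apply: erestrict_ge0.
have fg' x : (f \_ D) x <= (g \_ D) x.
  by rewrite /patch; case: ifPn => // /set_mem; exact: fg.
have g0' x : 0 <= (g \_ D) x := le_trans (f0' x) (fg' x).
rewrite !ge0_integralTE//; apply: ereal_sup_le => _ [h hf <-].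
by exists h => // x; exact: le_trans (hf x) (fg' x).
Qed.

Let itv_oc_shift (a b t : R) :
  (fun x : R => x + t)%R @^-1` `]a, b]%classic = `](a - t)%R, (b - t)%R]%classic.
Proof.
by apply/seteqP; split=> x /=; rewrite !in_itv/= ltrBlDr lerBrDr.
Qed.

Lemma measurable_addr (t : R) : measurable_fun setT (fun x : R => x + t)%R.
Proof. by apply: measurable_funD => //; exact: measurable_cst. Qed.

(** Lebesgue measure and its image under a translation agree on half-open intervals, hence
    everywhere. *)
Lemma integral_shift (t : R) (D : set R) (f : R -> \bar R) :
  measurable D -> measurable_fun [set: R] f -> (forall x, 0 <= f x) ->
  \int[mu]_(x in (fun x => x + t)%R @^-1` D) f (x + t)%R = \int[mu]_(x in D) f x.
Proof.
move=> mD mf f0; have mphi := measurable_addr t.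
have f0' : {in D, forall y, 0 <= f y} by move=> y _; exact: f0.
have := @ge0_integral_pushforward _ _ (measurableTypeR R) (measurableTypeR R) R
  (fun x => x + t)%R mphi mu D f mD (measurable_funTS mf) f0'.
move=> /= <-.
apply: eq_measure_integral => A mA _; apply/esym.
apply: lebesgue_measure_unique => // X [[a b] _ <-].
rewrite /= /pushforward itv_oc_shift !lebesgue_measure_itv/= !lte_fin ltrD2r.
by case: ifP => // _; rewrite -!EFinB; congr (_%:E); ring.
Qed.

End integral_tools.

Section periodic_measurable.
Variable R : realType.
Notation mu := (@lebesgue_measure R).
Implicit Types (f g : R -> R[i]) (p t : R).

Definition pmeas f :=
  [/\ measurable_fun setT (fun x : R => complex.Re (f x)),
      measurable_fun setT (fun x : R => complex.Im (f x))
    & forall x, f (x + 2 * pi) = f x].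

Lemma pmeasD f g : pmeas f -> pmeas g -> pmeas (fun x => f x + g x).
Proof.
move=> [f1 f2 f3] [g1 g2 g3]; split; last by move=> x; rewrite f3 g3.
- by under eq_fun do rewrite ReD; exact: measurable_funD.
- by under eq_fun do rewrite ImD; exact: measurable_funD.
Qed.

Lemma pmeasM f g : pmeas f -> pmeas g -> pmeas (fun x => f x * g x).
Proof.
move=> [f1 f2 f3] [g1 g2 g3]; split; last by move=> x; rewrite f3 g3.
- by under eq_fun do rewrite ReM; apply: measurable_funB; exact: measurable_funM.
- by under eq_fun do rewrite ImM; apply: measurable_funD; exact: measurable_funM.
Qed.

Lemma pmeas_cst (c : R[i]) : pmeas (fun=> c).
Proof. by split => //; exact: measurable_cst. Qed.

Lemma pmeasZ (c : R[i]) f : pmeas f -> pmeas (fun x => c * f x).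
Proof. exact: pmeasM (pmeas_cst c). Qed.

Lemma pmeasN f : pmeas f -> pmeas (fun x => - f x).
Proof.
by move=> /(pmeasZ (-1)); congr pmeas; apply/funext => x; rewrite mulN1r.
Qed.

Lemma pmeasB f g : pmeas f -> pmeas g -> pmeas (fun x => f x - g x).
Proof. by move=> hf /pmeasN; exact: pmeasD. Qed.

Lemma pmeas_sum (I : Type) (s : seq I) (F : I -> R -> R[i]) :
  (forall i, pmeas (F i)) -> pmeas (fun x => \sum_(i <- s) F i x).
Proof.
move=> h; elim: s => [|i s ih].
  by under eq_fun do rewrite big_nil; exact: pmeas_cst.
by under eq_fun do rewrite big_cons; exact: pmeasD.
Qed.

Lemma pmeas_shift f t : pmeas f -> pmeas (fun x => f (x + t)).
Proof.
move=> [f1 f2 f3]; split; last by move=> x; rewrite addrAC f3.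
- exact: (measurableT_comp f1 (measurable_addr t)).
- exact: (measurableT_comp f2 (measurable_addr t)).
Qed.

Lemma pmeas_expi (k : int) : pmeas (fun x => expi (k%:~R * x)).
Proof.
have mk : measurable_fun setT (fun x : R => k%:~R * x).
  by apply: measurable_funM => //; exact: measurable_cst.
split; last by move=> x; rewrite mulrDr expiD expi_2piMz mulr1.
- apply: (@measurableT_comp _ _ _ _ _ _ cos _ (fun x : R => k%:~R * x)) => //.
  by apply: continuous_measurable_fun; exact: continuous_cos.
- apply: (@measurableT_comp _ _ _ _ _ _ sin _ (fun x : R => k%:~R * x)) => //.
  by apply: continuous_measurable_fun; exact: continuous_sin.
Qed.

Lemma measurable_normc f : pmeas f -> measurable_fun setT (fun x => normc (f x)).
Proof.
move=> [f1 f2 _]; under eq_fun do rewrite normcE.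
have msqrt : measurable_fun [set: R] (@Num.sqrt R).
  by apply: continuous_measurable_fun; exact: sqrt_continuous.
apply: (measurableT_comp msqrt).
by apply: measurable_funD; exact: measurable_funX.
Qed.

Lemma measurable_normc_powR p f : pmeas f ->
  measurable_fun setT (fun x => (normc (f x) `^ p)%:E).
Proof.
move=> /measurable_normc mf; apply/measurable_EFinP.
exact: (measurableT_comp (measurable_powR p) mf).
Qed.

(** The [p]-th power of the quasi-norm, without normalization: subadditive for [p <= 1], unlike the
    quasi-norm itself when [p < 1]. *)
Definition Ip p f : \bar R := (\int[mu]_(x in torus R) (normc (f x) `^ p)%:E)%E.
Arguments Ip p%_R f%_R.

Lemma measurable_torus : measurable (torus R).
Proof. exact: measurable_itv. Qed.

Lemma mu_torus : mu (torus R) = (2 * pi)%:E.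
Proof.
rewrite /torus lebesgue_measure_itv/= lte_fin mulr_gt0 ?pi_gt0//.
by rewrite -EFinB subr0.
Qed.

Lemma Ip_ge0 p f : (0 <= Ip p f)%E.
Proof. by apply: integral_ge0 => x _; rewrite lee_fin powR_ge0. Qed.

Lemma torus_integral_shift (F : R -> \bar R) t :
  measurable_fun [set: R] F -> (forall x, (0 <= F x)%E) ->
  (forall x, F (x + 2 * pi) = F x) ->
  (\int[mu]_(x in torus R) F (x + t)%R = \int[mu]_(x in torus R) F x)%E.
Proof.
move=> mF F0 FT.
have FTn x (n : nat) : F (x + n%:R * (2 * pi)) = F x.
  elim: n => [|n ih]; first by rewrite mul0r addr0.
  by rewrite -natr1 mulrDl mul1r addrA FT.
have FTz x (k : int) : F (x + k%:~R * (2 * pi)) = F x.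
  case: k => n; first exact: FTn.
  by rewrite NegzE mulrNz mulNr -[in RHS](subrK (n.+1%:R * (2 * pi)) x) FTn.
have pi0 : 0 < 2 * pi :> R by rewrite mulr_gt0 ?pi_gt0.
(* Only the residue [s] of [t] modulo [2 pi] counts. The window [[s, s + 2 pi)] is cut at [2 pi],
   and its right piece is moved back by one period. *)
pose k := Num.floor (t / (2 * pi)); pose s := t - k%:~R * (2 * pi).
have s0 : 0 <= s by rewrite subr_ge0 -ler_pdivlMr// Num.Theory.floor_le_tmp.
have s1 : s < 2 * pi.
  rewrite ltrBlDr -[X in X + _]mul1r -mulrDl -ltr_pdivrMr// addrC.
  by rewrite -[1]/(1%:~R) -intrD Num.Theory.lt_succ_floor.
have -> : (fun x => F (x + t)) = (fun x => F (x + s)).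
  by apply/funext => x; rewrite -(FTz (x + s) k) /s; congr F; ring.
have E1 : torus R = (fun x => x + s) @^-1` `[s, s + 2 * pi[%classic.
  clearbody s; apply/seteqP; split=> x; rewrite /torus /= !in_itv/=.
    by case/andP=> h1 h2; rewrite lerDr h1 addrC ltrD2l.
  by case/andP=> h1 h2; rewrite lerDr in h1; rewrite addrC ltrD2l in h2; rewrite h1.
rewrite {1}E1 (integral_shift s (measurable_itv _) mF F0).
have E2 : `[s, s + 2 * pi[%classic = `[s, 2 * pi[ `|` `[2 * pi, s + 2 * pi[ :> set R.
  apply/seteqP; split=> x /=; rewrite !in_itv/=.
    by case: (ltP x (2 * pi)) => h /andP[h1 h2]; [left|right]; apply/andP; split.
  by case=> /andP[h1 h2]; apply/andP; split => //; lra.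
have E3 : torus R = `[0, s[ `|` `[s, 2 * pi[ :> set R.
  apply/seteqP; split=> x; rewrite /torus /= !in_itv/=.
    by case: (ltP x s) => h /andP[h1 h2]; [left|right]; apply/andP; split.
  by case=> /andP[h1 h2]; apply/andP; split => //; lra.
have dis (a b c : R) : [disjoint `[a, b[%classic & `[b, c[%classic].
  rewrite disj_set2E; apply/eqP/seteqP; split => // x [] /=; rewrite !in_itv/= => /andP[_ h1] /andP[h2 _].
  by have := lt_le_trans h1 h2; rewrite ltxx.
rewrite E2 E3 !ge0_integral_setU//; try exact: measurable_itv; try exact: measurable_funTS.
rewrite [RHS]addeC; congr (_ + _)%E.
rewrite -(integral_shift (2 * pi) (measurable_itv _) mF F0).
have -> : (fun x : R => x + 2 * pi) @^-1` `[2 * pi, s + 2 * pi[%classic = `[0, s[%classic.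
  by apply/seteqP; split=> x /=; rewrite !in_itv/= => /andP[h1 h2]; apply/andP; split; lra.
by apply: eq_integral => x _; rewrite FT.
Qed.

Lemma Ip_shift p f t : pmeas f -> Ip p (fun x => f (x + t)) = Ip p f.
Proof.
move=> hf; rewrite /Ip.
apply: (@torus_integral_shift (fun x => (normc (f x) `^ p)%:E)).
- exact: measurable_normc_powR.
- by move=> x; rewrite lee_fin powR_ge0.
- by move=> x; case: hf => _ _ ->.
Qed.

Lemma Ip_le p f g : (forall x, normc (f x) `^ p <= normc (g x) `^ p) ->
  (Ip p f <= Ip p g)%E.
Proof.
move=> fg; apply: ge0_le_integral_nomeas => x _; rewrite lee_fin ?powR_ge0//.
Qed.

Lemma IpZ p (c : R[i]) f : pmeas f ->
  Ip p (fun x => c * f x) = ((normc c `^ p)%:E * Ip p f)%E.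
Proof.
move=> hf; rewrite /Ip -ge0_integralZl//.
- by apply: eq_integral => x _; rewrite normcM powRM ?normc_ge0// EFinM.
- exact: measurable_torus.
- by apply: measurable_funTS; exact: measurable_normc_powR.
- by move=> x _; rewrite lee_fin powR_ge0.
- by rewrite lee_fin powR_ge0.
Qed.

(* The pointwise hypothesis is a p-th power triangle inequality for a series,
   stated without extended reals. *)
Lemma Ip_series p (F : nat -> R -> R[i]) G (B : \bar R) :
  (forall n, pmeas (F n)) ->
  (forall x b, bsum (fun n => normc (F n x) `^ p) b -> normc (G x) `^ p <= b) ->
  (forall n, \sum_(i < n) Ip p (F i) <= B)%E ->
  (Ip p G <= B)%E.
Proof.
move=> mF hG hB.
have F0 n x : (0 <= (normc (F n x) `^ p)%:E)%E by rewrite lee_fin powR_ge0.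
apply: (@le_trans _ _ (\int[mu]_(x in torus R) \sum_(n <oo) (normc (F n x) `^ p)%:E)%E).
  apply: ge0_le_integral_nomeas => x _; first by rewrite lee_fin powR_ge0.
  set S := (\sum_(n <oo) _)%E.
  have S0 : (0 <= S)%E by apply: nneseries_ge0.
  case E : S S0 => [s| |]; last 2 first.
  - by move=> _; rewrite leey.
  - by rewrite leeNy_eq.
  move=> _; rewrite lee_fin; apply: hG => n.
  rewrite -lee_fin -E -sumEFin -(big_mkord xpredT (fun i => (normc (F i x) `^ p)%:E)).
  by apply: nneseries_lim_ge.
rewrite integral_nneseries//; last 2 first.
- exact: measurable_torus.
- by move=> n; apply: measurable_funTS; exact: measurable_normc_powR.
apply: lime_le.
  by apply: is_cvg_nneseries => n _ _; exact: Ip_ge0.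
by apply: nearW => n; rewrite big_mkord; exact: hB.
Qed.

Lemma IpD p f g : 0 < p -> p <= 1 -> pmeas f -> pmeas g ->
  (Ip p (fun x => f x + g x)%R <= Ip p f + Ip p g)%E.
Proof.
move=> p0 p1 mf mg; rewrite /Ip -ge0_integralD//.
- apply: ge0_le_integral_nomeas => x _; rewrite -?EFinD lee_fin ?powR_ge0//.
  rewrite (le_trans _ (powR_subadd p0 p1 _ _)) ?normc_ge0//.
  by rewrite ler_powR2 ?(ltW p0) ?normc_ge0 ?normcD.
- exact: measurable_torus.
- by move=> x _; rewrite lee_fin powR_ge0.
- by apply: measurable_funTS; exact: measurable_normc_powR.
- by move=> x _; rewrite lee_fin powR_ge0.
- by apply: measurable_funTS; exact: measurable_normc_powR.
Qed.

Lemma IpN p f : Ip p (fun x => - f x) = Ip p f.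
Proof. by apply: eq_integral => x _; rewrite normcN'. Qed.

Lemma IpB p f g : 0 < p -> p <= 1 -> pmeas f -> pmeas g ->
  (Ip p (fun x => f x - g x)%R <= Ip p f + Ip p g)%E.
Proof.
by move=> p0 p1 mf mg; rewrite -(IpN p g); apply: IpD => //; exact: pmeasN.
Qed.

Lemma IpB_le p f g (B : \bar R) : 0 < p -> p <= 1 -> pmeas f -> pmeas g ->
  (Ip p f <= B)%E -> (Ip p (fun x => f x - g x)%R <= Ip p g + B)%E.
Proof.
move=> p0 p1 mf mg fB; apply: (le_trans (IpB p0 p1 mf mg)).
by rewrite addeC; exact: leeD2l.
Qed.

Lemma Ip_sum p (I : Type) (s : seq I) (F : I -> R -> R[i]) : 0 < p -> p <= 1 ->
  (forall i, pmeas (F i)) ->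
  (Ip p (fun x => \sum_(i <- s) F i x)%R <= \sum_(i <- s) Ip p (F i))%E.
Proof.
move=> p0 p1 mF; elim: s => [|i s ih].
  rewrite big_nil /Ip; under eq_integral do rewrite big_nil normc0 powR0 ?gt_eqF//.
  by rewrite integral0.
under [X in Ip _ X]eq_fun do rewrite big_cons.
rewrite big_cons (le_trans (IpD _ _ _ _))//; first exact: pmeas_sum.
exact: leeD2l.
Qed.

(** Translation invariance bounds a series of translates by the sum of the [p]-th powers of its
    coefficients. The hypothesis on [G] bites only at points where the terms are [p]-summable. *)
Lemma Ip_translates p (c : nat -> R[i]) (t : nat -> R) F G (B : R) :
  0 < p -> p <= 1 -> pmeas F ->
  (forall x b, bsum (fun n => normc (c n * F (x + t n)) `^ p) b ->
     normc (G x) `^ p <= b) ->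
  bsum (fun n => normc (c n) `^ p) B ->
  (Ip p G <= B%:E * Ip p F)%E.
Proof.
move=> p0 p1 mF hG hB.
apply: (Ip_series (F := fun n x => c n * F (x + t n))) => [n|//|n].
  by apply: pmeasZ; exact: pmeas_shift.
have E i : Ip p (fun x => c i * F (x + t i)) = ((normc (c i) `^ p)%:E * Ip p F)%E.
  by rewrite IpZ ?Ip_shift//; exact: pmeas_shift.
under eq_bigr do rewrite E.
rewrite -ge0_sume_distrl; last by move=> i _; rewrite lee_fin powR_ge0.
by rewrite lee_wpmul2r ?Ip_ge0// sumEFin lee_fin.
Qed.

Lemma Ip_bounded p f (M : R) : 0 < p -> (forall x, normc (f x) <= M) ->
  (Ip p f < +oo)%E.
Proof.
move=> p0 fM; apply: (@le_lt_trans _ _ (\int[mu]_(x in torus R) (M `^ p)%:E)%E).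
  apply: ge0_le_integral_nomeas => x _; rewrite lee_fin ?powR_ge0//.
  by rewrite ler_powR2 ?(ltW p0) ?normc_ge0.
rewrite integral_cst; last exact: measurable_torus.
by change (((M `^ p)%:E * mu (torus R))%E < +oo)%E; rewrite mu_torus -EFinM ltry.
Qed.

(** A splitting at the level [eta]: [t^p <= eta^p] below it and [t^p <= eta^(p - 1) t] above it. As
    [eta] is free, convergence in L_1 implies convergence of [Ip p]. *)
Lemma Ip_le_I1 p f (eta : R) : 0 < p -> p < 1 -> 0 < eta -> pmeas f ->
  (Ip p f <= (eta `^ p * (2 * pi))%:E + (eta `^ (p - 1))%:E * Ip 1 f)%E.
Proof.
move=> p0 p1 e0 mf.
apply: (@le_trans _ _ (\int[mu]_(x in torus R)
   ((eta `^ p)%:E + (eta `^ (p - 1))%:E * (normc (f x) `^ 1)%:E))%E).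
  apply: ge0_le_integral_nomeas => x _; rewrite -?EFinM -?EFinD lee_fin ?powR_ge0//.
  rewrite powRr1 ?normc_ge0//; set t := normc (f x).
  have t0 : 0 <= t := normc_ge0 _.
  have [te|et] := leP t eta.
    rewrite (le_trans (ler_powR2 (ltW p0) t0 te))// lerDl.
    by rewrite mulr_ge0 ?powR_ge0.
  have t0' : 0 < t := lt_trans e0 et.
  rewrite -(mulr_powRB1 t0 p0) mulrC (le_trans _ (_ : eta `^ (p - 1) * t <= _))//.
    rewrite ler_wpM2r// -opprB !powRN lef_pV2 ?posrE ?powR_gt0//.
    by rewrite ler_powR2 ?subr_ge0 ?ltW.
  by rewrite lerDr powR_ge0.
rewrite ge0_integralD//.
- apply: leeD.
    rewrite integral_cst; last exact: measurable_torus.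
    by change (((eta `^ p)%:E * mu (torus R))%E <= (eta `^ p * (2 * pi))%:E)%E; rewrite mu_torus.
  rewrite ge0_integralZl//.
  + exact: measurable_torus.
  + by apply: measurable_funTS; exact: measurable_normc_powR.
  + by move=> x _; rewrite lee_fin powR_ge0.
  + by rewrite lee_fin powR_ge0.
- exact: measurable_torus.
- by move=> x _; rewrite lee_fin powR_ge0.
- by move=> x _; rewrite -EFinM lee_fin mulr_ge0 ?powR_ge0.
- apply: measurable_funTS; apply: measurable_funeM; exact: measurable_normc_powR.
Qed.

End periodic_measurable.

(** * Trigonometric polynomials *)

Section trig_polynomials.
Variable R : realType.
Implicit Types (c : int -> R[i]) (x t h s : R) (n N M L : nat).

Definition tp n c x : R[i] :=
  \sum_(j < n.*2.+1) c (j%:Z - n%:Z) * expi ((j%:Z - n%:Z)%:~R * x).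

Lemma trig_polyP n T : trig_poly n T <-> exists c, T = tp n c.
Proof.
split=> [[c hc]|[c ->]]; first by exists c; apply/funext.
by exists c.
Qed.

Lemma pmeas_tp n c : pmeas (tp n c).
Proof.
apply: pmeas_sum => j; apply: pmeasZ; exact: pmeas_expi.
Qed.

Lemma tp_bounded n c : exists B, forall x, normc (tp n c x) <= B.
Proof.
exists (\sum_(j < n.*2.+1) normc (c (j%:Z - n%:Z))) => x.
rewrite (le_trans (normc_sum _ _ _))//; apply: ler_sum => j _.
by rewrite normcM normc_expi mulr1.
Qed.

Lemma Ip_tp_fin p n c : 0 < p -> (Ip p (tp n c) < +oo)%E.
Proof. by move=> p0; have [B hB] := tp_bounded n c; exact: (Ip_bounded p0 hB). Qed.

Lemma ord_shift_norm n (j : 'I_n.*2.+1) : `|((j%:Z - n%:Z)%:~R : R)| <= n%:R.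
Proof.
rewrite intrB -[j%:Z%:~R]/(j%:R) -[n%:Z%:~R]/(n%:R) ler_norml lerBrDr addNr ler0n/=.
by rewrite lerBlDr -natrD ler_nat addnn -ltnS.
Qed.

Lemma eq_tp n c c' : (forall k : int, `|(k%:~R : R)| <= n%:R -> c k = c' k) ->
  tp n c = tp n c'.
Proof.
move=> h; apply/funext => x; apply: eq_bigr => j _.
by rewrite h// ord_shift_norm.
Qed.

Lemma tpD n c c' x : tp n (fun k => c k + c' k) x = tp n c x + tp n c' x.
Proof. by rewrite -big_split/=; apply: eq_bigr => j _; rewrite mulrDl. Qed.

Lemma tpZ n (a : R[i]) c x : tp n (fun k => a * c k) x = a * tp n c x.
Proof. by rewrite mulr_sumr; apply: eq_bigr => j _; rewrite mulrA. Qed.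

Lemma tpN n c x : tp n (fun k => - c k) x = - tp n c x.
Proof. by rewrite -sumrN; apply: eq_bigr => j _; rewrite mulNr. Qed.

Lemma tp_sum n (I : Type) (s : seq I) (C : I -> int -> R[i]) x :
  tp n (fun k => \sum_(i <- s) C i k) x = \sum_(i <- s) tp n (C i) x.
Proof. by rewrite exchange_big/=; apply: eq_bigr => j _; rewrite mulr_suml. Qed.

Lemma tp_shift n c x t : tp n c (x + t) = tp n (fun k => expi (k%:~R * t) * c k) x.
Proof. by apply: eq_bigr => j _; rewrite mulrDr expiD; ring. Qed.

(** A polynomial has finitely many frequencies, so convergence of the multipliers at each of them
    suffices. *)
Lemma tp_csum n c (U : nat -> int -> R[i]) (V : int -> R[i]) x :
  (forall k : int, `|(k%:~R : R)| <= n%:R -> has_csum (fun i => U i k) (V k)) ->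
  has_csum (fun i => tp n (fun k => U i k * c k) x) (tp n (fun k => V k * c k) x).
Proof.
move=> h; apply: has_csum_sum => j.
have H := has_csumZ (c (j%:Z - n%:Z) * expi ((j%:Z - n%:Z)%:~R * x)) (h _ (ord_shift_norm j)).
have -> : V (j%:Z - n%:Z) * c (j%:Z - n%:Z) * expi ((j%:Z - n%:Z)%:~R * x) =
  c (j%:Z - n%:Z) * expi ((j%:Z - n%:Z)%:~R * x) * V (j%:Z - n%:Z) by ring.
by apply: has_csum_ext H => i; ring.
Qed.

Lemma tp_widen1 n c :
  tp n c = tp n.+1 (fun k => if (`|k| <= n)%N then c k else 0).
Proof.
apply/funext => x; rewrite /tp doubleS [RHS]big_ord_recl [X in _ = _ + X]big_ord_recr/=.
have -> : (`|0 - n.+1%:Z| <= n)%N = false by rewrite sub0r abszN absz_nat ltnn.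
have -> : (`|(bump 0 (n.*2.+1))%:Z - n.+1%:Z| <= n)%N = false.
  by rewrite /bump/= add1n -addnn -addnS -addSn PoszD addrK absz_nat ltnn.
rewrite !mul0r addr0 add0r; apply: eq_bigr => j _; rewrite /bump/= add1n.
have -> : j.+1%:Z - n.+1%:Z = j%:Z - n%:Z by rewrite -addn1 -(addn1 n) !PoszD; ring.
case: ifPn => // /negP[].
have := ord_shift_norm j; rewrite -intr_norm -[n%:R]/(n%:Z%:~R) ler_int.
by rewrite -abszE lez_nat.
Qed.

Lemma tp_widen n m c : (n <= m)%N -> exists c', tp n c = tp m c'.
Proof.
move=> /subnKC <-; elim: (m - n)%N c => [|d ih] c.
  by exists c; rewrite addn0.
have [c' ->] := ih c; rewrite addnS; eexists; exact: tp_widen1.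
Qed.

Lemma trig_poly_le n m : (n <= m)%N -> @trig_poly R n `<=` trig_poly m.
Proof.
move=> nm T /trig_polyP [c ->]; apply/trig_polyP; exact: tp_widen.
Qed.

End trig_polynomials.

(** * A reproducing kernel sampled on a grid *)

Section kernel.
Variable R : realType.
Implicit Types (c : int -> R[i]) (x t h s : R) (n N M L : nat).

Definition tgrid M (j : nat) : R := j%:R / M%:R * (2 * pi).

Lemma expi_neq1 t : 0 < `|t| -> `|t| < 2 * pi -> expi t != 1 :> R[i].
Proof.
move=> t0 tpi; apply/eqP => e1.
have := normc_one_sub_expi (- t); rewrite opprK e1 subrr normc0 mulNr sinN normrN.
have -> : `|sin (t / 2)| = sin (`|t| / 2).
  have s0 : 0 < sin (`|t| / 2).
    apply: sin_gt0_pi; rewrite divr_gt0//= ltr_pdivrMr// mulrC; exact: tpi.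
  have [t0'|t0'] := leP 0 t; first by rewrite ger0_norm// in s0 *; rewrite gtr0_norm.
  by rewrite ltr0_norm// in s0 *; rewrite mulNr sinN in s0 *; rewrite ltr0_norm// -oppr_gt0.
move=> /esym/eqP; rewrite mulf_eq0 pnatr_eq0/= gt_eqF//.
by apply: sin_gt0_pi; rewrite divr_gt0//= ltr_pdivrMr// mulrC; exact: tpi.
Qed.

(** Discrete orthogonality: the two inequalities say that [|a - b| < M], which excludes the nonzero
    multiples of [M]. *)
Lemma sum_expi_grid M (a b : nat) : (0 < M)%N -> (a < b + M)%N -> (b < a + M)%N ->
  \sum_(j < M) expi ((a%:R - b%:R) * tgrid M j) = (if a == b then M%:R else 0) :> R[i].
Proof.
move=> M0 ab ba; have M0' : M%:R != 0 :> R by rewrite pnatr_eq0 -lt0n.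
have [->|nab] := eqVneq a b.
  by under eq_bigr do rewrite subrr mul0r expi0; rewrite sumr_const card_ord.
pose z := expi ((a%:R - b%:R) / M%:R * (2 * pi)) : R[i].
have -> : \sum_(j < M) expi ((a%:R - b%:R) * tgrid M j) = \sum_(j < M) z ^+ j.
  by apply: eq_bigr => j _; rewrite -expiMn /tgrid; congr expi; ring.
have z1 : z != 1.
  have d0 : 0 < `|(a%:R - b%:R : R)| by rewrite normr_gt0 subr_eq0 eqr_nat.
  have d1 : `|(a%:R - b%:R : R)| < M%:R.
    have ab' : a%:R < b%:R + M%:R :> R by rewrite -natrD ltr_nat.
    have ba' : b%:R < a%:R + M%:R :> R by rewrite -natrD ltr_nat.
    by rewrite ltr_norml; apply/andP; split; lra.
  apply: expi_neq1; rewrite !normrM normfV (@ger0_norm _ M%:R)// (@gtr0_norm _ 2)// (@gtr0_norm _ pi) ?pi_gt0//.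
    by rewrite mulr_gt0 ?mulr_gt0 ?invr_gt0 ?ltr0n ?pi_gt0.
  by rewrite -[ltRHS]mul1r ltr_pM2r ?mulr_gt0 ?pi_gt0// ltr_pdivrMr ?ltr0n// mul1r.
have zM : z ^+ M = 1.
  rewrite -expiMn.
  have -> : M%:R * ((a%:R - b%:R) / M%:R * (2 * pi)) = a%:R * (2 * pi) - b%:R * (2 * pi) :> R.
    by field.
  rewrite expiD expi_2piMn expiN.
  by rewrite expi_2piMn invr1 mulr1.
apply/eqP; have := subrX1 z M; rewrite zM subrr => /esym/eqP.
by rewrite mulf_eq0 subr_eq0 (negbTE z1).
Qed.

(** The degree of [ravg N z ^+ L] as a polynomial in [z]. *)
Definition kfreq N L : nat := (L * N.-1)%N.

(** All frequencies from [- (N + kfreq N L)] to [N]. The window is extended to the left by the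
    degree of the factor [ravg N ^+ L] used in [kern], so that the product has Fourier coefficient
    exactly 1 on [[- N, N]]: a kernel of de la Vallee Poussin type. *)
Definition dker N L t : R[i] :=
  \sum_(l < (N.*2 + kfreq N L).+1) expi ((l%:R - (N + kfreq N L)%:R) * t).

Definition kern N L t : R[i] := dker N L t * ravg N (expi t) ^+ L.

Lemma ravg_expansion N L : (0 < N)%N -> exists kap : nat -> R[i],
  (forall z : R[i], ravg N z ^+ L = \sum_(i < (kfreq N L).+1) kap i * z ^+ i) /\
  \sum_(i < (kfreq N L).+1) kap i = 1.
Proof.
move=> N0.
pose P : {poly R[i]} := ((N%:R^-1 : R)%:C *: \poly_(l < N) 1) ^+ L.
have E z : ravg N z ^+ L = \sum_(i < (kfreq N L).+1) P`_i * z ^+ i.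
  rewrite -(@horner_coef_wide _ (kfreq N L).+1 P z).
    rewrite /P horner_exp hornerZ horner_poly /ravg; congr ((_ * _) ^+ _).
    by apply: eq_bigr => i _; rewrite mul1r.
  rewrite (leq_trans (size_poly_exp_leq _ _))// ltnS /kfreq mulnC leq_mul2l.
  apply/orP; right; rewrite -!subn1 leq_sub2r//.
  by rewrite (leq_trans (size_scale_leq _ _))// size_poly.
exists (fun i => P`_i); split => //.
have := E 1; under eq_bigr do rewrite expr1n mulr1; move=> <-.
rewrite /ravg; under eq_bigr do rewrite expr1n; rewrite sumr_const card_ord.
by rewrite -realc_nat -realcM mulVf ?expr1n// pnatr_eq0 -lt0n.
Qed.

(** Convolution with the kernel reproduces polynomials of order [N], and [M] nodes integrate it
    exactly because [M] is too large for aliasing. The translates on the right do not depend on [s]: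
    a difference of translates becomes a combination of fixed ones, weighted by increments of the
    kernel. *)
Lemma kern_reproduces N L M c x s : (0 < N)%N -> (N.*2 + kfreq N L < M)%N ->
  tp N c (x - s) =
  \sum_(j < M) (M%:R^-1)%:C * kern N L (tgrid M j - s) * tp N c (x - tgrid M j).
Proof.
move=> N0 hM; set B0 := kfreq N L in hM *.
have M0 : (0 < M)%N by rewrite (leq_ltn_trans _ hM).
have [kap [hk k1]] := ravg_expansion L N0.
have key (k : 'I_N.*2.+1) : \sum_(j < M) (M%:R^-1)%:C * kern N L (tgrid M j - s) *
     expi ((k%:R - N%:R) * - tgrid M j) = expi ((k%:R - N%:R) * - s).
  under eq_bigr => j _.
    rewrite /kern hk /dker big_distrlr/= mulr_sumr mulr_suml.
    under eq_bigr => l _.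
      rewrite mulr_sumr mulr_suml.
      under eq_bigr => i _.
        have -> : (M%:R^-1)%:C * (expi ((l%:R - (N + kfreq N L)%:R) * (tgrid M j - s)) *
            (kap i * expi (tgrid M j - s) ^+ i)) * expi ((k%:R - N%:R) * - tgrid M j) =
          (M%:R^-1)%:C * kap i * expi (((N + B0)%:R - (l + i)%:R) * s) *
            expi (((l + i)%N%:R - (B0 + k)%N%:R) * tgrid M j).
          have E : expi ((l%:R - (N + kfreq N L)%:R) * (tgrid M j - s)) *
             expi (tgrid M j - s) ^+ i * expi ((k%:R - N%:R) * - tgrid M j) =
             expi (((N + B0)%:R - (l + i)%:R) * s) *
             expi (((l + i)%N%:R - (B0 + k)%N%:R) * tgrid M j).
            by rewrite -expiMn -!expiD; congr expi; rewrite !natrD -/B0; ring.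
          by rewrite -!mulrA -E; ring.
        over.
      over.
    over.
  rewrite exchange_big/=; under eq_bigr do rewrite exchange_big/=.
  rewrite exchange_big/= -[RHS]mul1r -k1 mulr_suml; apply: eq_bigr => i _.
  have hi : (i <= B0)%N by rewrite -ltnS.
  have hk' : (k <= N.*2)%N by rewrite -ltnS.
  have hl : (B0 + k - i < (N.*2 + B0).+1)%N.
    by rewrite ltnS leq_subLR addnCA (addnC B0) leq_add// leq_addl.
  (* Orthogonality leaves the single index [l = B0 + k - i], which lies in the window of [dker] for
     every [i]; the weights [kap i] then sum to 1. *)
  rewrite (bigD1 (Ordinal hl))//= [X in _ + X]big1 ?addr0; last first.
    move=> l /negP nl; rewrite -mulr_sumr sum_expi_grid//.
    - case: ifPn => [/eqP E|_]; last by rewrite mulr0.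
      by case: nl; apply/eqP/val_inj; rewrite /= -E addnK.
    - have := ltn_ord l; rewrite ltnS => hll; rewrite -addnA.
      rewrite (leq_ltn_trans (leq_add hll hi))// addnC ltn_add2l.
      by rewrite (leq_trans hM)// leq_addl.
    - rewrite (leq_ltn_trans (leq_add (leqnn _) hk'))// addnC.
      by rewrite (leq_trans hM)// leq_addl.
  have Ei : (B0 + k - i + i = B0 + k)%N by rewrite subnK// (leq_trans hi)// leq_addr.
  have aM : (B0 + k < B0 + k + M)%N by rewrite -[ltnLHS]addn0 ltn_add2l.
  rewrite -mulr_sumr Ei sum_expi_grid// eqxx.
  have -> : expi (((N + B0)%:R - (B0 + k)%:R) * s) = expi ((k%:R - N%:R) * - s).
    by congr expi; rewrite !natrD; ring.
  rewrite mulrC !mulrA -realc_nat -realcM divff ?mul1r//.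
  by rewrite pnatr_eq0 -lt0n.
rewrite /tp; under [RHS]eq_bigr do rewrite mulr_sumr.
rewrite exchange_big/=; apply: eq_bigr => k _.
have -> : (k%:Z - N%:Z)%:~R = k%:R - N%:R :> R by rewrite intrB.
rewrite mulrDr expiD -[in LHS](key k) mulr_sumr mulr_sumr; apply: eq_bigr => j _.
by rewrite [in RHS]mulrDr expiD; ring.
Qed.

End kernel.

Section kernel_bounds.
Variable R : realType.
Implicit Types (c : int -> R[i]) (x t h s : R) (n N M L m : nat).

Lemma normc_dker N L t : normc (dker N L t) <= (N.*2 + kfreq N L).+1%:R.
Proof.
rewrite (le_trans (normc_sum _ _ _))//; under eq_bigr do rewrite normc_expi.
by rewrite sumr_const card_ord.
Qed.

Lemma dker_lip N L t s : normc (dker N L (t - s) - dker N L t) <=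
  (N.*2 + kfreq N L).+1%:R * ((N + kfreq N L)%:R * `|s|).
Proof.
rewrite -sumrB (le_trans (normc_sum _ _ _))//.
apply: (@le_trans _ _ (\sum_(l < (N.*2 + kfreq N L).+1) ((N + kfreq N L)%:R * `|s|))); last first.
  by rewrite sumr_const card_ord -[leLHS]mulr_natl.
apply: ler_sum => l _; rewrite (le_trans (normc_expiB _ _))//.
rewrite -mulrBr addrAC subrr add0r normrM normrN ler_wpM2r//.
rewrite ler_norml lerBrDr addNr ler0n/= lerBlDr -natrD ler_nat.
have hl : (l <= N.*2 + kfreq N L)%N by rewrite -ltnS.
by lia.
Qed.

Lemma normc_ravg_le1 N t : (0 < N)%N -> normc (ravg N (expi t)) <= 1.
Proof.
move=> N0; rewrite /ravg normcM normc_real ger0_norm ?invr_ge0//.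
rewrite ler_pdivrMl ?ltr0n// mulr1 (le_trans (normc_sum _ _ _))//.
by under eq_bigr do rewrite normcX normc_expi expr1n; rewrite sumr_const card_ord.
Qed.

Lemma ravg_lip N t s : (0 < N)%N ->
  normc (ravg N (expi (t - s)) - ravg N (expi t)) <= N%:R * `|s|.
Proof.
move=> N0; rewrite /ravg -mulrBr -sumrB normcM normc_real ger0_norm ?invr_ge0//.
rewrite ler_pdivrMl ?ltr0n// (le_trans (normc_sum _ _ _))//.
apply: (@le_trans _ _ (\sum_(l < N) (N%:R * `|s|))); last first.
  by rewrite sumr_const card_ord -[leLHS]mulr_natl.
apply: ler_sum => l _; rewrite -!expiMn (le_trans (normc_expiB _ _))//.
rewrite -mulrBr addrAC subrr add0r normrM normrN ler_wpM2r// ger0_norm//.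
by rewrite ler_nat ltnW.
Qed.

Lemma ravg_decay N t : (0 < N)%N ->
  N%:R * normc (1 - expi t) * normc (ravg N (expi t)) <= 2.
Proof.
move=> N0; have := ravgE (expi t) N0 => /(congr1 (@normc R)).
rewrite !normcM -realc_nat normc_real ger0_norm// => E.
rewrite mulrAC -mulrA [X in _ * X]mulrC mulrCA E.
by rewrite (le_trans (normcB _ _))// normc1 normcX normc_expi expr1n.
Qed.

Lemma normc_subX L (y z : R[i]) (th : R) : normc y <= th -> normc z <= th ->
  normc (y ^+ L - z ^+ L) <= L%:R * th ^+ L.-1 * normc (y - z).
Proof.
move=> yt zt; have t0 : 0 <= th := le_trans (normc_ge0 _) yt.
rewrite subrXX normcM mulrC ler_wpM2r ?normc_ge0//.
rewrite (le_trans (normc_sum _ _ _))//.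
apply: (@le_trans _ _ (\sum_(i < L) th ^+ L.-1)); last first.
  by rewrite sumr_const card_ord -[leLHS]mulr_natl.
apply: ler_sum => i _; rewrite normcM !normcX.
have -> : th ^+ L.-1 = th ^+ (L.-1 - i) * th ^+ i.
  by rewrite -exprD subnK// -ltnS prednK// (leq_ltn_trans _ (ltn_ord i)).
rewrite -subn1 -subnDA add1n.
by apply: ler_pM; rewrite ?exprn_ge0 ?normc_ge0// lerXn2r// ?nnegrE ?normc_ge0.
Qed.

(** The cyclic distance from node [j] to node 0. *)
Definition jstar M j : nat := minn j (M - j).

(** The constant comes from [2 sin x >= 2 x / 3] at [x = pi jstar / M], together with [pi >= 2]. *)
Lemma normc_one_sub_grid M j : (j <= M)%N ->
  4 / 3 * (jstar M j)%:R / M%:R <= normc (1 - expi (tgrid R M j)).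
Proof.
case: (posnP M) => [->|M0]; first by rewrite invr0 mulr0 normc_ge0.
move=> jM; have M0' : 0 < M%:R :> R by rewrite ltr0n.
have key (i : nat) : (i.*2 <= M)%N ->
    4 / 3 * i%:R / M%:R <= 2 * sin (i%:R / M%:R * pi) :> R.
  move=> iM; have iM' : i%:R / M%:R <= 2^-1 :> R.
    by rewrite ler_pdivrMr// mulrC ler_pdivlMr// -natrM ler_nat muln2.
  have x0 : 0 <= i%:R / M%:R * pi :> R by rewrite mulr_ge0 ?pi_ge0// divr_ge0.
  have x1 : i%:R / M%:R * pi <= pi / 2 :> R by rewrite mulrC ler_wpM2l ?pi_ge0.
  have := sin_ge_third x0 x1.
  have : i%:R / M%:R * 2 <= i%:R / M%:R * pi :> R.
    by rewrite ler_wpM2l ?pi_ge2// divr_ge0.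
  have -> : 4 / 3 * i%:R / M%:R = 4 / 3 * (i%:R / M%:R) :> R by rewrite !mulrA.
  lra.
rewrite -(opprK (tgrid R M j)) normc_one_sub_expi mulNr sinN normrN.
have -> : tgrid R M j / 2 = j%:R / M%:R * pi by rewrite /tgrid; field; rewrite gt_eqF.
apply: (@le_trans _ _ (2 * sin (j%:R / M%:R * pi))); last first.
  by rewrite ler_wpM2l// ler_norm.
have [jj|jj] := leqP j (M - j); first by rewrite /jstar (minn_idPl jj) key//; lia.
rewrite /jstar (minn_idPr (ltnW jj)).
have -> : sin (j%:R / M%:R * pi) = sin ((M - j)%:R / M%:R * pi) :> R.
  rewrite natrB// mulrBl divff ?gt_eqF// mulrBl mul1r sinB sinpi cospi; ring.
by apply: key; lia.
Qed.

Definition theta L M j : R := Num.min 1 (12 * (L + 3)%:R / (jstar M j).+1%:R).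

Lemma theta_ge0 L M j : 0 <= theta L M j.
Proof. by rewrite le_min ler01/= divr_ge0// mulr_ge0. Qed.

Lemma theta_le1 L M j : theta L M j <= 1.
Proof. by rewrite ge_min lexx. Qed.

(** The geometric sum gives [N |1 - z| |R| <= 2]. At a node with [i = jstar M j >= 1], moved by
    [|s| <= 1 / M], [|1 - z|] is at least [(4 i / 3 - 1) / M >= i / (3 M)]. With [M = (L + 3) N]
    this yields [i |R| <= 6 (L + 3)], and [i + 1 <= 2 i] doubles the 6 into the 12 of [theta]. *)
Lemma ravg_le_theta L N j s : (0 < N)%N -> (j <= (L + 3) * N)%N ->
  ((L + 3) * N)%:R * `|s| <= 1 ->
  normc (ravg N (expi (tgrid R ((L + 3) * N) j - s))) <= theta L ((L + 3) * N) j.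
Proof.
move=> N0; set M := ((L + 3) * N)%N => jM hs.
have N0' : 0 < N%:R :> R by rewrite ltr0n.
have M0 : 0 < M%:R :> R by rewrite ltr0n muln_gt0 N0 addnS.
rewrite /theta le_min normc_ravg_le1//=.
set q := normc (ravg _ _).
case Ej : (jstar M j) => [|i].
  rewrite divr1 (le_trans (normc_ravg_le1 _ N0))//.
  by rewrite -natrM ler1n muln_gt0 addnS.
have hd := ravg_decay (tgrid R M j - s) N0; rewrite -/q in hd.
have := normc_one_sub_grid jM; rewrite Ej => h1.
have h2 : normc (1 - expi (tgrid R M j)) - `|s| <= normc (1 - expi (tgrid R M j - s)).
  rewrite lerBlDr (_ : 1 - expi (tgrid R M j) = (1 - expi (tgrid R M j - s)) +
     (expi (tgrid R M j - s) - expi (tgrid R M j))); last by ring.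
  rewrite (le_trans (normcD _ _))// lerD2l (le_trans (normc_expiB _ _))//.
  by rewrite addrAC subrr add0r normrN.
have h3 : i.+1%:R / (3 * M%:R) <= normc (1 - expi (tgrid R M j - s)).
  rewrite (le_trans _ h2)// lerBrDr (le_trans _ h1)//.
  rewrite -[leRHS](_ : i.+1%:R / (3 * M%:R) + i.+1%:R / M%:R = _); last by field; rewrite gt_eqF.
  rewrite lerD2l ler_pdivlMr// mulrC (le_trans hs)// ler1n//.
have q0 : 0 <= q := normc_ge0 _.
have i0 : 0 < i.+1%:R :> R by [].
have h4 : N%:R * (i.+1%:R / (3 * M%:R)) * q <= 2.
  by rewrite (le_trans _ hd)// ler_wpM2r// ler_wpM2l// ltW.
have EM : M%:R = (L + 3)%:R * N%:R :> R by rewrite natrM.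
have L0 : 0 < (L + 3)%:R :> R by rewrite ltr0n addnS.
rewrite ler_pdivlMr//.
have h5 : i.+1%:R * q <= 6 * (L + 3)%:R.
  have -> : i.+1%:R * q = N%:R * (i.+1%:R / (3 * M%:R)) * q * (3 * (L + 3)%:R).
    by rewrite EM; field; rewrite !gt_eqF.
  have -> : 6 * (L + 3)%:R = 2 * (3 * (L + 3)%:R) :> R by ring.
  by rewrite ler_wpM2r// mulr_ge0// ltW.
have h6 : i.+2%:R <= 2 * i.+1%:R :> R.
  by rewrite -natrM ler_nat mulnS mul2n -addnn addnA addnC -addn2 leq_add2l leq_addr.
rewrite (le_trans (ler_wpM2l q0 h6))// mulrCA.
by move: h5; rewrite mulrC; lra.
Qed.

(** For [y >= 1], [1 / y^2] is at most [2 / y - 2 / (y + 1)], which telescopes. *)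
Lemma sum_inv_sqr n : \sum_(j < n) (j.+1%:R ^- 2) <= 2 :> R.
Proof.
suff : \sum_(j < n) (j.+1%:R ^- 2) <= 2 - 2 / n.+1%:R :> R.
  by move=> /le_trans; apply; rewrite lerBlDr lerDl divr_ge0.
elim: n => [|n ih]; first by rewrite big_ord0 divr1 subrr.
rewrite big_ord_recr/= (le_trans (lerD ih (lexx _)))//.
rewrite -addrA lerD2l -lerBrDl opprK addrC.
have n0 : 0 < n.+1%:R :> R by [].
have -> : n.+2%:R = n.+1%:R + 1 :> R by rewrite natr1.
have n1 : 1 <= n.+1%:R :> R by rewrite ler1n.
move: (n.+1%:R) n0 n1 => y y0 y1.
rewrite -subr_ge0.
have -> : 2 / y - 2 / (y + 1) - y ^- 2 = (y - 1) / (y ^+ 2 * (y + 1)).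
  by field; rewrite !gt_eqF//; lra.
by rewrite divr_ge0 ?subr_ge0// mulr_ge0 ?sqr_ge0// addr_ge0// ltW.
Qed.

Lemma sum_theta_sqr L M : \sum_(j < M) theta L M j ^+ 2 <= 4 * (12 * (L + 3)%:R) ^+ 2.
Proof.
set K := 12 * (L + 3)%:R; have K0 : 0 <= K by rewrite mulr_ge0.
(* [jstar] is the distance to one of the two ends of the grid. Counting from both ends bounds the
   sum by two sums of inverse squares, each at most 2; hence the factor 4. *)
have le1 (j : 'I_M) : theta L M j ^+ 2 <= K ^+ 2 * (j.+1%:R ^- 2 + (rev_ord j).+1%:R ^- 2).
  apply: (@le_trans _ _ ((K / (jstar M j).+1%:R) ^+ 2)).
    rewrite lerXn2r ?nnegrE ?theta_ge0 ?divr_ge0//.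
    by rewrite /theta ge_min lexx orbT.
  rewrite expr_div_n ler_wpM2l ?sqr_ge0// /jstar.
  have e0 (i : nat) : 0 <= i.+1%:R ^- 2 :> R by rewrite invr_ge0 sqr_ge0.
  have [_|_] := leqP j (M - j); first by rewrite lerDl e0.
  rewrite (le_trans (_ : _ <= (rev_ord j).+1%:R ^- 2))// ?lerDr ?e0//=.
  rewrite lef_pV2 ?posrE ?exprn_gt0// lerXn2r ?nnegrE// ler_nat.
  by rewrite subnSK// leqnSn.
apply: (le_trans (ler_sum _ (fun j _ => le1 j))).
rewrite -mulr_sumr mulrC ler_wpM2r ?sqr_ge0// big_split/=.
rewrite [X in _ + X](reindex_inj rev_ord_inj)/=.
under [X in _ + X]eq_bigr => j _.
  have -> : (M - (M - j.+1).+1).+1 = j.+1 by have := ltn_ord j; lia.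
  over.
have := sum_inv_sqr M; lra.
Qed.

(** Product rule: a shift by [s] changes [dker], of size at most [M], by at most [M^2 |s|], and
    [ravg] by at most [M |s|], the latter entering [L] times. A power [L - 1] of the decaying factor
    survives in both terms. *)
Lemma kern_diff L N j s : (0 < N)%N -> (j <= (L + 3) * N)%N ->
  ((L + 3) * N)%:R * `|s| <= 1 ->
  normc (kern N L (tgrid R ((L + 3) * N) j - s) - kern N L (tgrid R ((L + 3) * N) j)) <=
  ((L + 3) * N)%:R ^+ 2 * `|s| * (L.+1%:R * theta L ((L + 3) * N) j ^+ L.-1).
Proof.
move=> N0 jM hs; set M := ((L + 3) * N)%N in jM hs *.
set t := tgrid R M j; set th := theta L M j.
have q1 : normc (ravg N (expi (t - s))) <= th by exact: ravg_le_theta.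
have q2 : normc (ravg N (expi t)) <= th.
  by rewrite -(subr0 t); apply: ravg_le_theta; rewrite ?normr0 ?mulr0.
have th0 : 0 <= th := theta_ge0 _ _ _.
have hD : ((N.*2 + kfreq N L).+1 <= M)%N.
  rewrite /M /kfreq mulnDl -addnn; case: N N0 {jM hs q1 q2 t th th0} @M => // N _ /=.
  by rewrite mulnS; lia.
have hD' : (N + kfreq N L <= M)%N by lia.
have -> : kern N L (t - s) - kern N L t =
   (dker N L (t - s) - dker N L t) * ravg N (expi (t - s)) ^+ L +
   dker N L t * (ravg N (expi (t - s)) ^+ L - ravg N (expi t) ^+ L) by rewrite /kern; ring.
rewrite (le_trans (normcD _ _))// !normcM.
have a1 : normc (dker N L (t - s) - dker N L t) <= M%:R ^+ 2 * `|s|.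
  rewrite (le_trans (dker_lip _ _ _ _))// expr2 -mulrA.
  apply: ler_pM; rewrite ?mulr_ge0 ?ler_nat// ler_wpM2r// ler_nat//.
have a2 : normc (ravg N (expi (t - s)) ^+ L) <= th ^+ L.-1.
  case: L @M t th {hD hD' a1 jM hs} q1 q2 th0 => [|L] M t th q1 q2 th0; first by rewrite expr0 normc1.
  rewrite normcX exprS -[leRHS]mul1r; apply: ler_pM; rewrite ?normc_ge0 ?exprn_ge0 ?normc_ge0//.
    by rewrite normc_ravg_le1.
  by rewrite lerXn2r ?nnegrE ?normc_ge0.
have a3 : normc (dker N L t) <= M%:R.
  by rewrite (le_trans (normc_dker _ _ _))// ler_nat.
have a4 : normc (ravg N (expi (t - s)) ^+ L - ravg N (expi t) ^+ L) <=
    L%:R * th ^+ L.-1 * (M%:R * `|s|).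
  rewrite (le_trans (normc_subX _ q1 q2))// ler_wpM2l ?mulr_ge0 ?exprn_ge0//.
  rewrite (le_trans (ravg_lip _ _ N0))// ler_wpM2r// ler_nat /M.
  by rewrite leq_pmull// addnS.
apply: (@le_trans _ _ (M%:R ^+ 2 * `|s| * th ^+ L.-1 + M%:R * (L%:R * th ^+ L.-1 * (M%:R * `|s|)))).
  by apply: lerD; apply: ler_pM => //; exact: normc_ge0.
by rewrite le_eqVlt; apply/orP; left; apply/eqP; rewrite -natr1; ring.
Qed.

End kernel_bounds.

(** * Bernstein's inequality and refinement of the step *)

Section bernstein.
Variable R : realType.
Implicit Types (c : int -> R[i]) (x t h s p : R) (n N M L m : nat).

Lemma kfreq_lt N L : (0 < N)%N -> (N.*2 + kfreq N L < (L + 3) * N)%N.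
Proof.
rewrite /kfreq mulnDl -addnn; case: N => // n _ /=.
by rewrite mulnS; lia.
Qed.

Lemma eq_tpx n c c' x : (forall k : int, `|(k%:~R : R)| <= n%:R -> c k = c' k) ->
  tp n c x = tp n c' x.
Proof. by move=> h; rewrite (eq_tp h). Qed.

Lemma avg_tp N c m h x : tp N (fun k => (1 - ravg m (expi (- (k%:~R * h)))) * c k) x =
  tp N c x - (m%:R^-1)%:C * \sum_(l < m) tp N c (x - l%:R * h).
Proof.
under [X in _ - _ * X]eq_bigr do rewrite tp_shift.
rewrite -tp_sum -tpZ -tpN -tpD; apply: eq_bigr => j _; congr (_ * _).
rewrite mulrBl mul1r /ravg -mulrA mulr_suml; congr (_ - _ * _).
by apply: eq_bigr => l _; rewrite -expiMn; congr (expi _ * _); ring.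
Qed.

(* Bernstein's inequality in L_p, p < 1, for averages of small translations. *)
Lemma avg_bernstein p : 0 < p -> p <= 1 -> exists C eps : R, [/\ 0 < C, 0 < eps &
  forall N c m h, (0 < N)%N -> (0 < m)%N -> N%:R * (m%:R * `|h|) <= eps ->
  (Ip p (tp N (fun k => (1 - ravg m (expi (- (k%:~R * h)))) * c k))%R
   <= (C * (N%:R * (m%:R * `|h|)) `^ p)%:E * Ip p (tp N c))%E].
Proof.
(* [(L - 1) p >= 2] makes the [p]-th power of [theta^(L - 1)] at most [theta^2], whose sum over the
   grid is bounded independently of [M]. *)
move=> p0 p1; pose L := (Num.bound (2 / p)).+1.
have Lp : 2 <= L.-1%:R * p.
  by rewrite -ler_pdivrMr// ltW// archi_boundP// divr_ge0// ltW.
pose L3 : R := (L + 3)%:R; have L30 : 0 < L3 by rewrite ltr0n addnS.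
pose K : R := 4 * (12 * L3) ^+ 2.
have K0 : 0 < K by rewrite mulr_gt0// exprn_gt0// mulr_gt0.
exists ((L.+1%:R * L3) `^ p * K), L3^-1; split.
- by rewrite mulr_gt0// powR_gt0// mulr_gt0.
- by rewrite invr_gt0.
move=> N c m h N0 m0; set S := m%:R * `|h|.
have m0' : 0 < m%:R :> R by rewrite ltr0n.
have S0 : 0 <= S by rewrite mulr_ge0.
move=> hNS; pose M := ((L + 3) * N)%N.
have EM : M%:R = L3 * N%:R :> R by rewrite natrM.
have M0 : (0 < M)%N by rewrite muln_gt0 N0 addnS.
have M0' : 0 < M%:R :> R by rewrite ltr0n.
have MS : M%:R * S <= 1.
  by rewrite EM -mulrA -[leRHS](divff (lt0r_neq0 L30)) ler_wpM2l ?(ltW L30).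
pose t j := tgrid R M j.
(* All translates are expanded over the same nodes [t j], so [T] minus the mean of its translates
   has at node [j] the averaged increment [b j] of the kernel. *)
pose b j : R[i] := (M%:R^-1)%:C * ((m%:R^-1)%:C *
  \sum_(l < m) (kern N L (t j) - kern N L (t j - l%:R * h))).
have hM : (N.*2 + kfreq N L < M)%N.
  exact: kfreq_lt.
have -> : tp N (fun k => (1 - ravg m (expi (- (k%:~R * h)))) * c k) =
   (fun x => \sum_(j < M) b j * tp N c (x - t j)).
  apply/funext => x; rewrite avg_tp.
  rewrite -{1}(subr0 x) (kern_reproduces c x 0 N0 hM).
  under [X in _ - _ * X]eq_bigr do rewrite (kern_reproduces c x _ N0 hM).
  rewrite exchange_big/= mulr_sumr -sumrB; apply: eq_bigr => j _.
  rewrite /b subr0 sumrB sumr_const card_ord -/(t j).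
  under eq_bigr do rewrite mulrAC.
  rewrite -mulr_sumr.
  have E : (m%:R^-1)%:C * (kern N L (t j) *+ m) = kern N L (t j) :> R[i].
    by rewrite -[kern N L (t j) *+ m]mulr_natl mulrA -realc_nat -realcM mulVf ?mul1r// gt_eqF.
  rewrite mulrBr E; ring.
have hb j : (j < M)%N -> normc (b j) <= L.+1%:R * (M%:R * S) * theta R L M j ^+ L.-1.
  move=> jM; rewrite /b !normcM !normc_real !ger0_norm ?invr_ge0//.
  rewrite ler_pdivrMl// ler_pdivrMl// (le_trans (normc_sum _ _ _))//.
  apply: (@le_trans _ _ (\sum_(l < m) (M%:R ^+ 2 * S * (L.+1%:R * theta R L M j ^+ L.-1)))).
    apply: ler_sum => l _.
    have hl : `|l%:R * h| <= S.
      by rewrite normrM ger0_norm// ler_wpM2r// ler_nat ltnW.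
    rewrite normc_distC (le_trans (kern_diff N0 (ltnW jM) _))//.
      by rewrite (le_trans _ MS)// ler_wpM2l.
    apply: ler_wpM2r; first by rewrite mulr_ge0// exprn_ge0// theta_ge0.
    by apply: ler_wpM2l => //; rewrite sqr_ge0.
  rewrite sumr_const card_ord -[leLHS]mulr_natl le_eqVlt; apply/orP; left; apply/eqP; ring.
apply: le_trans (Ip_sum _ p0 p1 _) _.
  by move=> j; apply: pmeasZ; apply: pmeas_shift; exact: pmeas_tp.
have mT := pmeas_tp N c.
have EI j : Ip p (fun x => b j * tp N c (x - t j)) = ((normc (b j) `^ p)%:E * Ip p (tp N c))%E.
  by rewrite (IpZ p (b j) (pmeas_shift (- t j) mT)) (Ip_shift p (- t j) mT).
under eq_bigr do rewrite EI.
rewrite -ge0_sume_distrl; last by move=> i _; rewrite lee_fin powR_ge0.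
rewrite lee_wpmul2r ?Ip_ge0// sumEFin lee_fin.
apply: (@le_trans _ _ (\sum_(j < M) (L.+1%:R * (M%:R * S)) `^ p * theta R L M j ^+ 2)).
  apply: ler_sum => j _.
  have th0 := theta_ge0 R L M j; have th1 := theta_le1 R L M j.
  rewrite (le_trans (ler_powR2 (ltW p0) (normc_ge0 _) (hb _ (ltn_ord j))))//.
  rewrite powRM ?mulr_ge0 ?exprn_ge0// ler_wpM2l ?powR_ge0//.
  have [->|tn0] := eqVneq (theta R L M j) 0.
    rewrite expr0n; have -> : (L.-1 == 0)%N = false.
      by apply/negbTE/negP => /eqP L0; move: Lp; rewrite L0 mul0r; lra.
    by rewrite powR0 ?gt_eqF// expr0n.
  have tp0 : 0 < theta R L M j <= 1 by rewrite th1 lt_neqAle eq_sym tn0 th0.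
  by rewrite -powR_mulrn// -powRrM -(powR_mulrn 2 th0) ger_powR.
rewrite -mulr_sumr EM.
have -> : L.+1%:R * (L3 * N%:R * S) = L.+1%:R * L3 * (N%:R * S) by ring.
rewrite [in leLHS]powRM ?mulr_ge0 ?(ltW L30)//.
rewrite mulrAC ler_wpM2r ?powR_ge0// ler_wpM2l ?powR_ge0//.
exact: sum_theta_sqr.
Qed.

Local Opaque tp bser Ip.

Definition dfc a h c : int -> R[i] := fun k => bser a (expi (- (k%:~R * h))) * c k.

(** Write [F] and [G] for the differences with steps [h / m] and [h], and [r = 1 - R]. By
    [bser_refine], [m^(-a) G] is the binomial series of order [a] in [r] applied to [F]. Each power
    of [r] costs a small factor [rho] by the Bernstein inequality, so [F] itself dominates the
    series. *)
Lemma diff_refine p a : 0 < p -> p <= 1 -> 0 < a -> exists C eps : R, [/\ 0 < C, 0 < eps &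
  forall N c m h, (0 < N)%N -> (0 < m)%N -> N%:R * `|h| <= eps ->
  (Ip p (tp N (dfc a (h / m%:R) c)) <=
   (C * m%:R `^ (- (a * p)))%:E * Ip p (tp N (dfc a h c)))%E].
Proof.
move=> p0 p1 a0; have [C0 [e0 [C00 e00 HB]]] := avg_bernstein p0 p1.
have [B hB] := bsum_dcoef a0.
have hB1 i : `|dcoef a i| <= B.
  by apply: le_trans (hB i.+1); rewrite big_ord_recr/= lerDr sumr_ge0.
have B0 : 0 <= B := le_trans (normr_ge0 _) (hB1 0%N).
(* choose the step so small that the correction terms are absorbed *)
pose Bp := B `^ p; have Bp0 : 0 <= Bp := powR_ge0 _ _.
pose rho := (4 * (Bp + 1))^-1.
have rho0 : 0 < rho by rewrite invr_gt0 mulr_gt0// ltr_wpDl.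
have rho1 : rho <= 4^-1.
  by rewrite /rho invfM ler_piMr// invf_le1 ?lerDr// ltr_wpDl.
have rhoB : rho * Bp <= 4^-1.
  rewrite /rho invfM -mulrA ler_piMr// mulrC ler_pdivrMr ?ltr_wpDl// mul1r lerDl//.
(* Three demands on [N |h|]: at most [e0] for the Bernstein inequality, at most 1 for [bser_refine],
   and small enough that [C0 (N |h|)^p <= rho]. *)
pose eps := Num.min (Num.min e0 1) ((rho / C0) `^ p^-1).
have eps0 : 0 < eps by rewrite !lt_min e00 ltr01/= powR_gt0// divr_gt0.
exists 2, eps; split => // N c m h N0 m0 hNh.
have m0' : 0 < m%:R :> R by rewrite ltr0n.
pose h' := h / m%:R; pose F := tp N (dfc a h' c); pose G := tp N (dfc a h c).
suff : (Ip p F <= (2 * m%:R `^ (- (a * p)))%:E * Ip p G)%E by [].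
have mh : m%:R * `|h'| = `|h|.
  by rewrite /h' normrM normfV (@ger0_norm _ m%:R)// mulrCA divff ?mulr1// gt_eqF.
have hNh0 : 0 <= N%:R * `|h| by rewrite mulr_ge0.
have /andP[/andP[hN1 hN2] hN3] : (N%:R * `|h| <= e0) && (N%:R * `|h| <= 1) &&
    (N%:R * `|h| <= (rho / C0) `^ p^-1) by rewrite -!le_min.
pose r k : R[i] := 1 - ravg m (expi (- (k%:~R * h'))).
pose FF i := tp N (fun k => r k ^+ i * dfc a h' c k).
have r1 (k : int) : `|(k%:~R : R)| <= N%:R -> m%:R * `|- (k%:~R * h')| <= 1.
  move=> kN; rewrite normrN normrM mulrCA mh (le_trans _ hN2)//.
  by rewrite ler_wpM2r.
have cser x : has_csum (fun i => (dcoef a i)%:C * FF i x) ((m%:R `^ (- a))%:C * G x).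
  have H1 : has_csum (fun i => tp N (fun k => bterm a (r k) i * dfc a h' c k) x)
     (tp N (fun k => bser a (r k) * dfc a h' c k) x).
    apply: tp_csum => k kN; apply: bserP => //.
    by rewrite (le_trans (normc_one_sub_ravg _ m0))// r1.
  have -> : (m%:R `^ (- a))%:C * G x = tp N (fun k => bser a (r k) * dfc a h' c k) x.
    rewrite /G -tpZ; apply: eq_tpx => k kN.
    rewrite /dfc; have := bser_refine a0 m0 (r1 k kN).
    rewrite -expiMn mulrN mulrCA (_ : m%:R * h' = h); last first.
      by rewrite /h' mulrCA divff ?mulr1// gt_eqF.
    have mm : m%:R `^ (- a) * m%:R `^ a = 1 :> R.
      by rewrite powRN mulVf// gt_eqF// powR_gt0.
    have mmC : (m%:R `^ (- a))%:C * (m%:R `^ a)%:C = 1 :> R[i] by rewrite -realcM mm.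
    move=> ->; rewrite -/(r k); move: (bser a (r k)) (bser a _) => b1 b2.
    by rewrite !mulrA mmC mul1r.
  apply: has_csum_ext H1 => i; rewrite /FF -tpZ.
  by apply: eq_tpx => k _; rewrite /bterm mulrA.
have IFF i : (Ip p (FF i) <= (rho ^+ i)%:E * Ip p F)%E.
  elim: i => [|i ih].
    rewrite expr0 mul1e (_ : FF 0%N = F)//; apply: eq_tp => k _; rewrite expr0 mul1r//.
  have -> : FF i.+1 = tp N (fun k => r k * (r k ^+ i * dfc a h' c k)).
    by apply: eq_tp => k _; rewrite exprS mulrA.
  apply: le_trans (HB _ _ _ _ N0 m0 _) _; first by rewrite mh.
  rewrite exprS (EFinM rho) -[X in (_ <= X)%E]muleA; apply: lee_pmul.
  - by rewrite lee_fin mulr_ge0 ?powR_ge0 ?(ltW C00).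
  - exact: Ip_ge0.
  - rewrite lee_fin mh mulrC -ler_pdivlMr//.
    by rewrite (le_trans (ler_powR2 (ltW p0) hNh0 hN3))// powRVK// divr_ge0 ?ltW.
  - exact: ih.
have FF0 : FF 0%N = F by apply: eq_tp => k _; rewrite expr0 mul1r.
have fin n c' : Ip p (tp n c') \is a fin_num.
  by rewrite ge0_fin_numE ?Ip_ge0 ?(Ip_tp_fin n c' p0).
have IF' : Ip p F \is a fin_num := fin _ _.
have IG' : Ip p G \is a fin_num := fin _ _.
have mFF i : pmeas (FF i) := pmeas_tp _ _.
have mG : pmeas G := pmeas_tp _ _.
clearbody F G FF.
(* The series solved for [F]: its term of index 0 is [F] itself, which leaves [m^(-a) G] minus the
   terms of positive index; these total at most half of [Ip p F]. *)
pose W (i : nat) : R -> R[i] := if i is j.+1 then (fun x => - (dcoef a j.+1)%:C * FF j.+1 x)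
   else (fun x => (m%:R `^ (- a))%:C * G x).
have key : (Ip p F <= (m%:R `^ (- (a * p)))%:E * Ip p G + (2^-1)%:E * Ip p F)%E.
  apply: (Ip_series (F := W)).
  - by case=> [|i]; apply: pmeasZ.
  - move=> x b hb; apply: (has_csum_powR_le p0 p1 (u := fun i => W i x)) hb.
    have h0 : has_csum (fun i : nat => if i is 0 then F x + (m%:R `^ (- a))%:C * G x else 0)
        (F x + (m%:R `^ (- a))%:C * G x).
      have := @has_csum_fin R (fun i : nat => if i is 0 then F x + (m%:R `^ (- a))%:C * G x else 0) 1.
      by rewrite big_ord1; apply; case.
    have h1 := has_csumZ (-1) (cser x).
    have -> : F x = F x + (m%:R `^ (- a))%:C * G x + -1 * ((m%:R `^ (- a))%:C * G x) by ring.
    apply: has_csum_ext (has_csumD h0 h1) => -[|i] /=; last by rewrite add0r mulN1r mulNr.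
    rewrite dcoef0 mul1r.
    by rewrite FF0; ring.
  - move=> n; apply: (@le_trans _ _ (\sum_(i < n.+1) Ip p (W i))%E).
      by rewrite big_ord_recr/= leeDl// Ip_ge0.
    rewrite big_ord_recl/=; apply: leeD.
      by rewrite IpZ// normc_real ger0_norm ?powR_ge0// -powRrM mulNr.
    apply: (@le_trans _ _ (\sum_(i < n) (Bp * rho ^+ i.+1)%:E * Ip p F)%E).
      apply: lee_sum => i _; rewrite IpZ// normcN' normc_real EFinM -muleA.
      apply: lee_pmul; [by rewrite lee_fin powR_ge0|exact: Ip_ge0| |exact: IFF].
      by rewrite lee_fin; exact: ler_powR2 (ltW p0) _ (hB1 _).
    rewrite -ge0_sume_distrl; last first.
      by move=> i _; rewrite lee_fin mulr_ge0// exprn_ge0 ?ltW.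
    rewrite lee_wpmul2r ?Ip_ge0// sumEFin lee_fin.
    under eq_bigr do rewrite exprS mulrA.
    rewrite -mulr_sumr [Bp * _]mulrC.
    have hs : \sum_(i < n) rho ^+ i <= 2.
      have h2 : (1 - rho) * \sum_(i < n) rho ^+ i <= 1.
        by rewrite -opprB mulNr -subrX1 opprB lerBlDr lerDl exprn_ge0 ?ltW.
      have : 2^-1 * \sum_(i < n) rho ^+ i <= 1.
        rewrite (le_trans _ h2)// ler_wpM2r ?sumr_ge0// => [i _|]; last by lra.
        by rewrite exprn_ge0 ?ltW.
      lra.
    apply: (@le_trans _ _ (4^-1 * 2)); last by lra.
    apply: ler_pM => //; first by rewrite mulr_ge0// ltW.
    by rewrite sumr_ge0// => i _; rewrite exprn_ge0 ?ltW.
(* [Ip p F] is finite, so half of it can be absorbed into the left side; hence the constant 2. *)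
have [If IfE] : exists r : R, Ip p F = r%:E by exists (fine (Ip p F)); rewrite (fineK IF').
have [Ig IgE] : exists r : R, Ip p G = r%:E by exists (fine (Ip p G)); rewrite (fineK IG').
move: key; rewrite IfE IgE -!EFinM -EFinD !lee_fin.
move: (m%:R `^ _) => X; clear; lra.
Qed.

End bernstein.

(** * Coefficients folded modulo M *)

Section power_sums.
Variable R : realType.
Implicit Types (s r p x : R).

Lemma powR_one_plus_le r x : 0 < r -> 0 <= x -> x <= 1 ->
  (1 + x) `^ (- r) <= (1 + r * x / 2)^-1.
Proof.
move=> r0 x0 x1; have x1' : 0 < 1 + x by rewrite ltr_pwDl.
have d0 : 0 < 1 + r * x / 2 by rewrite ltr_pwDl// !mulr_ge0// ltW.
rewrite powRN lef_pV2 ?posrE ?powR_gt0//.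
have -> : (1 + x) `^ r = expR (r * ln (1 + x)) by rewrite /powR gt_eqF.
apply: le_trans (expR_ge1Dx _); rewrite lerD2l -mulrA ler_wpM2l ?(ltW r0)//.
(* ln(1+x) = - ln(1 - x/(1+x)) >= x/(1+x) >= x/2 *)
have E : 1 + x = (1 - x / (1 + x))^-1.
  have -> : 1 - x / (1 + x) = (1 + x)^-1 by field; rewrite gt_eqF.
  by rewrite invrK.
have d1 : 0 < 1 - x / (1 + x) by rewrite subr_gt0 ltr_pdivrMr// mul1r ltrDr.
rewrite [in leRHS]E lnV// lerNr.
rewrite (le_trans (le_ln1Dx _)) ?lerN2//.
  by rewrite ltrN2 ltr_pdivrMr// mul1r ltrDr.
by rewrite ler_wpM2l// lef_pV2 ?posrE// -[leRHS]/(1 + 1) lerD2l.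
Qed.

(** A discrete integral comparison: each term is at most a constant times the decrement of
    [k^(- (s - 1))], which telescopes. *)
Lemma psum_gt1 s : 1 < s -> exists B, bsum (fun n => n.+1%:R `^ (- s)) B.
Proof.
move=> s1; pose r := s - 1; have r0 : 0 < r by rewrite subr_gt0.
pose C := 2 * (1 + r / 2) / r; have C0 : 0 < C.
  by rewrite divr_gt0// mulr_gt0// addr_gt0// divr_gt0.
exists C => n.
have step (k : nat) : k.+1%:R `^ (- s) <= C * (k.+1%:R `^ (- r) - k.+2%:R `^ (- r)).
  set y := k.+1%:R; have y1 : 1 <= y :> R by rewrite ler1n.
  have y0 : 0 < y := lt_le_trans ltr01 y1.
  have yV : 0 <= y^-1 by rewrite invr_ge0 ltW.
  have yV1 : y^-1 <= 1 by rewrite invf_le1.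
  have -> : k.+2%:R = y * (1 + y^-1) :> R.
    by rewrite mulrDr mulr1 mulfV ?gt_eqF// natr1.
  rewrite powRM ?(ltW y0) ?addr_ge0//.
  have -> : y `^ (- s) = y `^ (- r) * y^-1.
    rewrite -[X in _ * X]powR_inv1 ?(ltW y0)// -powRD; first by congr (_ `^ _); rewrite /r; ring.
    by apply/implyP => _; rewrite gt_eqF.
  rewrite -[X in _ <= _ * (X - _)]mulr1 -mulrBr mulrCA ler_wpM2l ?powR_ge0//.
  have h := powR_one_plus_le r0 yV yV1.
  apply: (@le_trans _ _ (C * (1 - (1 + r * y^-1 / 2)^-1))); last first.
    by rewrite ler_wpM2l ?(ltW C0)// lerD2l lerN2.
  move: (y^-1) yV yV1 => {}x x0 x1.
  have d0 : 0 < 1 + r * x / 2 by rewrite ltr_pwDl// !mulr_ge0// ltW.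
  have -> : C * (1 - (1 + r * x / 2)^-1) = x * ((1 + r / 2) / (1 + r * x / 2)).
    by rewrite /C; field; rewrite !gt_eqF//= ?r0//; have := d0; lra.
  rewrite ler_peMr// ler_pdivlMr// mul1r lerD2l -mulrA ler_wpM2l ?(ltW r0)//.
  by rewrite ler_piMl.
apply: (@le_trans _ _ (\sum_(i < n) C * (i.+1%:R `^ (- r) - i.+2%:R `^ (- r)))).
  by apply: ler_sum => i _; exact: step.
rewrite -mulr_sumr ler_piMr ?(ltW C0)//.
rewrite -(big_mkord xpredT (fun k => k.+1%:R `^ (- r) - k.+2%:R `^ (- r))).
under eq_bigr do rewrite -opprB.
rewrite sumrN (telescope_sumr (fun k => k.+1%:R `^ (- r)))// opprB powR1.
by rewrite lerBlDr lerDl powR_ge0.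
Qed.

Lemma psum_lt1 s : 0 <= s -> s < 1 -> exists2 C, 0 < C &
  forall n, \sum_(j < n) j.+1%:R `^ (- s) <= C * n%:R `^ (1 - s).
Proof.
move=> s0 s1; pose r := 1 - s; have r0 : 0 < r by rewrite subr_gt0.
pose C := (1 + r) / r; have C0 : 0 < C by rewrite divr_gt0// addr_gt0.
exists C => // n; elim: n => [|k ih]; first by rewrite big_ord0 mulr_ge0 ?powR_ge0// ltW.
rewrite big_ord_recr/= (le_trans (lerD ih (lexx _)))// -/r -lerBrDl -mulrBr.
set y := k.+1%:R; have y1 : 1 <= y :> R by rewrite ler1n.
have y0 : 0 < y := lt_le_trans ltr01 y1.
have -> : k%:R = y * (1 - y^-1) :> R.
  by rewrite mulrBr mulr1 mulfV ?gt_eqF// /y -natr1 addrK.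
have yV : 0 <= y^-1 by rewrite invr_ge0 ltW.
have yV1 : y^-1 <= 1 by rewrite invf_le1.
rewrite powRM ?(ltW y0) ?subr_ge0// -[X in _ <= _ * (X - _)]mulr1 -mulrBr.
have -> : y `^ (- s) = y `^ r * y^-1.
  rewrite -[X in _ * X]powR_inv1 ?(ltW y0)// -powRD; first by congr (_ `^ _); rewrite /r; ring.
  by apply/implyP => _; rewrite gt_eqF.
rewrite mulrCA ler_wpM2l ?powR_ge0//.
have h : (1 - y^-1) `^ r <= (1 + r * y^-1)^-1.
  move: (y^-1) yV yV1 => x x0; rewrite le_eqVlt => /predU1P[->|x1].
    by rewrite subrr powR0 ?gt_eqF// invr_ge0 mulr1 addr_ge0// ltW.
  rewrite [in leLHS]/powR gt_eqF ?subr_gt0//.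
  have d0 : 0 < 1 + r * x by rewrite ltr_pwDl// mulr_ge0// ltW.
  rewrite -[leLHS]invrK lef_pV2 ?posrE ?invr_gt0 ?expR_gt0// -expRN.
  rewrite (le_trans _ (expR_ge1Dx _))// lerD2l -mulrN ler_wpM2l ?(ltW r0)// lerNr.
  by rewrite (le_trans (le_ln1Dx _))// ltrN2.
apply: (@le_trans _ _ (C * (1 - (1 + r * y^-1)^-1))); last first.
  by rewrite ler_wpM2l ?(ltW C0)// lerD2l lerN2.
move: (y^-1) yV yV1 => x x0 x1.
have d0 : 0 < 1 + r * x by rewrite ltr_pwDl// mulr_ge0// ltW.
have -> : C * (1 - (1 + r * x)^-1) = x * ((1 + r) / (1 + r * x)).
  by rewrite /C; field; rewrite !gt_eqF.
rewrite ler_peMr// ler_pdivlMr// mul1r lerD2l ler_piMr// ltW//.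
Qed.

Lemma psum_eq1 : exists2 C, 0 < C &
  forall n, \sum_(j < n) j.+1%:R `^ (- 1) <= C * ln n.+1%:R :> R.
Proof.
exists 2 => // n; elim: n => [|k ih]; first by rewrite big_ord0 ln1 mulr0.
rewrite big_ord_recr/= (le_trans (lerD ih (lexx _)))// -lerBrDl -mulrBr.
set y := k.+1%:R; have y1 : 1 <= y :> R by rewrite ler1n.
have y0 : 0 < y := lt_le_trans ltr01 y1.
have -> : k.+2%:R = y + 1 :> R by rewrite natr1.
have y2 : 0 < y + 1 by rewrite addr_gt0.
rewrite powR_inv1 ?(ltW y0)// -ln_div ?posrE//.
have E : (y + 1) / y = (1 - (y + 1)^-1)^-1.
  have -> : 1 - (y + 1)^-1 = y / (y + 1) by field; rewrite gt_eqF.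
  by rewrite invf_div.
have h : 0 < 1 - (y + 1)^-1 by rewrite subr_gt0 invf_lt1// ltrDr.
rewrite E lnV// (@le_trans _ _ (2 * (y + 1)^-1))//.
  rewrite ler_pdivlMr// mulrC ler_pdivrMr//; lra.
rewrite ler_wpM2l// lerNr (le_trans (le_ln1Dx _))//.
by rewrite ltrN2 invf_lt1// ltrDr.
Qed.

End power_sums.

Section folded_coefficients.
Variable R : realType.
Implicit Types (a p : R) (z : R[i]).

Definition foldc a M (j : nat) : R := limn (series (fun l => dcoef a (j + l * M)%N)).

Lemma bsum_sub (u : nat -> R) B (M j : nat) : (0 < M)%N -> (forall n, 0 <= u n) ->
  bsum u B -> bsum (fun l => u (j + l * M)%N) B.
Proof.
move=> M0 u0 hB n.
apply: le_trans (hB (j + n * M)%N).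
elim: n => [|n ih]; first by rewrite big_ord0 sumr_ge0.
rewrite big_ord_recr/= (le_trans (lerD ih (lexx _)))//.
have -> : (j + n.+1 * M = (j + n * M) + M.-1.+1)%N by rewrite prednK// mulSn; lia.
rewrite [leRHS]big_split_ord/= lerD2l big_ord_recl/= addn0 lerDl sumr_ge0//.
Qed.

Lemma cvg_foldc a M j : 0 < a -> (0 < M)%N ->
  series (fun l => dcoef a (j + l * M)%N) @ \oo --> foldc a M j.
Proof.
move=> a0 M0; have [B hB] := bsum_dcoef a0.
have hB' := bsum_sub j M0 (fun n => normr_ge0 _) hB.
apply: (@normed_cvg _ R^o); apply: nondecreasing_is_cvgn.
  by apply/nondecreasing_seqP => n; rewrite /= /series/= big_nat_recr//= lerDl.
by exists B => _ [n _ <-]; rewrite /= /series/= big_mkord.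
Qed.

Lemma sum_mul_blocks (V : nmodType) (u : nat -> V) n M :
  \sum_(i < n * M) u i = \sum_(j < M) \sum_(l < n) u (j + l * M)%N.
Proof.
elim: n => [|n ih].
  by rewrite mul0n big_ord0 big1// => j _; rewrite big_ord0.
under [RHS]eq_bigr do rewrite big_ord_recr/=.
rewrite big_split/= -ih mulSn addnC big_split_ord/=; congr (_ + _).
by apply: eq_bigr => j _; rewrite addnC.
Qed.

(** At an [M]-th root of unity [z^(j + l M) = z^j], so the binomial series can be summed by residue
    classes. Partial sums are compared over whole blocks of length [M]. *)
Lemma foldc_bser a M z : 0 < a -> (0 < M)%N -> normc z <= 1 -> z ^+ M = 1 ->
  \sum_(j < M) (foldc a M j)%:C * z ^+ j = bser a z.
Proof.
move=> a0 M0 z1 zM; apply/eqP; rewrite -subr_eq0; apply/eqP/eq0_normc/eqP.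
rewrite eq_le normc_ge0 andbT; apply/ler_addgt0Pr => e e0; rewrite add0r.
have e20 : 0 < e / 2 by rewrite divr_gt0.
have [n1 h1] := bserP a0 z1 e20.
have : \sum_(j < M) `|foldc a M j - series (fun l => dcoef a (j + l * M)%N) n| @[n --> \oo]
    --> (0 : R).
  rewrite [X in _ --> X](_ : 0 = \sum_(j < M) `|foldc a M j - foldc a M j|); last first.
    by rewrite big1// => j _; rewrite subrr normr0.
  apply: cvg_big => [|j _]; first exact: add_continuous.
  by apply: cvg_norm; apply: cvgB; [exact: cvg_cst|exact: cvg_foldc].
move=> /cvgrPdist_le /(_ _ e20) [n2 _ h2].
pose n := maxn n1 n2.
have := h2 n (leq_maxr _ _); rewrite sub0r normrN ger0_norm ?sumr_ge0// => {}h2.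
have := h1 (n * M)%N; rewrite (leq_trans (leq_maxl n1 n2)) ?leq_pmulr// => /(_ isT) {}h1.
have E : \sum_(i < n * M) bterm a z i =
    \sum_(j < M) (series (fun l => dcoef a (j + l * M)%N) n)%:C * z ^+ j.
  rewrite sum_mul_blocks; apply: eq_bigr => j _.
  rewrite /series/= big_mkord realc_sum mulr_suml; apply: eq_bigr => l _.
  by rewrite /bterm exprD mulnC exprM zM expr1n mulr1.
have -> : \sum_(j < M) (foldc a M j)%:C * z ^+ j - bser a z =
   (\sum_(j < M) (foldc a M j)%:C * z ^+ j - \sum_(i < n * M) bterm a z i) +
   (\sum_(i < n * M) bterm a z i - bser a z) by ring.
rewrite (le_trans (normcD _ _))// (splitr e) lerD//.
rewrite E -sumrB (le_trans (normc_sum _ _ _))// (le_trans _ h2)//.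
apply: ler_sum => j _; rewrite -mulrBl -realcN -realcD normcM normc_real normcX.
by rewrite ler_piMr// exprn_ile1// normc_ge0.
Qed.

Lemma foldc_le a M j (u : nat -> R) B : 0 < a -> (0 < M)%N ->
  (forall l, `|dcoef a (j + l * M)%N| <= u l) -> bsum u B -> `|foldc a M j| <= B.
Proof.
move=> a0 M0 hu hB; have /cvg_norm c := cvg_foldc (j := j) a0 M0.
apply: (cvgr_to_le c); apply: nearW => n /=.
rewrite /series/= big_mkord (le_trans (ler_norm_sum _ _ _))// (le_trans _ (hB n))//.
by apply: ler_sum => l _.
Qed.

(** Subadditivity within each residue class: folding does not increase the sum of [p]-th powers. *)
Lemma foldc_powR_le p a M B : 0 < p -> p <= 1 -> 0 < a -> (0 < M)%N ->
  bsum (fun n => `|dcoef a n| `^ p) B -> \sum_(j < M) `|foldc a M j| `^ p <= B.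
Proof.
move=> p0 p1 a0 M0 hB.
pose v j l := `|dcoef a (j + l * M)%N| `^ p.
have hv j : bsum (v j) B by apply: (bsum_sub j M0 _ hB) => n; exact: powR_ge0.
have v0 j l : 0 <= v j l := powR_ge0 _ _.
pose b j := limn (series (v j)).
have cb j : series (v j) @ \oo --> b j.
  apply: nondecreasing_is_cvgn.
    by apply/nondecreasing_seqP => n; rewrite seriesSr lerDl.
  by exists B => _ [n _ <-]; rewrite /series/= big_mkord; exact: hv.
have hb j : bsum (v j) (b j).
  move=> n; rewrite -(big_mkord xpredT) -/(series (v j) n).
  apply: nondecreasing_cvgn_le; last exact: cb.
  by apply/nondecreasing_seqP => k; rewrite seriesSr lerDl.
apply: (@le_trans _ _ (\sum_(j < M) b j)).
  apply: ler_sum => j _; rewrite -(powRVK p0 (bsum_ge0 (hb j))) ler_powR2 ?(ltW p0)//.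
  apply: (@foldc_le a M j (fun l => `|dcoef a (j + l * M)%N|)) => //.
  by apply: (bsum_powR p0 p1 _ (hb j)) => l; exact: normr_ge0.
have : \sum_(j < M) series (v j) n @[n --> \oo] --> \sum_(j < M) b j.
  by apply: cvg_big => [|j _]; [exact: add_continuous|exact: cb].
move/cvgr_to_le; apply; apply: nearW => n.
apply: (@le_trans _ _ (\sum_(i < n * M) `|dcoef a i| `^ p)); last exact: hB.
rewrite (sum_mul_blocks (fun i => `|dcoef a i| `^ p)).
by apply: ler_sum => j _; rewrite /series/= big_mkord.
Qed.

(** Since [j < M], [j + l M + 1 >= l (j + 1)] for [l >= 1]; the later terms of the class are thus
    bounded by the bound of the first one times [l^(- (1 + a))], which is summable. *)
Lemma foldc_decay a : 0 < a -> exists2 C, 0 < C & forall M j, (j < M)%N ->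
  `|foldc a M j| <= C * j.+1%:R `^ (- (1 + a)).
Proof.
move=> a0; have [C C0 hC] := dcoef_decay a0.
have a1 : 1 < 1 + a by rewrite ltrDl.
have [Z hZ'] := psum_gt1 a1.
exists (C * (1 + Z)) => [|M j jM].
  by rewrite mulr_gt0// ltr_pwDl// (bsum_ge0 hZ').
have M0 : (0 < M)%N by rewrite (leq_ltn_trans _ jM).
have Zp : 0 <= Z := bsum_ge0 hZ'.
pose w : R := j.+1%:R `^ (- (1 + a)).
have w0 : 0 <= w := powR_ge0 _ _.
apply: (@foldc_le a M j (fun l => if l is i.+1 then C * (w * i.+1%:R `^ (- (1 + a))) else C * w)) => //.
  case=> [|i]; first by rewrite addn0; exact: hC.
  rewrite (le_trans (hC _))// ler_wpM2l ?(ltW C0)// /w -powRM// -natrM.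
  rewrite !powRN lef_pV2 ?posrE ?powR_gt0 ?ltr0n ?muln_gt0//.
  rewrite ler_powR2 ?addr_ge0 ?(ltW a0)// ler_nat.
  by rewrite mulnC (leq_trans (leq_mul (leqnn _) jM))// ltnW// ltnS leq_addl.
case=> [|n]; first by rewrite big_ord0 mulr_ge0// ?mulr_ge0 ?addr_ge0// ltW.
rewrite big_ord_recl/= -mulrA [leRHS]mulrCA -!mulr_sumr -mulrDr [leRHS]mulrCA.
rewrite ler_wpM2l ?(ltW C0)// mulrDl mul1r [Z * _]mulrC lerD2l ler_wpM2l//.
exact: hZ'.
Qed.

End folded_coefficients.

Section sigma_bound.
Variable R : realType.
Implicit Types (a p : R).

Lemma posnatP a : is_posnat a -> exists n : nat, a = n.+1%:R.
Proof.
by move=> /andP[/Num.Theory.natrP[[|n] ->]]; [rewrite ltxx|exists n].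
Qed.

Lemma bsum_dcoef_powR p a : 0 < p -> p <= 1 -> 0 < a ->
  is_posnat a || (p^-1 - 1 < a) -> exists B, bsum (fun n => `|dcoef a n| `^ p) B.
Proof.
move=> p0 p1 a0 /orP[/posnatP[m ->]|pa].
  exists (\sum_(i < m.+2) `|dcoef m.+1%:R i : R| `^ p) => n.
  have [nm|mn] := leqP n m.+2.
    by rewrite -(subnKC nm) big_split_ord/= lerDl sumr_ge0// => i _; exact: powR_ge0.
  rewrite -(subnKC (ltnW mn)) big_split_ord/= [X in _ + X]big1 ?addr0// => i _.
  by rewrite dcoef_nat ?normr0 ?powR0 ?gt_eqF// leq_addr.
have [C C0 hC] := dcoef_decay a0.
have s1 : 1 < (1 + a) * p.
  by rewrite -ltr_pdivrMr// mul1r addrC -ltrBlDr.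
have [B hB] := psum_gt1 s1.
exists (C `^ p * B) => n.
apply: (@le_trans _ _ (\sum_(i < n) C `^ p * i.+1%:R `^ (- ((1 + a) * p)))).
  apply: ler_sum => i _; rewrite (le_trans (ler_powR2 (ltW p0) _ (hC i)))//.
  by rewrite powRM ?powR_ge0 ?(ltW C0)// -powRrM mulNr.
by rewrite -mulr_sumr ler_wpM2l ?powR_ge0.
Qed.

(** [M^(- a p) sigma^p] equals 1, [ln (M + 1)] or [M^(1 - (1 + a) p)] in the three cases. In the
    first the unfolded series is already [p]-summable; in the others the decay of the folded
    coefficients is summed over [j < M]. *)
Lemma foldc_sigma p a : 0 < p -> p <= 1 -> 0 < a -> exists2 C, 0 < C &
  forall M, (0 < M)%N -> \sum_(j < M) `|foldc a M j| `^ p <=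
    C * (M%:R `^ (- (a * p)) * sigma a p M `^ p).
Proof.
move=> p0 p1 a0.
case: (boolP (is_posnat a || (p^-1 - 1 < a))) => hc.
  have [B hB] := bsum_dcoef_powR p0 p1 a0 hc.
  exists (B + 1) => [|M M0]; first by rewrite ltr_wpDl// (bsum_ge0 hB).
  rewrite /sigma hc -powRrM -powRD; last by apply/implyP => _; rewrite pnatr_eq0 -lt0n.
  by rewrite addNr powRr0 mulr1 (le_trans (foldc_powR_le p0 p1 a0 M0 hB))// lerDl.
have [C C0 hC] := foldc_decay a0.
have sumle M : \sum_(j < M) `|foldc a M j| `^ p <=
    C `^ p * \sum_(j < M) j.+1%:R `^ (- ((1 + a) * p)).
  rewrite mulr_sumr; apply: ler_sum => j _.
  rewrite (le_trans (ler_powR2 (ltW p0) _ (hC _ _ (ltn_ord j))))//.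
  by rewrite powRM ?powR_ge0 ?(ltW C0)// -powRrM mulNr.
have Cp : 0 < C `^ p by rewrite powR_gt0.
case: (eqVneq a (p^-1 - 1)) => [ea|na].
  have [C1 C10 hC1] := psum_eq1 R.
  have ap : (1 + a) * p = 1 by rewrite ea addrC subrK mulVf// gt_eqF.
  exists (C `^ p * C1) => [|M M0]; first exact: mulr_gt0.
  rewrite (le_trans (sumle M))// -mulrA ler_wpM2l ?(ltW Cp)// ap.
  rewrite /sigma (negbTE hc) -ea eqxx powRM ?powR_ge0// -!powRrM mulrA -powRD; last first.
    by apply/implyP => _; rewrite pnatr_eq0 -lt0n.
  rewrite addNr powRr0 mul1r mulVf ?gt_eqF// powRr1//.
  by rewrite ln_ge0// ler1n.
have alt : a < p^-1 - 1.
  by rewrite lt_neqAle na/= leNgt; apply: contra hc => ->; rewrite orbT.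
have s1 : (1 + a) * p < 1 by rewrite -ltr_pdivlMr// div1r addrC -ltrBrDr.
have s0 : 0 <= (1 + a) * p by rewrite mulr_ge0 ?addr_ge0// ltW.
have [C1 C10 hC1] := psum_lt1 s0 s1.
exists (C `^ p * C1) => [|M M0]; first exact: mulr_gt0.
rewrite (le_trans (sumle M))// -mulrA ler_wpM2l ?(ltW Cp)//.
rewrite /sigma (negbTE hc) (negbTE na) -powRrM -powRD; last first.
  by apply/implyP => _; rewrite pnatr_eq0 -lt0n.
have -> : - (a * p) + (p^-1 - 1) * p = 1 - (1 + a) * p.
  by rewrite mulrBl mulVf ?gt_eqF//; ring.
exact: hC1.
Qed.

End sigma_bound.

(** * Fractional differences in L_p *)

Section fdiff_bounds.
Variable R : realType.
Implicit Types (c : int -> R[i]) (f : R -> R[i]) (p a h : R).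
Local Opaque tp bser.

Lemma cvg_limn_complex (u : nat -> R[i]) S : has_csum u S ->
  limn (series (u : nat -> R[i]^o)) = S.
Proof.
move=> hS; apply: (@cvg_lim R[i]^o); first exact: norm_hausdorff.
apply/cvgrPdist_le => e e0.
have Ee : e = (complex.Re e)%:C by rewrite RRe_real// gtr0_real.
have e0' : 0 < complex.Re e by move: e0; rewrite {1}Ee ltcR.
have [n0 hn0] := hS _ e0'; exists n0 => // n /= /hn0 hn.
have -> : `|(S : R[i]^o) - series (u : nat -> R[i]^o) n| = (normc (S - \sum_(i < n) u i))%:C.
  rewrite /series/= big_mkord.
  by case: (S - _) => x y; rewrite normc_def.
by rewrite Ee lecR normc_distC.
Qed.

Lemma fdiffE a h f x S : has_csum (fun n => (dcoef a n)%:C * f (x - n%:R * h)) S ->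
  fdiff a h f x = S.
Proof. exact: cvg_limn_complex. Qed.

Lemma has_csum_tp_diff N c a h x : 0 < a ->
  has_csum (fun n => (dcoef a n)%:C * tp N c (x - n%:R * h)) (tp N (dfc a h c) x).
Proof.
move=> a0.
have H : has_csum (fun i => tp N (fun k => bterm a (expi (- (k%:~R * h))) i * c k) x)
    (tp N (dfc a h c) x).
  by apply: tp_csum => k _; apply: bserP => //; exact: normc_expi_le1.
apply: has_csum_ext H => n; rewrite tp_shift -tpZ; apply: eq_tpx => k _.
by rewrite /bterm -expiMn mulrA; congr (_ * expi _ * _); ring.
Qed.

(* Where the series diverges, so does its majorant. *)
Lemma Ip_fdiff p a h B N c f : 0 < p -> p <= 1 -> 0 < a -> pmeas f ->
  bsum (fun n => `|dcoef a n| `^ p) B ->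
  (Ip p (fdiff a h f) <= Ip p (tp N (dfc a h c)) +
     B%:E * Ip p (fun x => f x - tp N c x)%R)%E.
Proof.
move=> p0 p1 a0 mf hB.
have mg : pmeas (fun x => f x - tp N c x) by apply: pmeasB => //; exact: pmeas_tp.
pose F (n : nat) : R -> R[i] := if n is k.+1 then
  (fun x => (dcoef a k)%:C * ((fun x => f x - tp N c x) (x + - (k%:R * h))))
  else tp N (dfc a h c).
have mF n : pmeas (F n).
  case: n => [|k]; first exact: pmeas_tp.
  by apply: pmeasZ; exact: (pmeas_shift (- (k%:R * h)) mg).
apply: (Ip_series mF).
- move=> x b hb.
  pose v k := (dcoef a k)%:C * (f (x - k%:R * h) - tp N c (x - k%:R * h)).
  have hv : bsum (fun k => normc (v k) `^ p) (b - normc (tp N (dfc a h c) x) `^ p).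
    by move=> n; rewrite lerBrDl; have := hb n.+1; rewrite big_ord_recl.
  have [S hS] := csum_exists (bsum_powR p0 p1 (fun k => normc_ge0 (v k)) hv).
  have -> : fdiff a h f x = S + tp N (dfc a h c) x.
    apply: fdiffE; apply: has_csum_ext (has_csumD hS (has_csum_tp_diff N c h x a0)) => n.
    by rewrite /v mulrBr subrK.
  apply: (@le_trans _ _ (normc S `^ p + normc (tp N (dfc a h c) x) `^ p)).
    rewrite (le_trans _ (powR_subadd p0 p1 _ _)) ?normc_ge0//.
    by rewrite ler_powR2 ?normc_ge0 ?normcD ?(ltW p0).
  by rewrite -lerBrDr (has_csum_powR_le p0 p1 hS).
- move=> n; apply: (@le_trans _ _ (\sum_(i < n.+1) Ip p (F i))%E).
    by rewrite big_ord_recr/= leeDl// Ip_ge0.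
  rewrite big_ord_recl/=; apply: leeD => //.
  have E i : Ip p (F i.+1) = ((`|dcoef a i| `^ p)%:E * Ip p (fun x => f x - tp N c x)%R)%E.
    rewrite /F (IpZ p _ (pmeas_shift (- (i%:R * h)) mg)) (Ip_shift p _ mg).
    by rewrite normc_real.
  under eq_bigr => i _ do rewrite add0n E.
  rewrite -ge0_sume_distrl; last by move=> i _; rewrite lee_fin powR_ge0.
  rewrite lee_wpmul2r ?Ip_ge0// sumEFin lee_fin; exact: hB.
Qed.

Lemma Ip_dfc_le p a h B N c : 0 < p -> p <= 1 -> 0 < a ->
  bsum (fun n => `|dcoef a n| `^ p) B ->
  (Ip p (tp N (dfc a h c)) <= B%:E * Ip p (tp N c))%E.
Proof.
move=> p0 p1 a0 hB; have mT := pmeas_tp N c.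
apply: (Ip_translates (c := fun n => (dcoef a n)%:C) (t := fun n => - (n%:R * h)) p0 p1 mT).
- by move=> x b; apply: has_csum_powR_le => //; exact: has_csum_tp_diff.
- by move=> n; under eq_bigr do rewrite normc_real.
Qed.

(** For [r >= eps] the plain bound of the difference suffices. Otherwise [h] is the [m]-th part of a
    step [h m] still admissible for [diff_refine], and the gain [m^(- b p)] is of order
    [r^(b p)]. *)
Lemma diff_small_step p b : 0 < p -> p <= 1 -> 0 < b -> is_posnat b || (p^-1 - 1 < b) ->
  exists2 C, 0 < C & forall N c h r, (0 < N)%N -> 0 < r -> N%:R * `|h| <= r ->
   (Ip p (tp N (dfc b h c)) <= (C * r `^ (b * p))%:E * Ip p (tp N c))%E.
Proof.
move=> p0 p1 b0 hb; have [B hB] := bsum_dcoef_powR p0 p1 b0 hb.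
have [C [eps [C0 e0 HC]]] := diff_refine p0 p1 b0.
have B0 := bsum_ge0 hB; have bp0 : 0 < b * p by rewrite mulr_gt0.
pose D := (B + 1) * (1 + C) * (2 / eps) `^ (b * p).
exists D => [|N c h r N0 r0 hr].
  by rewrite !mulr_gt0 ?powR_gt0 ?divr_gt0// ltr_wpDl// ltW.
have [er|re] := leP eps r.
  apply: (le_trans (Ip_dfc_le h N c p0 p1 b0 hB)).
  rewrite lee_wpmul2r ?Ip_ge0// lee_fin /D -[_ * r `^ _]mulrA -powRM ?divr_ge0 ?(ltW e0) ?(ltW r0)//.
  rewrite -[leLHS]mulr1; apply: ler_pM => //.
    by have := mulr_ge0 B0 (ltW C0); lra.
  have {1}-> : 1 = (1 : R) `^ (b * p) by rewrite powR1.
  rewrite ler_powR2 ?(ltW bp0)//.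
  by rewrite mulrAC ler_pdivlMr// mul1r; lra.
(* As [eps / r > 1], truncation loses at most a factor 2: [eps / r < m + 1 <= 2 m]. This is the 2 in
   [D]. *)
pose m := Num.trunc (eps / r).
have er0 : 0 <= eps / r by rewrite divr_ge0 ?ltW.
have /andP[m1 m2] := Num.Theory.truncn_itv er0.
have er1 : 1 < eps / r by rewrite ltr_pdivlMr// mul1r.
have m0 : (0 < m)%N by have := lt_trans er1 m2; rewrite ltr1n ltnS.
have m0' : 0 < m%:R :> R by rewrite ltr0n.
have := HC N c m (h * m%:R) N0 m0.
rewrite mulfK ?gt_eqF// => /(_ _)/le_trans; apply.
  rewrite normrM (@ger0_norm _ m%:R)// mulrA.
  by rewrite (le_trans (ler_wpM2r _ hr))// mulrC -ler_pdivlMr.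
apply: (le_trans (lee_wpmul2l _ (Ip_dfc_le (h * m%:R) N c p0 p1 b0 hB))).
  by rewrite lee_fin mulr_ge0 ?powR_ge0// ltW.
rewrite muleA -EFinM lee_wpmul2r ?Ip_ge0// lee_fin.
have hm : m%:R `^ (- (b * p)) <= (2 / eps) `^ (b * p) * r `^ (b * p).
  have y0 : 0 < 2 / eps * r by rewrite mulr_gt0// divr_gt0.
  rewrite -powRM ?divr_ge0 ?(ltW e0) ?(ltW r0)// powRN -[leRHS]invrK.
  rewrite lef_pV2 ?posrE ?invr_gt0 ?powR_gt0// -powRN -mulN1r powRrM.
  rewrite powR_inv1 ?(ltW y0)// ler_powR2 ?(ltW bp0) ?invr_ge0 ?(ltW y0)//.
  have -> : (2 / eps * r)^-1 = (eps / r) / 2 by field; rewrite !gt_eqF.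
  have : 1 <= m%:R :> R by rewrite ler1n.
  move: m2; rewrite -/m -natr1; lra.
apply: (@le_trans _ _ (C * ((2 / eps) `^ (b * p) * r `^ (b * p)) * B)).
  by rewrite ler_wpM2r// ler_wpM2l// ltW.
have -> : D * r `^ (b * p) =
  ((1 + C) * ((2 / eps) `^ (b * p) * r `^ (b * p))) * (B + 1) by rewrite /D; ring.
have X0 : 0 <= (2 / eps) `^ (b * p) * r `^ (b * p) by rewrite mulr_ge0 ?powR_ge0.
apply: ler_pM; rewrite ?mulr_ge0 ?powR_ge0 ?(ltW C0) ?lerDl//.
by rewrite ler_wpM2r// lerDr.
Qed.

End fdiff_bounds.

(** * Differences on a grid of the torus *)

Section grid_difference.
Variable R : realType.
Implicit Types (c : int -> R[i]) (f : R -> R[i]) (p a h : R).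
Local Opaque tp bser.

Definition AM a M f (x : R) : R[i] :=
  \sum_(j < M) (foldc a M j)%:C * f (x - tgrid R M j).

Lemma pmeas_AM a M f : pmeas f -> pmeas (AM a M f).
Proof. by move=> mf; apply: pmeas_sum => j; apply: pmeasZ; exact: pmeas_shift. Qed.

Lemma AMB a M f g : AM a M (fun x => f x - g x) = (fun x => AM a M f x - AM a M g x).
Proof. by apply/funext => x; rewrite /AM -sumrB; apply: eq_bigr => j _; rewrite mulrBr. Qed.

Definition gstep M : R := 2 * pi / M%:R.

Lemma AM_tp a M N c : 0 < a -> (0 < M)%N -> AM a M (tp N c) = tp N (dfc a (gstep M) c).
Proof.
move=> a0 M0; apply/funext => x; rewrite /AM.
under eq_bigr do rewrite tp_shift -tpZ.
rewrite -tp_sum; apply: eq_tpx => k _; rewrite /dfc.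
have M0' : M%:R != 0 :> R by rewrite pnatr_eq0 -lt0n.
rewrite -(@foldc_bser R a M _ a0 M0 (normc_expi_le1 _)); last first.
  rewrite -expiMn mulrN mulrCA /gstep [M%:R * _]mulrCA divff// mulr1 expiN.
  by rewrite expi_2piMz invr1.
rewrite mulr_suml; apply: eq_bigr => j _.
rewrite mulrA -expiMn; congr (_ * expi _ * _).
by rewrite /tgrid /gstep; ring.
Qed.

Lemma Ip_AM p a M f B : 0 < p -> p <= 1 -> pmeas f ->
  \sum_(j < M) `|foldc a M j| `^ p <= B ->
  (Ip p (AM a M f) <= B%:E * Ip p f)%E.
Proof.
move=> p0 p1 mf hB.
have mj (j : 'I_M) : pmeas (fun x => (foldc a M j)%:C * f (x - tgrid R M j)).
  by apply: pmeasZ; exact: pmeas_shift.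
apply: (le_trans (Ip_sum _ p0 p1 mj)).
have E (j : 'I_M) : Ip p (fun x => (foldc a M j)%:C * f (x - tgrid R M j)) =
    ((`|foldc a M j| `^ p)%:E * Ip p f)%E.
  by rewrite (IpZ p _ (pmeas_shift (- tgrid R M j) mf)) (Ip_shift p _ mf) normc_real.
under eq_bigr do rewrite E.
rewrite -ge0_sume_distrl; last by move=> i _; rewrite lee_fin powR_ge0.
by rewrite lee_wpmul2r ?Ip_ge0// sumEFin lee_fin.
Qed.

End grid_difference.

(** * Multipliers of fractional differences *)

Section bernoulli_concave.
Variable R : realType.
Implicit Types (s x y : R).

(** With [x = exp y], the bounds [1 + u <= exp u] at [u = (1 - s) y] and [u = - s y] are multiplied
    by [x^s] and combined with weights [s] and [1 - s], so that the linear terms in [y] cancel. *)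
Lemma powR_le_tangent s x : 0 <= s -> s <= 1 -> 0 < x -> x `^ s <= 1 + s * (x - 1).
Proof.
move=> s0 s1 x0; have [y ->] : exists y, x = expR y by exists (ln x); rewrite lnK.
rewrite -expRM mulrC; pose E := expR (y * s).
have E0 : 0 <= E := expR_ge0 _.
have h1 : E * (1 + (1 - s) * y) <= expR y.
  rewrite -[in leRHS](subrK (y * s) y) expRD mulrC ler_wpM2r//.
  by rewrite (le_trans _ (expR_ge1Dx _))// lerD2l; lra.
have h2 : E * (1 - s * y) <= 1.
  rewrite -[leRHS](expR0) -[in leRHS](addNr (y * s)) expRD mulrC ler_wpM2r//.
  by rewrite (le_trans _ (expR_ge1Dx _))// lerD2l; lra.
have H := lerD (ler_wpM2l s0 h1) (ler_wpM2l (_ : 0 <= 1 - s) h2).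
rewrite mulr1 in H; rewrite mulrC -/E.
apply: (@le_trans _ _ (s * expR y + (1 - s))); last by lra.
apply: le_trans (H _); last by lra.
by rewrite le_eqVlt; apply/orP; left; apply/eqP; ring.
Qed.

(** With [s = 1 - g] and [x = 1 / (j + 1)] the product is the quotient of consecutive values of
    [lratio] below: first-order terms cancel, and a defect of order [x^2] is summable. The lower
    bound comes from the tangent inequality at [1 / (1 + x)]. *)
Lemma powR_ratio_bounds s x : 0 <= s -> s <= 1 -> 0 <= x -> x <= 1 ->
  1 - 2 * x ^+ 2 <= (1 - s * x) * (1 + x) `^ s <= 1.
Proof.
move=> s0 s1 x0 x1; have x1' : 0 < 1 + x by rewrite ltr_pwDl.
have sx1 : 0 <= 1 - s * x.
  by rewrite subr_ge0 (le_trans (ler_pM s0 x0 s1 x1))// mulr1.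
have up : (1 + x) `^ s <= 1 + s * x.
  by rewrite (le_trans (powR_le_tangent s0 s1 x1'))// addrAC subrr add0r.
apply/andP; split; last first.
  apply: (le_trans (ler_wpM2l sx1 up)).
  by have := sqr_ge0 (s * x); rewrite expr2; lra.
have lo : 1 + s * x - s * x ^+ 2 <= (1 + x) `^ s.
  have iv0 : 0 < (1 + x)^-1 by rewrite invr_gt0.
  have := powR_le_tangent s0 s1 iv0.
  have -> : (1 + x)^-1 `^ s = ((1 + x) `^ s)^-1.
    by rewrite -[(1 + x)^-1]powR_inv1 ?(ltW x1')// -powRrM mulN1r powRN.
  have P0 : 0 < (1 + x) `^ s by rewrite powR_gt0.
  have -> : (1 + x)^-1 - 1 = - (x / (1 + x)) by field; rewrite gt_eqF.
  set P := _ `^ s; set q := x / (1 + x).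
  have q0 : 0 <= q by rewrite divr_ge0// ltW.
  have qx : x - x ^+ 2 <= q.
    rewrite ler_pdivlMr//; have := mulr_ge0 x0 (sqr_ge0 x); lra.
  rewrite -[X in X <= _]div1r ler_pdivrMr// => h.
  have sq := ler_wpM2l s0 qx.
  have : (1 + s * q) * 1 <= (1 + s * q) * ((1 + s * - q) * P).
    by rewrite ler_wpM2l// addr_ge0// mulr_ge0.
  have := mulr_ge0 (sqr_ge0 (s * q)) (ltW P0); rewrite -/P.
  lra.
apply: le_trans (ler_wpM2l sx1 lo).
have s2 : s * s <= s by rewrite ler_piMr.
have x2 := sqr_ge0 x.
have h1 : s * s * x ^+ 2 <= 1 * x ^+ 2 by rewrite ler_wpM2r// (le_trans s2).
have h2 : s * x ^+ 2 <= 1 * x ^+ 2 by rewrite ler_wpM2r.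
have h3 : 0 <= s * s * (x * x ^+ 2) by rewrite !mulr_ge0.
lra.
Qed.

End bernoulli_concave.

Section refined_difference_kernel.
Variable R : realType.
Implicit Types (g a b : R) (z : R[i]).

(** [dcoef (- g) j] behaves like [j^(g - 1) / Gamma(g)]; dividing by the power leaves a slowly
    varying factor, which for [0 < g < 1] decreases within [[0, 1]]. *)
Definition lratio g j : R := dcoef (- g) j * j.+1%:R `^ (1 - g).

Lemma lratioE g j : 0 < g -> dcoef (- g) j = lratio g j * j.+1%:R `^ (g - 1).
Proof.
by move=> g0; rewrite /lratio -mulrA -powRD ?subrKA ?subrr ?powRr0 ?mulr1//;
  apply/implyP => _; rewrite pnatr_eq0.
Qed.

Lemma lratio_step g j : 0 < g -> g < 1 -> 0 <= lratio g j ->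
  (1 - 2 * (j.+1%:R^-1) ^+ 2) * lratio g j <= lratio g j.+1 <= lratio g j.
Proof.
move=> g0 g1 L0; pose x : R := j.+1%:R^-1.
have j0 : 0 < j.+1%:R :> R by [].
have x0 : 0 <= x by rewrite invr_ge0.
have x1 : x <= 1 by rewrite invf_le1// ler1n.
have -> : lratio g j.+1 = ((1 - (1 - g) * x) * (1 + x) `^ (1 - g)) * lratio g j.
  rewrite /lratio dcoefS'.
  have -> : j.+2%:R = (1 + x) * j.+1%:R :> R.
    by rewrite mulrDl mul1r mulVf ?gt_eqF// natr1.
  rewrite powRM ?addr_ge0//.
  have -> : (j%:R - - g) / j.+1%:R = 1 - (1 - g) * x :> R.
    by rewrite /x -natr1; field; rewrite natr1 gt_eqF.
  ring.
have /andP[h1 h2] := @powR_ratio_bounds _ (1 - g) x ltac:(lra) ltac:(lra) x0 x1.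
by rewrite ler_wpM2r//= ler_piMl.
Qed.

Lemma lratio_bounds g j : 0 < g -> g < 1 -> 0 <= lratio g j <= 1.
Proof.
move=> g0 g1; elim: j => [|j /andP[h0 h1]].
  by rewrite /lratio dcoef0 powR1 mulr1 ler01 lexx.
have /andP[_ h2] := lratio_step g0 g1 h0.
rewrite (le_trans h2 h1) andbT /lratio mulr_ge0 ?powR_ge0// dcoefS' mulr_ge0//.
  by rewrite divr_ge0// opprK addr_ge0// ltW.
by move: h0; rewrite /lratio pmulr_lge0// powR_gt0.
Qed.

(** With [n] the index plus 1, each step loses at most [2 / n^2 <= 4 / n - 4 / (n + 1)], and the
    latter telescopes. *)
Lemma lratio_diff g (l k : nat) : 0 < g -> g < 1 -> (l <= k)%N ->
  `|lratio g k - lratio g l| <= 4 / l.+1%:R.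
Proof.
move=> g0 g1 /subnKC <-; move: (k - l)%N => {k} d.
have H : 0 <= lratio g l - lratio g (l + d) <= 4 / l.+1%:R - 4 / (l + d).+1%:R.
  elim: d => [|d /andP[i1 i2]]; first by rewrite addn0 !subrr lexx.
  have /andP[b0 b1] := lratio_bounds (l + d) g0 g1.
  have /andP[s1 s2] := lratio_step g0 g1 b0.
  rewrite addnS; apply/andP; split; first by lra.
  pose n : R := (l + d).+1%:R; have n1 : 1 <= n by rewrite ler1n.
  have n0 : 0 < n by rewrite (lt_le_trans ltr01).
  have -> : (l + d).+2%:R = n + 1 :> R by rewrite natr1.
  have t : 2 * n^-1 ^+ 2 <= 4 / n - 4 / (n + 1).
    have -> : 4 / n - 4 / (n + 1) = 4 / (n * (n + 1)).
      by field; rewrite !gt_eqF// addr_gt0.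
    rewrite -subr_ge0 exprVn.
    have -> : 4 / (n * (n + 1)) - 2 * (n ^+ 2)^-1 = 2 * (n - 1) / (n ^+ 2 * (n + 1)).
      by field; rewrite !gt_eqF// addr_gt0.
    by rewrite divr_ge0 ?mulr_ge0 ?subr_ge0 ?addr_ge0 ?sqr_ge0// ltW.
  have t' : 2 * n^-1 ^+ 2 * lratio g (l + d) <= 2 * n^-1 ^+ 2.
    by rewrite ler_piMr// mulr_ge0 ?sqr_ge0.
  have s1' : lratio g (l + d) - 2 * n^-1 ^+ 2 * lratio g (l + d) <= lratio g (l + d).+1.
    by rewrite mulrBl mul1r in s1.
  move: i2 t t' s1'; rewrite -/n.
  set A := 2 * n^-1 ^+ 2; set A' := A * _; set X := 4 / n; set Y := 4 / (n + 1).
  by set Z := 4 / _; move: A A' X Y Z => A A' X Y Z; lra.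
case/andP: H => h1 h2; rewrite distrC ger0_norm// (le_trans h2)// gerBl.
by rewrite divr_ge0.
Qed.


(** The coefficients of [u(z^m)]. *)
Definition stretch (T : nmodType) m (u : nat -> T) (n : nat) : T :=
  if (m %| n)%N then u (n %/ m)%N else 0.

Lemma sum_stretch (T : pzSemiRingType) m (u F : nat -> T) N : (0 < m)%N ->
  \sum_(i < N) stretch m u i * F i = \sum_(l < (N + m.-1) %/ m) u l * F (l * m)%N.
Proof.
move=> m0; elim: N => [|N ih].
  by rewrite add0n divn_small ?prednK// !big_ord0.
rewrite big_ord_recr/= ih /stretch; case: ifP => [/dvdnP[q ->]|mN].
  have -> : (((q * m).+1 + m.-1) %/ m = q.+1)%N.
    by rewrite addSn -addnS prednK// divnMDl// divnn m0 addn1.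
  have -> : ((q * m + m.-1) %/ m = q)%N.
    by rewrite divnMDl// divn_small ?prednK// addn0.
  by rewrite mulnK// big_ord_recr.
have -> : ((N.+1 + m.-1) %/ m = (N + m.-1) %/ m)%N; last by rewrite mul0r addr0.
rewrite addSn -addnS prednK// divnDr// divnn m0.
rewrite [in RHS](divn_eq N m) -addnA divnMDl//; congr addn.
have r0 : (0 < N %% m)%N by rewrite lt0n; move: mN; rewrite /dvdn => ->.
have rm : (N %% m < m)%N by rewrite ltn_mod.
have -> : (N %% m + m.-1 = 1 * m + (N %% m).-1)%N by lia.
by rewrite divnMDl// divn_small//; lia.
Qed.

(* Coefficients of [((1 - z^m) / (1 - z))^g]. *)
Definition refk g m : nat -> R := conv (stretch m (dcoef g)) (dcoef (- g)).

Lemma refk_block g m q r : (r < m)%N ->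
  refk g m (r + q * m) = conv (dcoef g) (fun l => dcoef (- g) (r + l * m)%N) q.
Proof.
move=> rm; have m0 : (0 < m)%N by case: m rm.
rewrite /refk /conv (sum_stretch _ (fun i => dcoef (- g) (r + q * m - i)%N))//.
have -> : (((r + q * m).+1 + m.-1) %/ m = q.+1)%N.
  have -> : ((r + q * m).+1 + m.-1 = q.+1 * m + r)%N.
    by rewrite addSn -addnS prednK// mulSn; move: (q * m)%N => t; lia.
  by rewrite divnMDl// divn_small ?addn0.
apply: eq_bigr => l _; congr (_ * dcoef _ _).
have lq : (l <= q)%N by rewrite -ltnS.
by rewrite mulnBl addnBA// leq_mul2r lq orbT.
Qed.

(** On the class of [r] modulo [m], [dcoef (- g) (r + l m)] is close to [m^(g - 1) dcoef (- g) l].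
    Convolution with [dcoef g] turns this main part into a multiple of the unit at [q = 0], so that
    only a summable remainder is left. *)
Lemma refk_blockE g m q r : (r < m)%N -> 0 < g ->
  refk g m (r + q * m) = conv (dcoef g)
     (fun l => dcoef (- g) (r + l * m)%N - m%:R `^ (g - 1) * dcoef (- g) l) q
   + m%:R `^ (g - 1) * (q == 0%N)%:R.
Proof.
move=> rm g0; rewrite refk_block// -dcoef_a0 -(subrr g) dcoefD mulr_sumr -big_split/=.
by apply: eq_bigr => l _; ring.
Qed.

(** For [l >= 1] the difference has two sources: the variation of [lratio], which adds a factor
    [4 / (l + 1)] and makes the power summable, and the variation of the power, squeezed between
    consecutive terms of a telescoping sum. The index [l = 0] gives the term in [r]. *)
Lemma refk_tail g : 0 < g -> g < 1 -> exists2 C, 0 < C & forall m r, (r < m)%N ->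
  bsum (fun l => `|dcoef (- g) (r + l * m)%N - m%:R `^ (g - 1) * dcoef (- g) l|)
    (r.+1%:R `^ (g - 1) + C * m%:R `^ (g - 1)).
Proof.
move=> g0 g1; have s1 : 1 < 1 + (1 - g) by lra.
have [B hB] := psum_gt1 s1; have B0 := bsum_ge0 hB.
exists (4 * B + 2) => [|m r rm]; first by lra.
have m0 : (0 < m)%N by case: m rm.
have m0' : 0 < m%:R :> R by rewrite ltr0n.
pose w (x : R) := x `^ (g - 1).
have w_ge0 x : 0 <= w x by exact: powR_ge0.
have w_anti x y : 0 < x -> x <= y -> w y <= w x.
  move=> x0 xy; rewrite /w -opprB !powRN lef_pV2 ?posrE ?powR_gt0//.
    by rewrite ler_powR2// ?(ltW x0)//; lra.
  exact: lt_le_trans xy.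
have wM x y : 0 < x -> 0 < y -> w (x * y) = w x * w y.
  by move=> x0 y0; rewrite /w powRM ?(ltW x0) ?(ltW y0).
have term i : `|dcoef (- g) (r + i.+1 * m)%N - w m%:R * dcoef (- g) i.+1| <=
   w m%:R * (4 * i.+1%:R `^ (- (1 + (1 - g))) + (w i.+1%:R - w i.+2%:R)).
  rewrite (lratioE _ g0) (lratioE i.+1 g0) -!/(w _).
  pose k := (r + i.+1 * m)%N.
  have kle : (i.+1 <= k)%N.
    by rewrite (leq_trans _ (leq_addl _ _))// leq_pmulr.
  have d := lratio_diff g0 g1 kle.
  have /andP[l0 l1] := lratio_bounds i.+1 g0 g1.
  have i0 : 0 < i.+1%:R :> R by [].
  have im0 : 0 < m%:R * i.+1%:R :> R by rewrite mulr_gt0.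
  have w1 : w k.+1%:R <= w m%:R * w i.+1%:R.
    by rewrite -wM// w_anti// -natrM ler_nat mulnC /k leqW// leq_addl.
  have w2 : w m%:R * w i.+2%:R <= w k.+1%:R.
    by rewrite -wM// w_anti// -natrM ler_nat /k mulnS [(m * i.+1)%N]mulnC -addSn leq_add2r.
  have -> : lratio g (r + i.+1 * m)%N * w (r + i.+1 * m).+1%:R - w m%:R * (lratio g i.+1 * w i.+2%:R) =
     (lratio g k - lratio g i.+1) * w k.+1%:R + lratio g i.+1 * (w k.+1%:R - w m%:R * w i.+2%:R).
    by rewrite /k; ring.
  rewrite (le_trans (ler_normD _ _))// [leRHS]mulrDr; apply: lerD.
    rewrite normrM (ger0_norm (w_ge0 _)).
    apply: (le_trans (ler_pM _ _ d w1)) => //.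
    rewrite mulrCA ler_wpM2l// opprD powRD ?powR_inv1//; last first.
      by apply/implyP => _; rewrite gt_eqF.
    have -> : i.+1%:R `^ (- (1 - g)) = w i.+1%:R by rewrite /w opprB.
    by rewrite mulrA ler_wpM2r// ler_wpM2l// lef_pV2 ?posrE// ler_nat.
  rewrite normrM (ger0_norm l0) (@ger0_norm _ (_ - _)) ?subr_ge0//.
  rewrite (le_trans (ler_piMl _ l1)) ?subr_ge0// mulrBr lerB//.
have main n : \sum_(i < n) `|dcoef (- g) (r + i.+1 * m)%N - w m%:R * dcoef (- g) i.+1| <=
   (4 * B + 1) * w m%:R.
  apply: (le_trans (ler_sum _ (fun (i : 'I_n) _ => term i))).
  rewrite -mulr_sumr mulrC ler_wpM2r// big_split/= -mulr_sumr lerD//.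
    by rewrite ler_wpM2l// hB.
  have -> : \sum_(i < n) (w i.+1%:R - w i.+2%:R) = w 1%:R - w n.+1%:R.
    elim: n => [|n ih]; first by rewrite big_ord0 subrr.
    by rewrite big_ord_recr/= ih; ring.
  have -> : w 1%:R = 1 by rewrite /w powR1.
  by rewrite gerBl.
case=> [|n].
  by rewrite big_ord0 addr_ge0 ?w_ge0// mulr_ge0 ?w_ge0//; lra.
rewrite big_ord_recl/=; have := main n; rewrite /bump /=.
have b0 : `|dcoef (- g) (r + 0 * m)%N - w m%:R * dcoef (- g) 0%N| <= w r.+1%:R + w m%:R.
  rewrite mul0n addn0 dcoef0 mulr1 (le_trans (ler_normB _ _))//.
  rewrite (ger0_norm (w_ge0 _)) lerD2r (lratioE _ g0) -/(w _).
  have /andP[l0 l1] := lratio_bounds r g0 g1.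
  by rewrite normrM (ger0_norm l0) (ger0_norm (w_ge0 _)) ler_piMl.
move: b0; rewrite -!/(w _); under [in X in _ -> _ -> X]eq_bigr do rewrite add1n.
lra.
Qed.

(** Each class costs [r^(g - 1)] and a multiple of [m^(g - 1)], the 2 being a bound for the absolute
    sum of [dcoef g]; summed over the [m] classes both are of order [m^g]. *)
Lemma bsum_refk g : 0 < g -> g < 1 -> exists2 C, 0 < C & forall m, (0 < m)%N ->
  bsum (fun n => `|refk g m n|) (C * m%:R `^ g).
Proof.
move=> g0 g1; have [C C0 hC] := refk_tail g0 g1.
have [D D0 hD] := @psum_lt1 R (1 - g) ltac:(lra) ltac:(lra).
exists (2 * (D + C) + 1) => [|m m0 N]; first by lra.
have m0' : 0 < m%:R :> R by rewrite ltr0n.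
pose w (x : R) := x `^ (g - 1).
have w_ge0 x : 0 <= w x by exact: powR_ge0.
have block r : (r < m)%N ->
    \sum_(q < N) `|refk g m (r + q * m)| <= 2 * (w r.+1%:R + C * w m%:R) + w m%:R.
  move=> rm; pose e l := dcoef (- g) (r + l * m)%N - m%:R `^ (g - 1) * dcoef (- g) l.
  have he := hC m r rm.
  have hc := bsum_conv (fun k => normr_ge0 (dcoef g k)) (fun k => normr_ge0 (e k))
    (bsum_dcoef1 g0 (ltW g1)) he.
  apply: (@le_trans _ _ (\sum_(q < N) (conv (fun k => `|dcoef g k|) (fun k => `|e k|) q
     + w m%:R * (q == 0 :> nat)%:R))).
    apply: ler_sum => q _; rewrite refk_blockE// (le_trans (ler_normD _ _))//.
    apply: lerD; last by rewrite normrM !ger0_norm ?ler0n ?w_ge0.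
    rewrite (le_trans (ler_norm_sum _ _ _))//.
    by apply: ler_sum => l _; rewrite normrM.
  rewrite big_split/=; apply: lerD; first exact: hc.
  rewrite -mulr_sumr ler_piMr//; case: (N) => [|k]; first by rewrite big_ord0.
  by rewrite big_ord_recl/= big1 ?addr0.
apply: (@le_trans _ _ (\sum_(n < N * m) `|refk g m n|)).
  rewrite -(subnKC (leq_pmulr N m0)) big_split_ord/= lerDl.
  exact: sumr_ge0.
rewrite (sum_mul_blocks (fun n => `|refk g m n|) N m).
apply: (le_trans (ler_sum _ (fun (r : 'I_m) _ => block r (ltn_ord r)))).
rewrite big_split/= -mulr_sumr big_split/= !sumr_const !card_ord.
have hw : w m%:R *+ m = m%:R `^ g.
  rewrite -mulr_natr -{2}[m%:R]powRr1 ?ler0n// -powRD ?subrK//.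
  by apply/implyP => _; rewrite gt_eqF.
have -> : C * w m%:R *+ m = C * m%:R `^ g by rewrite -hw mulrnAr.
rewrite hw.
have : \sum_(i < m) w i.+1%:R <= D * m%:R `^ g.
  have e1 : - (1 - g) = g - 1 by ring.
  have e2 : 1 - (1 - g) = g by ring.
  by have := hD m; rewrite e2 e1.
lra.
Qed.

Lemma conv_refk g m n : 0 < g -> conv (refk g m) (dcoef g) n = stretch m (dcoef g) n.
Proof.
move=> g0; rewrite /refk -convA convC.
rewrite -[RHS](@conv_delta _ _ n) ; apply: eq_bigr => i _; congr (_ * _).
by rewrite -dcoefD addNr dcoef_a0.
Qed.

Lemma has_csum_stretch g m z : 0 < g -> (0 < m)%N -> normc z <= 1 ->
  has_csum (fun n => (stretch m (dcoef g) n)%:C * z ^+ n) (bser g (z ^+ m)).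
Proof.
move=> g0 m0 z1 e e0.
have zm1 : normc (z ^+ m) <= 1 by rewrite normcX exprn_ile1// normc_ge0.
have [n0 hn] := bserP g0 zm1 e0; exists (n0 * m)%N => n nn.
have -> : \sum_(i < n) (stretch m (dcoef g) i)%:C * z ^+ i =
    \sum_(i < n) stretch m (fun k => (dcoef g k)%:C) i * z ^+ i.
  by apply: eq_bigr => i _; rewrite /stretch; case: ifP.
rewrite sum_stretch//.
have -> : \sum_(l < (n + m.-1) %/ m) (dcoef g l)%:C * z ^+ (l * m) =
   \sum_(l < (n + m.-1) %/ m) bterm g (z ^+ m) l.
  by apply: eq_bigr => l _; rewrite /bterm mulnC exprM.
apply: hn; rewrite leq_divRL//; apply: leq_trans nn _; exact: leq_addr.
Qed.

Lemma conv_expr (u v : nat -> R[i]) z n :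
  conv (fun i => u i * z ^+ i) (fun i => v i * z ^+ i) n = conv u v n * z ^+ n.
Proof.
rewrite /conv mulr_suml; apply: eq_bigr => i _.
have -> : z ^+ n = z ^+ i * z ^+ (n - i) by rewrite -exprD subnKC// -ltnS.
ring.
Qed.

(** [u] is a power series for the quotient of [(1 - z^m)^a] by [(1 - z)^a] on the closed disc. It is
    stated as a product because the denominator vanishes at [z = 1]. *)
Definition diff_multiplier a m (u : nat -> R[i]) := forall z, normc z <= 1 ->
  exists2 S, has_csum (fun j => u j * z ^+ j) S & bser a (z ^+ m) = S * bser a z.

Lemma diff_multiplier_frac g : 0 < g -> g < 1 -> exists2 C, 0 < C &
  forall m, (0 < m)%N -> exists2 u, bsum (fun n => normc (u n)) (C * m%:R `^ g) &
    diff_multiplier g m u.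
Proof.
move=> g0 g1; have [C C0 hC] := bsum_refk g0 g1.
exists C => // m m0; exists (fun n => (refk g m n)%:C) => [|z z1].
  by move=> n; under eq_bigr do rewrite normc_real; exact: hC.
have bC : bsum (fun n => normc ((refk g m n)%:C * z ^+ n)) (C * m%:R `^ g).
  move=> n; rewrite (le_trans _ (hC m m0 n))//; apply: ler_sum => i _.
  by rewrite normcM normc_real normcX ler_piMr// exprn_ile1// normc_ge0.
have [S hS] := csum_exists bC; exists S => //.
have [B hB] := bsum_dcoef g0.
apply: has_csum_unique (has_csum_stretch g0 m0 z1) _.
apply: has_csum_ext (has_csum_conv hS (bserP g0 z1) bC (bsum_bterm z1 hB)) => n.
rewrite -conv_refk// (conv_expr (fun n => (refk g m n)%:C)) /conv realc_sum.
by congr (_ * _); apply: eq_bigr => i _; rewrite realcM.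
Qed.

Lemma diff_multiplier1 m : exists2 u, bsum (fun n => normc (u n)) (m%:R `^ 1) &
  diff_multiplier 1 m u.
Proof.
exists (fun j => (if (j < m)%N then 1 else 0)) => [n|z z1].
  rewrite powRr1//; apply: (@le_trans _ _ (\sum_(i < n + m) (if (i < m)%N then 1 else 0))).
    rewrite big_split_ord/= ler_wpDr//; last first.
      by apply: ler_sum => i _; case: ifP; rewrite ?normc1 ?normc0.
    by apply: sumr_ge0 => i _; case: ifP.
  rewrite -(big_mkord xpredT (fun i => if (i < m)%N then 1 else 0)) addnC.
  rewrite (@big_cat_nat _ _ _ m)//= ?leq_addr// [X in _ + X]big1_seq ?addr0.
    rewrite (eq_big_nat _ _ (F2 := fun=> 1)) => [|i /andP[_ ->]//].
    by rewrite sumr_const_nat subn0.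
  by move=> i /=; rewrite mem_index_iota => /andP[mi _]; rewrite ltnNge mi.
exists (\sum_(j < m) z ^+ j).
  have := @has_csum_fin R (fun j => (if (j < m)%N then 1 else 0) * z ^+ j) m.
  under eq_bigr => i _ do rewrite ltn_ord mul1r.
  by apply => k mk; rewrite ltnNge mk mul0r.
by rewrite !bser1 ?normcX ?exprn_ile1 ?normc_ge0// -opprB subrX1; ring.
Qed.

(** Factors of order 1, whose multiplier is the geometric sum, are split off until the order is at
    most 1; orders below 1 use the kernel [refk]. *)
Lemma diff_multiplierP a : 0 < a -> exists2 C, 0 < C &
  forall m, (0 < m)%N -> exists2 u, bsum (fun n => normc (u n)) (C * m%:R `^ a) &
    diff_multiplier a m u.
Proof.
move=> a0; have [n] : exists n, a <= n%:R.
  by exists (Num.bound a) => //; rewrite ltW// Num.Theory.archi_boundP// ltW.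
elim: n a a0 => [|n ih] a a0 an; first by move: an; rewrite leNgt a0.
have [a1|] := ltP a 1; first exact: diff_multiplier_frac.
rewrite le_eqVlt => /predU1P[<-|a1].
  by exists 1 => // m m0; rewrite mul1r; exact: diff_multiplier1.
have a10 : 0 < a - 1 by rewrite subr_gt0.
have [|C C0 hC] := ih (a - 1) a10; first by rewrite lerBlDr natr1.
exists C => // m m0.
have [u hu mu] := hC m m0; have [v hv mv] := @diff_multiplier1 m.
exists (conv u v) => [|z z1].
  have := bsum_normc_conv hu hv; rewrite -mulrA -powRD ?subrK//.
  by apply/implyP => _; rewrite pnatr_eq0 -lt0n.
have bz (x : nat -> R[i]) B : bsum (fun n => normc (x n)) B ->
    bsum (fun n => normc (x n * z ^+ n)) B.
  move=> hx k; rewrite (le_trans _ (hx k))//; apply: ler_sum => i _.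
  by rewrite normcM normcX ler_piMr ?normc_ge0// exprn_ile1// normc_ge0.
have [S hS eS] := mu z z1; have [T hT eT] := mv z z1; exists (S * T).
  apply: has_csum_ext (has_csum_conv hS hT (bz _ _ hu) (bz _ _ hv)) => k.
  exact: conv_expr.
have zm1 : normc (z ^+ m) <= 1 by rewrite normcX exprn_ile1// normc_ge0.
have E x : normc x <= 1 -> bser a x = bser (a - 1) x * bser 1 x.
  by move=> x1; rewrite -bserD// subrK.
by rewrite (E _ zm1) (E _ z1) eS eT mulrACA.
Qed.

End refined_difference_kernel.

(** * Differences against derivatives in L_1 *)

Section fractional_differences_in_L1.
Variable R : realType.
Implicit Types (c : int -> R[i]) (a h : R) (N M m : nat).
Local Opaque tp bser.

Lemma Ip1_dfc_multiple a : 0 < a -> exists2 C, 0 < C & forall m N c h, (0 < m)%N ->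
  (Ip 1 (tp N (dfc a (m%:R * h) c)) <= (C * m%:R `^ a)%:E * Ip 1 (tp N (dfc a h c)))%E.
Proof.
move=> a0; have [C C0 hC] := diff_multiplierP a0; exists C => // m N c h m0.
have [u hu mu] := hC m m0.
have ex (k : int) : exists S, has_csum (fun j => u j * expi (- (k%:~R * h)) ^+ j) S /\
    bser a (expi (- (k%:~R * (m%:R * h)))) = S * bser a (expi (- (k%:~R * h))).
  have [S h1 h2] := mu _ (normc_expi_le1 (- (k%:~R * h))); exists S; split; first exact: h1.
  by rewrite -h2 -expiMn; congr (bser a (expi _)); ring.
have [S hS] := boolp.choice ex.
have mT := pmeas_tp N (dfc a h c).
apply: (Ip_translates (c := u) (t := fun j => - (j%:R * h)) ltr01 (lexx _) mT); last first.
  by move=> n; under eq_bigr => i _ do rewrite powRr1 ?normc_ge0//; exact: hu.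
move=> x b; apply: has_csum_powR_le => //.
have := tp_csum (n := N) (dfc a h c) x (fun k _ => (hS k).1).
have -> : tp N (fun k => S k * dfc a h c k) = tp N (dfc a (m%:R * h) c).
  by apply: eq_tp => k _; rewrite /dfc (hS k).2 mulrA.
apply: has_csum_ext => j; rewrite tp_shift -tpZ; apply: eq_tpx => k _.
rewrite -expiMn mulrA; congr (_ * expi _ * _); ring.
Qed.

Lemma Ip1_tp_le N c :
  (Ip 1 (tp N c) <= (2 * pi * \sum_(j < N.*2.+1) normc (c (j%:Z - N%:Z)))%:E)%E.
Proof.
pose B := \sum_(j < N.*2.+1) normc (c (j%:Z - N%:Z)).
apply: (@le_trans _ _ (\int[@lebesgue_measure R]_(x in torus R) B%:E)%E).
  apply: ge0_le_integral_nomeas => x _; rewrite lee_fin ?powR_ge0// powRr1 ?normc_ge0//.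
  rewrite (le_trans (normc_sum _ _ _))//; apply: ler_sum => j _.
  by rewrite normcM normc_expi mulr1.
rewrite integral_cst; last exact: measurable_torus.
by rewrite [X in (_ * X)%E]mu_torus -EFinM mulrC.
Qed.

Lemma Ip1_tp_cvg N (U : nat -> int -> R[i]) V :
  (forall k, normc (U m k - V k) @[m --> \oo] --> (0 : R)) ->
  forall e : R, 0 < e ->
    \forall m \near \oo, (Ip 1 (tp N (fun k => (U m k - V k)%R)) <= e%:E)%E.
Proof.
move=> hU e e0.
have cv : 2 * pi * \sum_(j < N.*2.+1) normc (U m (j%:Z - N%:Z) - V (j%:Z - N%:Z)) @[m --> \oo]
    --> (0 : R).
  rewrite [X in _ --> X](_ : 0 = 2 * pi * \sum_(j < N.*2.+1) 0 :> R); last first.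
    by rewrite big1_eq mulr0.
  apply: cvgM; first exact: cvg_cst.
  by apply: cvg_big => [|i _]; [exact: add_continuous|exact: hU].
have /cvgr_le/(_ _ e0) := cv; apply: filterS => m hm.
by rewrite (le_trans (Ip1_tp_le _ _))// lee_fin.
Qed.

Lemma deriv_symbolM a h x : 0 < a -> 0 < h ->
  deriv_symbol a (x * h) = (h `^ a)%:C * deriv_symbol a x.
Proof.
move=> a0 h0; rewrite /deriv_symbol mulf_eq0 (gt_eqF h0) orbF.
case: eqP => [_|_]; first by rewrite mulr0.
by rewrite normrM (gtr0_norm h0) powRM ?(ltW h0)// sgrM (gtr0_sg h0) mulr1 realcM; ring.
Qed.

Lemma bser_deriv_step a h x : 0 < a -> 0 < h ->
  normc (((m.+1%:R / h) `^ a)%:C * bser a (expi (- (x * (h / m.+1%:R)))) - deriv_symbol a x)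
    @[m --> \oo] --> (0 : R).
Proof.
move=> a0 h0; have ha : 0 < h `^ a by rewrite powR_gt0.
have E m : normc (((m.+1%:R / h) `^ a)%:C * bser a (expi (- (x * (h / m.+1%:R)))) - deriv_symbol a x)
  = (h `^ a)^-1 * normc ((m.+1%:R `^ a)%:C * bser a (expi (- (x * h / m.+1%:R))) - deriv_symbol a (x * h)).
  rewrite -[(h `^ a)^-1]ger0_norm ?invr_ge0 ?(ltW ha)// -normc_real -normcM mulrBr.
  rewrite deriv_symbolM// !mulrA -!realcM mulVf ?gt_eqF// mul1r.
  congr (normc (_%:C * _ - _)).
  rewrite powRM ?invr_ge0 ?(ltW h0)// mulrC; congr (_ * _).
  by rewrite -[h^-1]powR_inv1 ?(ltW h0)// -powRrM mulN1r powRN.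
rewrite (funext E).
rewrite [X in _ --> X](_ : 0 = (h `^ a)^-1 * 0 :> R); last by rewrite mulr0.
by apply: cvgM; [exact: cvg_cst|exact: bser_deriv].
Qed.

Lemma dfc_deriv_cvg a h N c : 0 < a -> 0 < h -> forall e : R, 0 < e ->
  \forall m \near \oo, (Ip 1 (fun x =>
    (((m.+1%:R / h) `^ a)%:C * tp N (dfc a (h / m.+1%:R) c) x
       - tp N (fun k => deriv_symbol a k%:~R * c k) x)%R) <= e%:E)%E.
Proof.
move=> a0 h0 e e0.
pose U (m : nat) (k : int) :=
  ((m.+1%:R / h) `^ a)%:C * bser a (expi (- (k%:~R * (h / m.+1%:R)))) * c k.
have hU k : normc (U m k - deriv_symbol a k%:~R * c k) @[m --> \oo] --> (0 : R).
  rewrite (_ : (fun m => _) = (fun m : nat => normc (((m.+1%:R / h) `^ a)%:C *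
    bser a (expi (- (k%:~R * (h / m.+1%:R)))) - deriv_symbol a k%:~R) * normc (c k))); last first.
    by apply/funext => m; rewrite /U -mulrBl normcM.
  rewrite [X in _ --> X](_ : 0 = 0 * normc (c k)); last by rewrite mul0r.
  by apply: cvgM; [exact: bser_deriv_step|exact: cvg_cst].
have := Ip1_tp_cvg N hU e0; apply: filterS => m; apply: le_trans.
rewrite le_eqVlt; apply/orP; left; apply/eqP; congr (Ip 1 _); apply/funext => x.
rewrite tpD tpN; congr (_ - _); rewrite -tpZ; apply: eq_tpx => k _.
by rewrite /U /dfc mulrA.
Qed.

(** The step [h] is [m + 1] times [h / (m + 1)]. The multiplier bound passes to the finer step with
    a loss [(m + 1)^a], exactly the scaling under which fine differences tend to the derivative. *)
Lemma Ip1_dfc_le_deriv a : 0 < a -> exists2 C, 0 < C & forall N c h, 0 < h ->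
  (Ip 1 (tp N (dfc a h c)) <=
     (C * h `^ a)%:E * Ip 1 (tp N (fun k => deriv_symbol a k%:~R * c k)%R))%E.
Proof.
move=> a0; have [C C0 hC] := Ip1_dfc_multiple a0; exists C => // N c h h0.
have ha : 0 < h `^ a by rewrite powR_gt0.
have Ch0 : 0 < C * h `^ a by rewrite mulr_gt0.
pose V := tp N (fun k => deriv_symbol a k%:~R * c k); rewrite -/V.
have mV : pmeas V by exact: pmeas_tp.
apply/lee_addgt0Pr => e e0.
have [m _ /(_ m (leqnn m))hm] := dfc_deriv_cvg N c a0 h0 (divr_gt0 e0 Ch0).
pose T := tp N (dfc a (h / m.+1%:R) c).
have mT : pmeas T by exact: pmeas_tp.
have m0 : 0 < m.+1%:R :> R by [].
have := hC m.+1 N c (h / m.+1%:R) isT.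
have -> : m.+1%:R * (h / m.+1%:R) = h by rewrite mulrCA divff ?mulr1// gt_eqF.
move/le_trans; apply; rewrite -/T.
have -> : C * m.+1%:R `^ a = C * h `^ a * (m.+1%:R / h) `^ a.
  by rewrite -mulrA -powRM ?divr_ge0 ?(ltW h0)// [h * _]mulrC divfK ?gt_eqF.
rewrite EFinM -muleA.
have -> : (((m.+1%:R / h) `^ a)%:E * Ip 1 T)%E =
    Ip 1 (fun x => ((m.+1%:R / h) `^ a)%:C * T x)%R.
  by rewrite IpZ// powRr1 ?normc_ge0// normc_real ger0_norm ?powR_ge0.
have -> : (e%:E = (C * h `^ a)%:E * (e / (C * h `^ a))%:E)%E.
  by rewrite -EFinM mulrCA divff ?mulr1// gt_eqF.
rewrite -muleDr ?ge0_adde_def ?inE ?Ip_ge0 ?lee_fin ?divr_ge0 ?(ltW e0) ?(ltW Ch0)//.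
rewrite lee_wpmul2l ?lee_fin ?(ltW Ch0)//.
have mW : pmeas (fun x => ((m.+1%:R / h) `^ a)%:C * T x) by exact: pmeasZ.
have -> : (fun x => ((m.+1%:R / h) `^ a)%:C * T x) =
    (fun x => V x + (((m.+1%:R / h) `^ a)%:C * T x - V x)).
  by apply/funext => x; rewrite addrC subrK.
apply: (le_trans (IpD ltr01 (lexx _) mV (pmeasB mW mV))).
by rewrite leeD2l.
Qed.

End fractional_differences_in_L1.

(** * Fejer means *)

Section torus_integrals.
Variable R : realType.
Notation mu := (@lebesgue_measure R).
Implicit Types (f g : R -> R[i]) (c : R[i]).

Definition cint f := mu.-integrable (torus R) (fun x => (complex.Re (f x))%:E) /\
  mu.-integrable (torus R) (fun x => (complex.Im (f x))%:E).

Lemma Ip1E f : Ip 1 f = (\int[mu]_(x in torus R) (normc (f x))%:E)%E.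
Proof. by apply: eq_integral => x _; rewrite powRr1 ?normc_ge0. Qed.

Lemma pmeas_cint f : pmeas f -> (Ip 1 f < +oo)%E -> cint f.
Proof.
move=> [f1 f2 _] foo; split; apply/integrableP; split.
- by apply/measurable_EFinP; exact: measurable_funTS.
- apply: le_lt_trans foo; apply: ge0_le_integral_nomeas => x _; first exact: abse_ge0.
  by rewrite lee_fin powRr1 ?normc_ge0 ?normc_ge_Re.
- by apply/measurable_EFinP; exact: measurable_funTS.
- apply: le_lt_trans foo; apply: ge0_le_integral_nomeas => x _; first exact: abse_ge0.
  by rewrite lee_fin powRr1 ?normc_ge0 ?normc_ge_Im.
Qed.

Lemma cintD f g : cint f -> cint g -> cint (fun x => f x + g x).
Proof.
move=> [f1 f2] [g1 g2]; have mT := @measurable_torus R; split.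
- by under eq_fun do rewrite ReD EFinD; exact: integrableD.
- by under eq_fun do rewrite ImD EFinD; exact: integrableD.
Qed.

Lemma cintZ c f : cint f -> cint (fun x => c * f x).
Proof.
move=> [f1 f2]; have mT := @measurable_torus R; split.
- by under eq_fun do rewrite ReM EFinB !EFinM; apply: integrableB => //; exact: integrableZl.
- by under eq_fun do rewrite ImM EFinD !EFinM; apply: integrableD => //; exact: integrableZl.
Qed.

Lemma torus_integralD f g : cint f -> cint g ->
  torus_integral (fun x => f x + g x) = torus_integral f + torus_integral g.
Proof.
move=> [f1 f2] [g1 g2]; have mT := @measurable_torus R; apply: complex_eqP => /=.
- by rewrite -RintegralD//; apply: eq_Rintegral => x _; rewrite ReD.
- by rewrite -RintegralD//; apply: eq_Rintegral => x _; rewrite ImD.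
Qed.

Lemma torus_integralZ c f : cint f ->
  torus_integral (fun x => c * f x) = c * torus_integral f.
Proof.
move=> [f1 f2]; have mT := @measurable_torus R.
have i1 (r : R) : mu.-integrable (torus R) (fun x => (r * complex.Re (f x))%:E).
  by under eq_fun do rewrite EFinM; exact: integrableZl.
have i2 (r : R) : mu.-integrable (torus R) (fun x => (r * complex.Im (f x))%:E).
  by under eq_fun do rewrite EFinM; exact: integrableZl.
have z1 (r : R) : \int[mu]_(x in torus R) (r * complex.Re (f x)) =
    r * \int[mu]_(x in torus R) complex.Re (f x) by exact: RintegralZl.
have z2 (r : R) : \int[mu]_(x in torus R) (r * complex.Im (f x)) =
    r * \int[mu]_(x in torus R) complex.Im (f x) by exact: RintegralZl.
apply: complex_eqP; rewrite ?ReM ?ImM /=.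
- transitivity (\int[mu]_(x in torus R)
      (complex.Re c * complex.Re (f x) - complex.Im c * complex.Im (f x))).
    by apply: eq_Rintegral => x _; rewrite ReM.
  by rewrite -z1 -z2; exact: (@RintegralB _ _ _ mu (torus R) (fun x => complex.Re c * complex.Re (f x))
    (fun x => complex.Im c * complex.Im (f x)) mT (i1 _) (i2 _)).
- transitivity (\int[mu]_(x in torus R)
      (complex.Re c * complex.Im (f x) + complex.Im c * complex.Re (f x))).
    by apply: eq_Rintegral => x _; rewrite ImM.
  by rewrite -z1 -z2; exact: (@RintegralD _ _ _ mu (torus R) (fun x => complex.Re c * complex.Im (f x))
    (fun x => complex.Im c * complex.Re (f x)) mT (i2 _) (i1 _)).
Qed.

Lemma torus_integral0 : torus_integral (fun=> 0 : R[i]) = 0.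
Proof.
have h : (\int[mu]_(x in torus R) 0 = 0 :> R) by rewrite Rintegral_cst ?mul0r//; exact: measurable_torus.
by apply: complex_eqP.
Qed.

Lemma cint0 : cint (fun=> 0).
Proof. by split; exact: integrable0. Qed.

Lemma torus_integral_sum (I : Type) (s : seq I) (F : I -> R -> R[i]) :
  (forall i, cint (F i)) ->
  torus_integral (fun x => \sum_(i <- s) F i x) = \sum_(i <- s) torus_integral (F i).
Proof.
move=> hF; suff [] : cint (fun x => \sum_(i <- s) F i x) /\
  torus_integral (fun x => \sum_(i <- s) F i x) = \sum_(i <- s) torus_integral (F i) by [].
elim: s => [|i s [h1 h2]].
  split; first by under eq_fun do rewrite big_nil; exact: cint0.
  by rewrite big_nil -[RHS]torus_integral0; congr torus_integral; apply/funext => x; rewrite big_nil.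
have -> : (fun x => \sum_(i <- i :: s) F i x) = (fun x => F i x + \sum_(i <- s) F i x).
  by apply/funext => x; rewrite big_cons.
by rewrite big_cons -h2 -torus_integralD//; split => //; exact: cintD.
Qed.

Lemma normc_torus_integral f : cint f -> ((normc (torus_integral f))%:E <= 2%:E * Ip 1 f)%E.
Proof.
move=> [f1 f2]; have mT := @measurable_torus R.
have b (r : R -> R) : mu.-integrable (torus R) (fun x => (r x)%:E) ->
    (forall x, `|r x| <= normc (f x)) -> (`|(\int[mu]_(x in torus R) r x)|%:E <= Ip 1 f)%E.
  move=> ri rf; rewrite EFin_normr_Rintegral//.
  apply: (le_trans (le_abse_integral mu mT _)); first by case/integrableP: ri.
  apply: ge0_le_integral_nomeas => x _; first exact: abse_ge0.
  by rewrite lee_fin powRr1 ?normc_ge0.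
apply: (@le_trans _ _ (`|(\int[mu]_(x in torus R) complex.Re (f x))|%:E +
   `|(\int[mu]_(x in torus R) complex.Im (f x))|%:E)%E).
  by rewrite -EFinD lee_fin normc_le_ReIm.
rewrite mule_natl mule2n; apply: leeD; apply: b => // x; [exact: normc_ge_Re|exact: normc_ge_Im].
Qed.

End torus_integrals.

Section fejer_kernel.
Variable R : realType.
Notation mu := (@lebesgue_measure R).
Implicit Types (f g : R -> R[i]) (c : R[i]) (n M : nat) (t u x : R).

Lemma tp_delta n (k0 : int) x : (`|k0| <= n)%N ->
  tp n (fun k => (k == k0)%:R) x = expi (k0%:~R * x) :> R[i].
Proof.
move=> kn; have hj : (`|(k0 + n%:Z)%R| < n.*2.+1)%N by lia.
have ej : (`|(k0 + n%:Z)%R|%N)%:Z - n%:Z = k0 by lia.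
rewrite /tp (bigD1 (Ordinal hj))//= ej eqxx mul1r big1 ?addr0// => j jj.
case: eqP => [e|_]; last by rewrite mul0r.
by case/eqP: jj; apply: val_inj => /=; lia.
Qed.

Definition fejer n t : R := normc (\sum_(l < n.+1) expi (l%:R * t)) ^+ 2 / n.+1%:R.

(** The weight [(1 - |k| / (n + 1))_+], left in the double-sum form in which the squared modulus
    produces it. *)
Definition fejer_coef n (k : int) : R[i] :=
  \sum_(l < n.+1) \sum_(l' < n.+1) (n.+1%:R^-1)%:C * (k == l%:Z - l'%:Z)%:R.

Lemma fejer_ge0 n t : 0 <= fejer n t.
Proof. by rewrite divr_ge0 ?sqr_ge0. Qed.

Lemma normc_sqr_conj c : (normc c ^+ 2)%:C = c * c^*.
Proof.
rewrite normc_sqr; apply: complex_eqP; rewrite ?ReM ?ImM; case: c => a b /=; ring.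
Qed.

Lemma fejer_double_sum n t : (fejer n t)%:C =
  \sum_(l < n.+1) \sum_(l' < n.+1) (n.+1%:R^-1)%:C * expi ((l%:R - l'%:R) * t).
Proof.
rewrite /fejer realcM normc_sqr_conj conjc_sum mulrC big_distrlr/= mulr_sumr.
apply: eq_bigr => l _; rewrite mulr_sumr; apply: eq_bigr => l' _.
by rewrite -/(expi (l'%:R * t)) -[_ -i* _]/((expi (l'%:R * t))^*) expi_conj -expiD mulrBl.
Qed.

Lemma fejerE n t : (fejer n t)%:C = tp n (fejer_coef n) t.
Proof.
rewrite fejer_double_sum /fejer_coef tp_sum; apply: eq_bigr => l _.
rewrite tp_sum; apply: eq_bigr => l' _; rewrite tpZ tp_delta.
  by rewrite intrB.
by move: (ltn_ord l) (ltn_ord l'); lia.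
Qed.

Lemma fejerN n t : fejer n (- t) = fejer n t.
Proof.
rewrite /fejer -[in RHS]normc_conj conjc_sum; congr (normc _ ^+ 2 / _).
by apply: eq_bigr => l _; rewrite expi_conj mulrN.
Qed.

Lemma fejer_grid n M u : (n < M)%N -> \sum_(j < M) fejer n (u + tgrid R M j) = M%:R.
Proof.
move=> nM; have M0 : (0 < M)%N by case: M nM.
suff: (\sum_(j < M) fejer n (u + tgrid R M j))%:C = (M%:R)%:C :> R[i] by case.
rewrite realc_sum; under eq_bigr do rewrite fejer_double_sum.
rewrite exchange_big/=.
have E (l l' : 'I_n.+1) : \sum_(j < M) (n.+1%:R^-1)%:C * expi ((l%:R - l'%:R) * (u + tgrid R M j)) =
    if l == l' then (n.+1%:R^-1)%:C * M%:R else 0 :> R[i].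
  under eq_bigr do rewrite mulrDr expiD mulrA.
  rewrite -mulr_sumr sum_expi_grid//.
  - rewrite -[(l : nat) == l']/(l == l'); case: eqP => [->|_]; last by rewrite mulr0.
    by rewrite subrr mul0r expi0 mulr1.
  - by move: (ltn_ord l); lia.
  - by move: (ltn_ord l'); lia.
under eq_bigr => l _.
  rewrite exchange_big/=; under eq_bigr do rewrite E.
  rewrite (bigD1 l)//= eqxx big1 ?addr0; last by move=> i; rewrite eq_sym => /negbTE ->.
  over.
rewrite /= sumr_const card_ord -[LHS]mulr_natl mulrA -realc_nat -realcM divff ?mul1r ?realc_nat//.
Qed.

Lemma fejer_concentrated n t : fejer n t * normc (1 - expi t) ^+ 2 <= 4 / n.+1%:R.
Proof.
rewrite /fejer mulrAC ler_wpM2r ?invr_ge0// -exprMn -normcM.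
have -> : (\sum_(l < n.+1) expi (l%:R * t)) * (1 - expi t) = 1 - expi t ^+ n.+1 :> R[i].
  under eq_bigr do rewrite expiMn.
  by rewrite -[RHS]opprB subrX1; ring.
have h : normc (1 - expi t ^+ n.+1) <= 2.
  by rewrite (le_trans (normcB _ _))// normc1 normcX normc_expi expr1n.
have -> : 4 = 2 ^+ 2 :> R by rewrite -natrX.
by rewrite lerXn2r ?nnegrE ?normc_ge0.
Qed.

Lemma pmeas_fejer n x : pmeas (fun t => (fejer n (t - x))%:C).
Proof.
under eq_fun do rewrite fejerE.
exact: pmeas_shift (- x) (pmeas_tp n (fejer_coef n)).
Qed.

Lemma measurable_fejer n x : measurable_fun setT (fun t => fejer n (t - x)).
Proof. by have [h _ _] := pmeas_fejer n x. Qed.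

Lemma fejer_periodic n x t : fejer n (t + 2 * pi - x) = fejer n (t - x).
Proof. by have [_ _ h] := pmeas_fejer n x; have [] := h t. Qed.

(** The translates by the grid sum to the constant [M] and all have the same integral. *)
Lemma integral_fejer n x : (\int[mu]_(t in torus R) (fejer n (t - x))%:E = (2 * pi)%:E)%E.
Proof.
have mT := @measurable_torus R; pose M := n.+1; pose F t := (fejer n (t - x))%:E.
have mF : measurable_fun setT F by apply/measurable_EFinP; exact: measurable_fejer.
have F0 t : (0 <= F t)%E by rewrite lee_fin fejer_ge0.
have sF (s : R) : (\int[mu]_(t in torus R) F (t + s)%R = \int[mu]_(t in torus R) F t)%E.
  by apply: torus_integral_shift => // t; rewrite /F fejer_periodic.
have mS (s : R) : measurable_fun (torus R) (fun t => F (t + s)).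
  apply: measurable_funTS; exact: (measurableT_comp mF (measurable_addr s)).
have h : (\sum_(j < M) \int[mu]_(t in torus R) F (t + tgrid R M j)%R = (M%:R * (2 * pi))%:E)%E.
  rewrite -ge0_integral_sum//; last by move=> j; exact: mS.
  rewrite (eq_integral (fun=> (M%:R)%:E)) => [|t _].
    by rewrite integral_cst// [X in (_ * X)%E]mu_torus.
  rewrite sumEFin -(fejer_grid (n := n) (M := M) (t - x))//; congr (_%:E).
  by apply: eq_bigr => j _; rewrite addrAC.
have M0 : M%:R != 0 :> R by rewrite pnatr_eq0.
have sE (s : R) : (\int[mu]_(t in torus R) F (t + s)%R = 1%:E * \int[mu]_(t in torus R) F t)%E.
  by rewrite sF mul1e.
move: h; under eq_bigr do rewrite sE.
rewrite -ge0_sume_distrl// sumEFin sumr_const card_ord /F.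
case: (\int[mu]_(t in torus R) _)%E => [r||].
- by rewrite -EFinM => -[/(mulfI M0) ->].
- by rewrite mulry gtr0_sg ?mul1e// ltr0n.
- by rewrite mulrNy gtr0_sg ?mul1e// ltr0n.
Qed.

Definition cesaro n f x : R[i] := tp n (fun k => fejer_coef n k * fourier_coef f k) x.

Lemma pmeas_cesaro n f : pmeas (cesaro n f).
Proof. exact: pmeas_tp. Qed.

Lemma Ip1_mul_le f g (B : R) : 0 <= B -> pmeas f -> (forall x, normc (g x) <= B) ->
  (Ip 1 (fun x => f x * g x)%R <= B%:E * Ip 1 f)%E.
Proof.
move=> B0 mf gB; have mT := @measurable_torus R.
have -> : (B%:E * Ip 1 f = Ip 1 (fun x => B%:C * f x)%R)%E.
  by rewrite IpZ// powRr1 ?normc_ge0// normc_real ger0_norm.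
apply: Ip_le => x; rewrite !powRr1 ?normc_ge0// !normcM mulrC normc_real ger0_norm//.
by rewrite ler_wpM2r ?normc_ge0.
Qed.

Lemma cint_mul f g (B : R) : 0 <= B -> pmeas f -> pmeas g -> (Ip 1 f < +oo)%E ->
  (forall x, normc (g x) <= B) -> cint (fun x => f x * g x).
Proof.
move=> B0 mf mg foo gB; apply: pmeas_cint; first exact: pmeasM.
apply: le_lt_trans (Ip1_mul_le B0 mf gB) _.
by rewrite lte_mul_pinfty.
Qed.

Lemma fejer_bounded n t : normc (fejer n t)%:C <= n.+1%:R.
Proof.
rewrite normc_real ger0_norm ?fejer_ge0// /fejer ler_pdivrMr// -expr2.
rewrite lerXn2r ?nnegrE ?normc_ge0// (le_trans (normc_sum _ _ _))//.
by under eq_bigr do rewrite normc_expi; rewrite sumr_const card_ord.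
Qed.

Lemma cint_fejer f n x : pmeas f -> (Ip 1 f < +oo)%E ->
  cint (fun t => f t * (fejer n (t - x))%:C).
Proof.
move=> mf foo; apply: (cint_mul (B := n.+1%:R)) => // [|t]; first exact: pmeas_fejer.
exact: fejer_bounded.
Qed.

Lemma cesaroE f n x : pmeas f -> (Ip 1 f < +oo)%E ->
  cesaro n f x = ((2 * pi)^-1)%:C * torus_integral (fun t => f t * (fejer n (t - x))%:C).
Proof.
move=> mf foo.
have ce (k : int) : cint (fun t => f t * expi (- (k%:~R * t))).
  have -> : (fun t : R => f t * expi (- (k%:~R * t))) = (fun t => f t * expi ((- k)%:~R * t)).
    by apply/funext => t; rewrite mulrNz mulNr.
  apply: (cint_mul (B := 1)) => // [|t]; first exact: pmeas_expi.
  exact: normc_expi_le1.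
have -> : (fun t => f t * (fejer n (t - x))%:C) = (fun t => \sum_(j < n.*2.+1)
    (fejer_coef n (j%:Z - n%:Z) * expi ((j%:Z - n%:Z)%:~R * x)) *
    (f t * expi (- ((j%:Z - n%:Z)%:~R * t)))).
  apply/funext => t; rewrite -fejerN fejerE /tp mulr_sumr; apply: eq_bigr => j _.
  by rewrite opprB mulrBr expiD; ring.
rewrite torus_integral_sum => [|j]; last exact: cintZ.
rewrite mulr_sumr /cesaro /tp; apply: eq_bigr => j _.
by rewrite torus_integralZ// /fourier_coef; ring.
Qed.

Lemma normc_fejer_integral f n x : pmeas f -> (Ip 1 f < +oo)%E ->
  ((normc (((2 * pi)^-1)%:C * torus_integral (fun t => f t * (fejer n (t - x))%:C)))%:E <=
   pi^-1%:E * \int[mu]_(t in torus R) (normc (f t) * fejer n (t - x))%:E)%E.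
Proof.
move=> mf foo; have pi0 := @pi_gt0 R.
rewrite normcM normc_real ger0_norm ?invr_ge0 ?mulr_ge0 ?(ltW pi0)// EFinM.
apply: (le_trans (lee_wpmul2l _ (normc_torus_integral (cint_fejer n x mf foo)))).
  by rewrite lee_fin invr_ge0 mulr_ge0// ltW.
rewrite muleA -EFinM.
have -> : (2 * pi)^-1 * 2 = pi^-1 :> R by rewrite invfM mulrAC mulVf ?mul1r.
rewrite Ip1E; under eq_integral => t _ do
  rewrite normcM normc_real ger0_norm ?fejer_ge0//.
by [].
Qed.

(* Averaging over the translates by the grid, on which the kernel sums to [M],
   replaces Fubini's theorem. *)
Lemma Ip1_cesaro f n : pmeas f -> (Ip 1 f < +oo)%E -> (Ip 1 (cesaro n f) <= 2%:E * Ip 1 f)%E.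
Proof.
move=> mf foo; have mT := @measurable_torus R; pose M := n.+1.
have pi0 := @pi_gt0 R.
have mC : pmeas (cesaro n f) by exact: pmeas_tp.
have mfe x : measurable_fun (torus R) (fun t => (normc (f t) * fejer n (t - x))%:E).
  apply: measurable_funTS; apply/measurable_EFinP; apply: measurable_funM.
    exact: measurable_normc.
  exact: measurable_fejer.
have pt x : (\sum_(j < M) (normc (cesaro n f (x + tgrid R M j)))%:E <=
    (pi^-1 * M%:R)%:E * Ip 1 f)%E.
  apply: (@le_trans _ _ (\sum_(j < M) (pi^-1%:E *
      \int[mu]_(t in torus R) (normc (f t) * fejer n (t - (x + tgrid R M j)))%:E))%E).
    by apply: lee_sum => j _; rewrite cesaroE//; exact: normc_fejer_integral.
  rewrite -ge0_sume_distrr; last first.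
    move=> j _; apply: integral_ge0 => t _.
    by rewrite lee_fin mulr_ge0 ?normc_ge0 ?fejer_ge0.
  rewrite -ge0_integral_sum//; last 2 first.
    by move=> j; exact: mfe.
    by move=> j t _; rewrite lee_fin mulr_ge0 ?normc_ge0 ?fejer_ge0.
  rewrite EFinM -muleA lee_wpmul2l ?lee_fin ?invr_ge0 ?(ltW pi0)//.
  rewrite Ip1E -ge0_integralZl//; last 2 first.
    by apply: measurable_funTS; apply/measurable_EFinP; exact: measurable_normc.
    by move=> t _; rewrite lee_fin normc_ge0.
  under eq_integral => t _.
    rewrite sumEFin -mulr_sumr.
    under eq_bigr do rewrite -fejerN opprB addrAC.
    rewrite (fejer_grid (x - t))// mulrC EFinM.
    over.
  by [].
have S : (\sum_(j < M) Ip 1 (fun x => cesaro n f (x + tgrid R M j)) = M%:R%:E * Ip 1 (cesaro n f))%E.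
  have sE (j : 'I_M) : Ip 1 (fun x => cesaro n f (x + tgrid R M j)) = (1%:E * Ip 1 (cesaro n f))%E.
    by rewrite mul1e Ip_shift.
  under eq_bigr do rewrite sE.
  by rewrite -ge0_sume_distrl// sumEFin sumr_const card_ord.
have M0 : 0 < M%:R :> R by rewrite ltr0n.
rewrite -(@lee_pmul2l _ M%:R%:E) ?fin_numE// -S.
under eq_bigr do rewrite Ip1E.
rewrite -ge0_integral_sum//; last 2 first.
- move=> j; apply: measurable_funTS; apply/measurable_EFinP.
  exact: (measurable_normc (pmeas_shift _ mC)).
- by move=> j x _; rewrite lee_fin normc_ge0.
apply: (@le_trans _ _ (\int[mu]_(x in torus R) ((pi^-1 * M%:R)%:E * Ip 1 f))%E).
  apply: ge0_le_integral_nomeas => x _; last exact: pt.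
  by rewrite sume_ge0// => j _; rewrite lee_fin normc_ge0.
have [r rE] : exists r : R, Ip 1 f = r%:E.
  by exists (fine (Ip 1 f)); rewrite fineK// ge0_fin_numE ?Ip_ge0.
rewrite rE -EFinM integral_cst// [X in (_ * X)%E]mu_torus -!EFinM lee_fin.
rewrite [leLHS](_ : _ = M%:R * (2 * r) * (pi^-1 * pi)); last by ring.
by rewrite mulVf ?mulr1// gt_eqF.
Qed.


Lemma normc_one_sub_expi_ge d u : 0 <= d -> d <= `|u| -> `|u| <= 2 * pi - d ->
  d / 3 <= normc (1 - expi (- u)).
Proof.
move=> d0; wlog u0 : u / 0 <= u.
  move=> H; have [/H//|/ltW un] := leP 0 u; rewrite -normrN => h1 h2.
  have := H (- u) _ h1 h2; rewrite oppr_ge0 => /(_ un).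
  by rewrite !normc_one_sub_expi mulNr sinN normrN.
rewrite ger0_norm// => du ud; rewrite normc_one_sub_expi.
have pi0 := @pi_gt0 R.
suff h : d / 6 <= sin (u / 2) by have := ler_norm (sin (u / 2)); lra.
have [uh|uh] := leP (u / 2) (pi / 2).
  by have := sin_ge_third (_ : 0 <= u / 2) uh; rewrite divr_ge0// => /(_ isT); lra.
have -> : sin (u / 2) = sin (pi - u / 2) by rewrite sinB sinpi cospi; ring.
have h1 : 0 <= pi - u / 2 by lra.
have h2 : pi - u / 2 <= pi / 2 by lra.
by have := sin_ge_third h1 h2; lra.
Qed.

Lemma torus_integral_fejer n x : torus_integral (fun t => (fejer n (t - x))%:C) = (2 * pi)%:C.
Proof.
apply: complex_eqP => /=; first by rewrite /Rintegral integral_fejer.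
by rewrite Rintegral_cst ?mul0r//; exact: measurable_torus.
Qed.

Lemma cesaro_sub f n x : pmeas f -> (Ip 1 f < +oo)%E ->
  cesaro n f x - f x =
    ((2 * pi)^-1)%:C * torus_integral (fun t => (f t - f x) * (fejer n (t - x))%:C).
Proof.
move=> mf foo; have pi0 := @pi_gt0 R.
have F1 : cint (fun t => (fejer n (t - x))%:C).
  have := @cint_fejer (fun=> 1) n x (pmeas_cst 1) (Ip_bounded (M := 1) ltr01 _).
  under eq_fun do rewrite mul1r.
  by apply => y; rewrite normc1.
under eq_fun do rewrite mulrBl -mulNr.
rewrite torus_integralD; [|exact: cint_fejer|exact: cintZ].
rewrite torus_integralZ// torus_integral_fejer cesaroE// [RHS]mulrDr; congr (_ + _).
by rewrite mulrCA -realcM mulVf ?mulr1// gt_eqF// mulr_gt0.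
Qed.

Lemma cesaro_sub_bounded f B n x : pmeas f -> (forall s, normc (f s) <= B) ->
  normc (cesaro n f x - f x) <= 4 * B.
Proof.
move=> mf fB; have pi0 := @pi_gt0 R; have mT := @measurable_torus R.
have foo : (Ip 1 f < +oo)%E by apply: Ip_bounded fB.
have B0 : 0 <= B := le_trans (normc_ge0 _) (fB 0).
have mH : pmeas (fun t => f t - f x) by apply: pmeasB => //; exact: pmeas_cst.
have HB t : normc (f t - f x) <= 2 * B.
  by rewrite (le_trans (normcB _ _))// mulr_natl mulr2n lerD.
have Hoo : (Ip 1 (fun t => f t - f x)%R < +oo)%E by exact: Ip_bounded HB.
rewrite cesaro_sub// -lee_fin; apply: (le_trans (normc_fejer_integral n x mH Hoo)).
apply: (@le_trans _ _ (pi^-1%:E * \int[mu]_(t in torus R)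
    ((2 * B)%:E * (fejer n (t - x))%:E))%E).
  rewrite lee_wpmul2l ?lee_fin ?invr_ge0 ?(ltW pi0)//.
  apply: ge0_le_integral_nomeas => t _; first by rewrite lee_fin mulr_ge0 ?normc_ge0 ?fejer_ge0.
  by rewrite -EFinM lee_fin ler_wpM2r ?fejer_ge0.
rewrite ge0_integralZl//; last 3 first.
- by apply: measurable_funTS; apply/measurable_EFinP; exact: measurable_fejer.
- by move=> t _; rewrite lee_fin fejer_ge0.
- by rewrite lee_fin mulr_ge0.
rewrite integral_fejer -!EFinM lee_fin.
rewrite [leLHS](_ : _ = (4 * B) * (pi^-1 * pi)); last by ring.
by rewrite mulVf ?mulr1// gt_eqF.
Qed.

(** Farther than [d] from [x], the bound [2 B] is rewritten with [|1 - expi (t - x)| >= d / 3];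
    hence [18 = 2 * 9]. *)
Lemma fejer_away (B e d x t : R) (G : R -> R[i]) : 0 < e -> 0 < d ->
  d <= x -> x <= 2 * pi - d -> 0 <= t -> t < 2 * pi ->
  (forall s, normc (G s) <= B) -> (forall s, `|s - x| <= d -> normc (G s - G x) <= e) ->
  normc (G t - G x) <= e + 18 * B / d ^+ 2 * normc (1 - expi (t - x)) ^+ 2.
Proof.
move=> e0 d0 dx xd t0 t2 GB Gc; have B0 : 0 <= B := le_trans (normc_ge0 _) (GB 0).
have pi0 := @pi_gt0 R.
have K0 : 0 <= 18 * B / d ^+ 2 by rewrite divr_ge0 ?sqr_ge0// mulr_ge0.
have [td|dt] := leP `|t - x| d.
  by rewrite (le_trans (Gc _ td))// lerDl mulr_ge0 ?sqr_ge0.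
have lo : d / 3 <= normc (1 - expi (t - x)).
  rewrite -[t - x]opprB normc_one_sub_expi_ge ?(ltW d0)// distrC ?(ltW dt)//.
  by rewrite ler_norml; apply/andP; split; lra.
rewrite ler_wpDl ?(ltW e0)//.
apply: (@le_trans _ _ (2 * B)).
  by rewrite (le_trans (normcB _ _))//; have := GB t; have := GB x; lra.
have -> : 2 * B = 18 * B / d ^+ 2 * (d / 3) ^+ 2 by field; rewrite gt_eqF.
by rewrite ler_wpM2l// lerXn2r ?nnegrE ?normc_ge0 ?divr_ge0 ?(ltW d0).
Qed.

(** By [fejer_concentrated] the second term of [fejer_away] contributes at most [4 / (n + 1)] times
    its constant. Integration over a period with weight [1 / pi] doubles both terms, and
    [144 = 2 * 4 * 18]. *)
Lemma cesaro_pointwise (G : R -> R[i]) (B x d e : R) n : pmeas G -> 0 < e -> 0 < d ->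
  d <= x -> x <= 2 * pi - d ->
  (forall s, normc (G s) <= B) -> (forall s, `|s - x| <= d -> normc (G s - G x) <= e) ->
  normc (cesaro n G x - G x) <= 2 * e + 144 * B / d ^+ 2 / n.+1%:R.
Proof.
move=> mG e0 d0 dx xd GB Gc; have pi0 := @pi_gt0 R; have mT := @measurable_torus R.
have Goo : (Ip 1 G < +oo)%E by apply: Ip_bounded GB.
have mH : pmeas (fun t => G t - G x) by apply: pmeasB => //; exact: pmeas_cst.
have Hoo : (Ip 1 (fun t => G t - G x)%R < +oo)%E.
  apply: (@Ip_bounded _ _ _ (B + B)) => // t; rewrite (le_trans (normcB _ _))// lerD//.
rewrite cesaro_sub//.
rewrite -lee_fin; apply: (le_trans (normc_fejer_integral n x mH Hoo)).
pose K := 18 * B / d ^+ 2.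
apply: (@le_trans _ _ (pi^-1%:E * \int[mu]_(t in torus R)
    (e%:E * (fejer n (t - x))%:E + (K * (4 / n.+1%:R))%:E))%E).
  rewrite lee_wpmul2l ?lee_fin ?invr_ge0 ?(ltW pi0)//.
  apply: ge0_le_integral_nomeas => t; rewrite /torus/= in_itv/= => /andP[t0 t2].
    by rewrite lee_fin mulr_ge0 ?normc_ge0 ?fejer_ge0.
  rewrite -EFinM -EFinD lee_fin.
  have := fejer_away e0 d0 dx xd t0 t2 GB Gc => h.
  apply: (le_trans (ler_wpM2r (fejer_ge0 n (t - x)) h)).
  rewrite -/K mulrDl lerD2l -mulrA; apply: ler_wpM2l.
    by rewrite divr_ge0 ?sqr_ge0// mulr_ge0// (le_trans _ (GB 0)) ?normc_ge0.
  by rewrite mulrC fejer_concentrated.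
have K0 : 0 <= K * (4 / n.+1%:R).
  rewrite mulr_ge0 ?divr_ge0 ?sqr_ge0// mulr_ge0// (le_trans _ (GB 0)) ?normc_ge0//.
have mF : measurable_fun (torus R) (fun t => (fejer n (t - x))%:E).
  by apply: measurable_funTS; apply/measurable_EFinP; exact: measurable_fejer.
rewrite ge0_integralD//; last 2 first.
- by move=> t _; rewrite -EFinM lee_fin mulr_ge0 ?fejer_ge0// ltW.
- exact: measurable_funeM.
rewrite ge0_integralZl//; last 2 first.
- by move=> t _; rewrite lee_fin fejer_ge0.
- by rewrite lee_fin ltW.
rewrite integral_cst// integral_fejer.
rewrite [X in (_ + _ * X)%E](_ : _ = (2 * pi)%:E); last exact: mu_torus.
rewrite -!(EFinM, EFinD) lee_fin.
rewrite [leLHS](_ : _ = (2 * e + 2 * (K * (4 / n.+1%:R))) * (pi^-1 * pi)); last by ring.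
rewrite mulVf ?gt_eqF// mulr1 lerD2l /K.
by rewrite le_eqVlt; apply/orP; left; apply/eqP; ring.
Qed.

End fejer_kernel.

Section fejer_theorem.
Variable R : realType.
Notation mu := (@lebesgue_measure R).
Implicit Types (f g : R -> R[i]).
Local Opaque tp bser cesaro.

Definition periodize (T : Type) (g : R -> T) (x : R) : T :=
  g (x - (Num.floor (x / (2 * pi)))%:~R * (2 * pi)).

Lemma periodize_periodic (T : Type) (g : R -> T) x : periodize g (x + 2 * pi) = periodize g x.
Proof.
have pi2 : 2 * pi != 0 :> R by rewrite gt_eqF// mulr_gt0 ?pi_gt0.
rewrite /periodize; have -> : (x + 2 * pi) / (2 * pi) = x / (2 * pi) + 1.
  by rewrite mulrDl divff.
rewrite Num.Theory.floorDrz ?rpred1// Num.Theory.floor1 intrD; congr g; ring.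
Qed.

Lemma periodizeE (T : Type) (g : R -> T) x : 0 <= x -> x < 2 * pi -> periodize g x = g x.
Proof.
move=> x0 x2; rewrite /periodize; have pi2 : 0 < 2 * pi :> R by rewrite mulr_gt0 ?pi_gt0.
suff -> : Num.floor (x / (2 * pi)) = 0 by rewrite mul0r subr0.
apply/eqP; rewrite Num.Theory.floor_eq//= ?add0r.
by rewrite divr_ge0 ?(ltW pi2)// ltr_pdivrMr// mul1r.
Qed.

Lemma measurable_periodize (g : R -> R) : measurable_fun setT g ->
  measurable_fun setT (periodize g).
Proof.
move=> mg; apply: (measurableT_comp mg); apply: measurable_funB => //.
apply: measurable_funM; last exact: measurable_cst.
apply: nondecreasing_measurable => // s t st; rewrite ler_int Num.Theory.floor_ge_int.
rewrite (le_trans (Num.Theory.floor_le_tmp _))//.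
by rewrite ler_wpM2r// invr_ge0 mulr_ge0 ?pi_ge0.
Qed.

Lemma continuous_approx (f : R -> R) (e : R) : 0 < e ->
  mu.-integrable (torus R) (fun x => (f x)%:E) ->
  exists g : R -> R, continuous g /\
    (\int[mu]_(x in torus R) `|f x - g x|%:E <= e%:E)%E.
Proof.
move=> e0 fi; have mT := @measurable_torus R.
have [|g [cg ig cv]] := @approximation_continuous_integrable R (torus R) f mT _ fi.
  by rewrite [X in (X < _)%E]mu_torus ltry.
have /fine_cvgP[[n1 _ h1] /cvgr_le/(_ _ e0)[n2 _ h2]] := cv.
exists (g (n1 + n2)%N); split; first exact: cg.
have := h2 (n1 + n2)%N (leq_addl _ _); rewrite -lee_fin fineK//.
exact: h1 (leq_addr _ _).
Qed.

Lemma periodize_bounded (g : R -> R) : continuous g ->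
  exists B, forall x, `|periodize g x| <= B.
Proof.
move=> cg; have pi2 : 0 < 2 * pi :> R by rewrite mulr_gt0 ?pi_gt0.
have [|c _ hc] := @EVT_max R (fun x => `|g x|) 0 (2 * pi) (ltW pi2).
  apply: continuous_subspaceT => x; apply: continuous_comp; first exact: cg.
  exact: norm_continuous.
exists `|g c| => x; rewrite /periodize; apply: hc.
have /andP[f1 f2] := Num.Theory.floor_itv (x / (2 * pi)).
rewrite in_itv/=; rewrite ler_pdivlMr// in f1.
rewrite ltr_pdivrMr// intrD mulrDl mul1r in f2.
by apply/andP; split; lra.
Qed.

(** A continuous approximant on the line is restricted to one period and repeated. It may jump at
    multiples of [2 pi], so continuity is claimed only for [0 < x < 2 pi]. *)
Lemma Lp1_approx f (e : R) : pmeas f -> (Ip 1 f < +oo)%E -> 0 < e ->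
  exists G : R -> R[i], exists B : R, [/\ pmeas G, forall s, normc (G s) <= B,
    forall x (e' : R), 0 < x -> x < 2 * pi -> 0 < e' -> exists d : R,
      [/\ 0 < d, d <= x, x <= 2 * pi - d &
        forall s, `|s - x| <= d -> normc (G s - G x) <= e'] &
    (Ip 1 (fun x => f x - G x)%R <= e%:E)%E].
Proof.
move=> mf foo e0; have e20 : 0 < e / 2 by rewrite divr_gt0.
have mT := @measurable_torus R.
have [fr fi] := pmeas_cint mf foo; have [m1 m2 m3] := mf.
have [u [cu hu]] := continuous_approx e20 fr.
have [v [cv hv]] := continuous_approx e20 fi.
have [Bu hBu] := periodize_bounded cu; have [Bv hBv] := periodize_bounded cv.
exists (fun x => periodize u x +i* periodize v x), (Bu + Bv); split.
- split=> /=.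
  + by apply: measurable_periodize; exact: continuous_measurable_fun.
  + by apply: measurable_periodize; exact: continuous_measurable_fun.
  + by move=> x; rewrite !periodize_periodic.
- by move=> s; rewrite (le_trans (normc_le_ReIm _))//= lerD ?hBu ?hBv.
- move=> x e' x0 x2 e'0.
  have e'20 : 0 < e' / 2 by rewrite divr_gt0.
  have near_d (g : R -> R) : continuous g -> exists2 d, 0 < d &
      forall s, `|s - x| <= d -> `|g s - g x| <= e' / 2.
    move=> cg; have /cvgrPdist_le/(_ _ e'20)/nbhs_ballP[d /= d0 hd] := cg x.
    exists (d / 2) => [|s sd]; first by rewrite divr_gt0.
    rewrite distrC; apply: hd; rewrite /ball/= distrC.
    by rewrite (le_lt_trans sd)// ltr_pdivrMr// ltr_pMr// ltr1n.
  have [du du0 hdu] := near_d u cu; have [dv dv0 hdv] := near_d v cv.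
  (* Half the distance to the ends of the period keeps the whole neighbourhood inside it, where
     [periodize] is the identity. *)
  pose d := Num.min (Num.min du dv) (Num.min x (2 * pi - x) / 2).
  have md : 0 < Num.min x (2 * pi - x) by rewrite lt_min x0 subr_gt0.
  have d_le : [/\ d <= du, d <= dv & d <= Num.min x (2 * pi - x) / 2].
    by rewrite /d !ge_min !lexx ?orbT.
  have dm1 : Num.min x (2 * pi - x) <= x by rewrite ge_min lexx.
  have dm2 : Num.min x (2 * pi - x) <= 2 * pi - x by rewrite ge_min lexx orbT.
  have d0 : 0 < d by rewrite /d !lt_min du0 dv0 divr_gt0.
  have [d1 d2 d3] := d_le; clearbody d.
  have dx : d <= x by clear -d3 md dm1; lra.
  have xd : x <= 2 * pi - d by clear -d3 md dm2; lra.
  exists d; split=> //.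
  move=> s sd; have /andP[s1 s2] : -d <= s - x <= d by rewrite -ler_norml.
  have s0 : 0 <= s by clear -s1 dx; lra.
  have s2pi : s < 2 * pi by clear -s2 d3 md dm2; lra.
  rewrite (periodizeE u s0 s2pi) (periodizeE v s0 s2pi).
  rewrite (periodizeE u (ltW x0) x2) (periodizeE v (ltW x0) x2).
  rewrite (le_trans (normc_le_ReIm _))//= [e']splitr.
  by rewrite lerD// ?hdu ?hdv// (le_trans sd).
- rewrite Ip1E; apply: (@le_trans _ _ (\int[mu]_(x in torus R)
     (`|complex.Re (f x) - u x|%:E + `|complex.Im (f x) - v x|%:E))%E).
    apply: ge0_le_integral_nomeas => x; rewrite /torus/= in_itv/= => /andP[x0 x2].
      by rewrite lee_fin normc_ge0.
    rewrite -EFinD lee_fin (le_trans (normc_le_ReIm _))// ReD ImD ReN ImN /=.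
    by rewrite !periodizeE.
  have mu' : measurable_fun [set: R] u by exact: continuous_measurable_fun.
  have mv' : measurable_fun [set: R] v by exact: continuous_measurable_fun.
  rewrite ge0_integralD//; last 2 first.
  + apply: measurable_funTS; apply/measurable_EFinP.
    by apply: measurableT_comp => //; exact: measurable_funB.
  + apply: measurable_funTS; apply/measurable_EFinP.
    by apply: measurableT_comp => //; exact: measurable_funB.
  by rewrite [in leRHS](splitr e) EFinD; exact: leeD.
Qed.

Lemma cesaro_cvg_bounded (G : R -> R[i]) B : pmeas G -> (forall s, normc (G s) <= B) ->
  (forall x (e' : R), 0 < x -> x < 2 * pi -> 0 < e' -> exists d : R,
      [/\ 0 < d, d <= x, x <= 2 * pi - d &
        forall s, `|s - x| <= d -> normc (G s - G x) <= e']) ->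
  Ip 1 (fun x => cesaro n G x - G x)%R @[n --> \oo] --> 0%E.
Proof.
move=> mG GB Gc; have mT := @measurable_torus R; have B0 := le_trans (normc_ge0 _) (GB 0).
have pi0 := @pi_gt0 R.
pose h n x := (normc (cesaro n G x - G x))%:E.
have mC n : pmeas (fun x => cesaro n G x - G x).
  by apply: pmeasB => //; exact: pmeas_cesaro.
have mh n : measurable_fun (torus R) (h n).
  by apply: measurable_funTS; apply/measurable_EFinP; exact: measurable_normc.
have pw x : 0 < x -> x < 2 * pi -> h ^~ x @ \oo --> 0%E.
  move=> x0 x2; apply/fine_cvgP; split; first by apply: nearW.
  apply/cvgrPdist_le => e e0 /=.
  have e40 : 0 < e / 4 by rewrite divr_gt0.
  have [d [d0 dx xd hd]] := Gc x _ x0 x2 e40.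
  pose K := 144 * B / d ^+ 2.
  have K0 : 0 <= K by apply: divr_ge0; [exact: mulr_ge0|exact: sqr_ge0].
  exists (Num.bound (2 * K / e)) => // n /= bn.
  rewrite sub0r normrN ger0_norm ?normc_ge0//.
  apply: (le_trans (cesaro_pointwise n mG e40 d0 dx xd GB hd)); rewrite -/K.
  have : K / n.+1%:R <= e / 2.
    rewrite ler_pdivrMr// -ler_pdivrMl ?divr_gt0//.
    have b1 : 2 * K / e < (Num.bound (2 * K / e))%:R.
      by apply: Num.Theory.archi_boundP; rewrite divr_ge0 ?(ltW e0)// mulr_ge0.
    have : (Num.bound (2 * K / e))%:R <= n.+1%:R :> R by rewrite ler_nat leqW.
    have -> : (e / 2)^-1 * K = 2 * K / e by field; rewrite gt_eqF.
    by apply: le_trans; exact: ltW.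
  move=> hK; have -> : 2 * (e / 4) = e / 2 by field.
  by rewrite [leRHS](splitr e) lerD.
have [] := @dominated_convergence _ _ _ mu (torus R) mT h (fun=> 0%E) (fun=> (4 * B)%:E) mh.
- exact: measurable_cst.
(* Pointwise convergence is known inside the period; the endpoint 0 is a null set. *)
- exists [set 0]; split; [exact: measurable_set1|exact: lebesgue_measure_set1|].
  move=> x /= H; apply: contrapT => x0; apply: H; rewrite /torus/= in_itv/= => /andP[x1 x2].
  apply: pw => //; rewrite lt_neqAle x1 andbT eq_sym; exact/eqP.
- apply/integrableP; split; first exact: measurable_cst.
  by rewrite integral_cst// [X in (_ * X)%E]mu_torus -EFinM ltry.
- by apply: aeW => x n _; rewrite /h gee0_abs ?lee_fin ?normc_ge0 ?cesaro_sub_bounded.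
move=> _ _; rewrite integral0 => cv.
rewrite (_ : (fun n => _) = [sequence (\int[mu]_(x in torus R) h n x)%E]_n)//.
by apply/funext => n; rewrite Ip1E.
Qed.

(** Density: the means of the approximant converge, and the approximation error passes through the
    means with a factor at most 2, uniformly in [n]. *)
Lemma cesaro_cvg f : pmeas f -> (Ip 1 f < +oo)%E -> forall e : R, 0 < e ->
  \forall n \near \oo, (Ip 1 (fun x => cesaro n f x - f x)%R <= e%:E)%E.
Proof.
move=> mf foo e e0; have e40 : 0 < e / 4 by rewrite divr_gt0.
have [G [B [mG GB Gc fG]]] := Lp1_approx mf foo e40.
have mH : pmeas (fun x => f x - G x) by apply: pmeasB.
have Hoo : (Ip 1 (fun x => f x - G x)%R < +oo)%E by rewrite (le_lt_trans fG)// ltry.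
have Goo : (Ip 1 G < +oo)%E by exact: Ip_bounded GB.
have := cesaro_cvg_bounded mG GB Gc.
move=> /fine_cvgP[fin /cvgr_le/(_ _ e40)cv].
apply: filterS (filterI fin cv) => n [h1 h2].
have hG : (Ip 1 (fun x => cesaro n G x - G x)%R <= (e / 4)%:E)%E.
  by rewrite -[leLHS]fineK// lee_fin.
have split3 x : cesaro n f x - f x = cesaro n (fun x => f x - G x) x
     + ((cesaro n G x - G x) - (f x - G x)).
  have -> : cesaro n f x = cesaro n (fun x => f x - G x) x + cesaro n G x.
    rewrite !cesaroE// -mulrDr -torus_integralD; [|exact: cint_fejer|exact: cint_fejer].
    by congr (_ * torus_integral _); apply/funext => t; rewrite mulrBl subrK.
  ring.
rewrite (funext split3).
have mC (F : R -> R[i]) : pmeas (cesaro n F) by exact: pmeas_cesaro.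
apply: (le_trans (IpD ltr01 (lexx _) (mC _) (pmeasB (pmeasB (mC G) mG) mH))).
apply: (@le_trans _ _ (2%:E * (e / 4)%:E + ((e / 4)%:E + (e / 4)%:E))%E).
  apply: leeD.
    apply: (le_trans (Ip1_cesaro n mH Hoo)).
    exact: (lee_wpmul2l _ fG).
  apply: (le_trans (IpB ltr01 (lexx _) (pmeasB (mC G) mG) mH)).
  exact: (leeD hG fG).
by rewrite -EFinM -!EFinD lee_fin; lra.
Qed.

End fejer_theorem.

(** * Convergence of grid differences to the Weyl derivative *)

Section grid_consistency.
Variable R : realType.
Implicit Types (f g : R -> R[i]) (c : int -> R[i]) (a h : R) (n N M : nat).
Local Opaque tp bser cesaro AM.

Lemma tp_widen_supp n N c : (forall k : int, (n < `|k|)%N -> c k = 0) -> (n <= N)%N ->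
  tp n c = tp N c.
Proof.
move=> hc /subnKC <-; elim: (N - n)%N => [|d ih]; first by rewrite addn0.
rewrite ih addnS tp_widen1; apply: eq_tp => k _; case: ltnP => // nk; rewrite hc//.
by rewrite (leq_ltn_trans (leq_addr d n)).
Qed.

Lemma fejer_coef_supp n (k : int) : (n < `|k|)%N -> fejer_coef R n k = 0.
Proof.
move=> nk; rewrite /fejer_coef big1// => l _; rewrite big1// => l' _.
case: eqP => [e|_]; last by rewrite mulr0.
by move: nk (ltn_ord l) (ltn_ord l'); rewrite e; lia.
Qed.

Lemma ik_powE a (k : int) :
  deriv_symbol a k%:~R = if k == 0 then 0 else ik_pow a k :> R[i].
Proof.
rewrite /deriv_symbol intr_eq0; case: eqP => // _; rewrite /ik_pow intr_norm.
by congr (_ * expi (_ * _)); rewrite intr_sg.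
Qed.

Definition weyl_pair a f g := [/\ pmeas f, pmeas g, (Ip 1 f < +oo)%E, (Ip 1 g < +oo)%E &
  forall k, fourier_coef g k = deriv_symbol a k%:~R * fourier_coef f k].

Lemma cesaro_subE a f g : (forall k, fourier_coef g k = deriv_symbol a k%:~R * fourier_coef f k) ->
  forall n n', exists N, exists c, (fun x => cesaro n' f x - cesaro n f x) = tp N c /\
    (fun x => cesaro n' g x - cesaro n g x) = tp N (fun k => deriv_symbol a k%:~R * c k).
Proof.
move=> fg n n'; pose N := maxn n n'.
have W (F : R -> R[i]) m : (m <= N)%N ->
    cesaro m F = tp N (fun k => fejer_coef R m k * fourier_coef F k).
  move=> mN; rewrite -(@tp_widen_supp m)// => k mk.
  by rewrite fejer_coef_supp// mul0r.
exists N, (fun k => (fejer_coef R n' k - fejer_coef R n k) * fourier_coef f k).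
split; apply/funext => x; rewrite !W ?leq_maxl ?leq_maxr// -tpN -tpD;
  apply: eq_tpx => k _; rewrite ?fg; ring.
Qed.

Local Opaque Ip.

Lemma gstep_gt0 M : (0 < M)%N -> 0 < gstep R M.
Proof. by move=> M0; rewrite divr_gt0 ?mulr_gt0 ?pi_gt0// ltr0n. Qed.

Definition Agrid a M f x : R[i] := ((M%:R / (2 * pi)) `^ a)%:C * AM a M f x.

Lemma AgridE a M f x : Agrid a M f x = ((M%:R / (2 * pi)) `^ a)%:C * AM a M f x.
Proof. by []. Qed.

Lemma pmeas_Agrid a M f : pmeas f -> pmeas (Agrid a M f).
Proof. by move=> mf; apply: pmeasZ; exact: pmeas_AM. Qed.

Lemma AgridB a M f g : Agrid a M (fun x => f x - g x) = (fun x => Agrid a M f x - Agrid a M g x).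
Proof. by apply/funext => x; rewrite /Agrid AMB mulrBr. Qed.

Lemma Ip_Agrid p a M f : 0 < p -> pmeas f ->
  Ip p (Agrid a M f) = ((((M%:R / (2 * pi)) `^ a) `^ p)%:E * Ip p (AM a M f))%E.
Proof.
move=> p0 mf; rewrite IpZ; last exact: pmeas_AM.
by rewrite normc_real ger0_norm// powR_ge0.
Qed.

Local Opaque Agrid.

Lemma Ip_Agrid_tp p a M N c : 0 < p -> 0 < a -> (0 < M)%N -> Ip p (Agrid a M (tp N c)) =
  ((((M%:R / (2 * pi)) `^ a) `^ p)%:E * Ip p (tp N (dfc a (gstep R M) c)))%E.
Proof. by move=> p0 a0 M0; rewrite Ip_Agrid ?AM_tp//; exact: pmeas_tp. Qed.

Lemma Ip1_Agrid_tp a : 0 < a -> exists2 C, 0 < C & forall M N c, (0 < M)%N ->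
  (Ip 1 (Agrid a M (tp N c)) <= C%:E * Ip 1 (tp N (fun k => deriv_symbol a k%:~R * c k)%R))%E.
Proof.
move=> a0; have [C C0 hC] := Ip1_dfc_le_deriv a0; exists C => // M N c M0.
have M0' : 0 < M%:R :> R by rewrite ltr0n.
have pi2 : 0 < 2 * pi :> R by rewrite mulr_gt0// pi_gt0.
rewrite (Ip_Agrid_tp N c ltr01 a0 M0) (powRr1 (powR_ge0 _ _)).
apply: (le_trans (lee_wpmul2l _ (hC N c _ (gstep_gt0 M0)))); first by rewrite lee_fin powR_ge0.
rewrite muleA -EFinM.
suff -> : (M%:R / (2 * pi)) `^ a * (C * gstep R M `^ a) = C by [].
rewrite mulrCA -powRM ?divr_ge0 ?(ltW pi2) ?(ltW M0') ?(ltW (gstep_gt0 M0))//.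
have -> : M%:R / (2 * pi) * gstep R M = 1 by rewrite /gstep mulrA divfK ?divff ?gt_eqF.
by rewrite powR1 mulr1.
Qed.

(** In contrast with [Ip1_Agrid_tp] the bound depends on [M]; it only has to absorb a remainder that
    can be made small once [M] is fixed. *)
Lemma Ip1_Agrid_fin a M f : (0 < M)%N -> pmeas f -> exists2 B : R, 0 <= B &
  forall f', pmeas f' -> (Ip 1 (Agrid a M f') <= B%:E * Ip 1 f')%E.
Proof.
move=> M0 mf; pose B := \sum_(j < M) `|foldc a M j| `^ 1.
have B0 : 0 <= B by apply: sumr_ge0 => j _; exact: powR_ge0.
exists (((M%:R / (2 * pi)) `^ a) `^ 1 * B) => [|f' mf']; first by rewrite mulr_ge0 ?powR_ge0.
rewrite Ip_Agrid// EFinM -muleA; apply: lee_wpmul2l; first by rewrite lee_fin powR_ge0.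
exact: Ip_AM.
Qed.

(** The constant is uniform in [M]. With [M] fixed, [f] is replaced by a mean [cesaro n' f] so
    accurate that even the [M]-dependent bound leaves an error [e]; the rest is a polynomial, to
    which the uniform estimate by its derivative applies. *)
Lemma Agrid_cesaro_le a : 0 < a -> exists2 C, 0 < C & forall f g n M, weyl_pair a f g ->
  (0 < M)%N -> (Ip 1 (Agrid a M (fun x => f x - cesaro n f x)%R) <=
     C%:E * Ip 1 (fun x => cesaro n g x - g x)%R)%E.
Proof.
move=> a0; have [C C0 hC] := Ip1_Agrid_tp a0; exists C => // f g n M [mf mg foo goo fg] M0.
have [B B0 hB] := Ip1_Agrid_fin a M0 mf.
apply/lee_addgt0Pr => e e0.
have BC : 0 < B + C by rewrite ltr_wpDl.
have e10 : 0 < e / (B + C) by rewrite divr_gt0.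
have [n' [h1 h2]] : exists n', (Ip 1 (fun x => cesaro n' f x - f x)%R <= (e / (B + C))%:E)%E /\
    (Ip 1 (fun x => cesaro n' g x - g x)%R <= (e / (B + C))%:E)%E.
  have [n' _ H] := @filterI _ \oo _ _ _ (cesaro_cvg mf foo e10) (cesaro_cvg mg goo e10).
  by exists n'; exact: (H n' (leqnn _)).
have [N [c [E1 E2]]] := cesaro_subE fg n n'.
have mC m (F : R -> R[i]) : pmeas (cesaro m F) by exact: pmeas_cesaro.
have -> : (fun x => f x - cesaro n f x) =
    (fun x => (cesaro n' f x - cesaro n f x) - (cesaro n' f x - f x)).
  by apply/funext => x; ring.
rewrite AgridB; apply: le_trans (IpB ltr01 (lexx _) _ _) _.
- by apply: pmeas_Agrid; exact: pmeasB.
- by apply: pmeas_Agrid; exact: pmeasB.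
have t2 : (Ip 1 (Agrid a M (fun x => cesaro n' f x - f x)%R) <= (B * (e / (B + C)))%:E)%E.
  apply: (le_trans (hB (fun x => cesaro n' f x - f x) (pmeasB (mC _ _) mf))); rewrite EFinM.
  by apply: lee_wpmul2l; [rewrite lee_fin|exact: h1].
have t1 : (Ip 1 (Agrid a M (fun x => cesaro n' f x - cesaro n f x)%R) <=
    C%:E * Ip 1 (fun x => cesaro n g x - g x)%R + (C * (e / (B + C)))%:E)%E.
  rewrite E1; apply: (le_trans (hC M N c M0)); rewrite -E2.
  have -> : (fun x => cesaro n' g x - cesaro n g x) =
     (fun x => (cesaro n' g x - g x) - (cesaro n g x - g x)) by apply/funext => x; ring.
  rewrite EFinM -ge0_muleDr ?Ip_ge0 ?lee_fin ?(ltW e10)//.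
  apply: lee_wpmul2l; first by rewrite lee_fin ltW.
  exact: (IpB_le ltr01 (lexx _) (pmeasB (mC n' g) mg) (pmeasB (mC n g) mg) h2).
apply: (le_trans (leeD t1 t2)); rewrite -addeA; apply: leeD2l.
rewrite -EFinD lee_fin -mulrDl addrC mulrCA divff ?mulr1// gt_eqF//.
Qed.

Lemma cesaro_deriv a f g n : weyl_pair a f g -> cesaro n g =
  tp n (fun k => deriv_symbol a k%:~R * (fejer_coef R n k * fourier_coef f k)).
Proof.
move=> [_ _ _ _ fg]; apply/funext => x; apply: eq_tpx => k _.
by rewrite fg; ring.
Qed.

(** The order [n] is fixed first, by the estimate uniform in [M]; only then does the grid become
    fine, on the single polynomial [cesaro n f]. *)
Lemma weyl_grid_cvg a f g : 0 < a -> weyl_pair a f g -> forall e : R, 0 < e ->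
  \forall m \near \oo, (Ip 1 (fun x => Agrid a m.+1 f x - g x)%R <= e%:E)%E.
Proof.
move=> a0 fg e e0; have [C C0 hC] := Agrid_cesaro_le a0.
have [mf mg foo goo hfg] := fg.
have C2 : 0 < C + 2 by rewrite addr_gt0.
pose e1 := e / (C + 2); have e10 : 0 < e1 by rewrite divr_gt0.
have [n _ /(_ n (leqnn n))hn] := cesaro_cvg mg goo e10.
pose c k := fejer_coef R n k * fourier_coef f k.
have pi2 : 0 < 2 * pi :> R by rewrite mulr_gt0// pi_gt0.
have := dfc_deriv_cvg n c a0 pi2 e10; apply: filterS => m hm.
have mC k (F : R -> R[i]) : pmeas (cesaro k F) by exact: pmeas_cesaro.
have EA : (fun x => Agrid a m.+1 (cesaro n f) x - cesaro n g x) =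
  (fun x => ((m.+1%:R / (2 * pi)) `^ a)%:C * tp n (dfc a (2 * pi / m.+1%:R) c) x
       - tp n (fun k => deriv_symbol a k%:~R * c k) x).
  by rewrite (cesaro_deriv n fg) [cesaro n f](_ : _ = tp n c)//; apply/funext => x; rewrite AgridE AM_tp.
rewrite -EA in hm.
have -> : (fun x => Agrid a m.+1 f x - g x) = (fun x => Agrid a m.+1 (fun x => f x - cesaro n f x) x +
    ((Agrid a m.+1 (cesaro n f) x - cesaro n g x) + (cesaro n g x - g x))).
  by apply/funext => x; rewrite AgridB; ring.
have m1 : pmeas (Agrid a m.+1 (fun x => f x - cesaro n f x)).
  by apply: pmeas_Agrid; exact: pmeasB.
have m2 : pmeas (fun x => Agrid a m.+1 (cesaro n f) x - cesaro n g x).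
  by apply: pmeasB => //; exact: pmeas_Agrid.
have m3 : pmeas (fun x => cesaro n g x - g x) by exact: pmeasB.
apply: (le_trans (IpD ltr01 (lexx _) m1 (pmeasD m2 m3))).
apply: (le_trans (leeD (hC f g n m.+1 fg isT) (IpD ltr01 (lexx _) m2 m3))).
apply: (@le_trans _ _ (C%:E * e1%:E + (e1%:E + e1%:E))%E).
  apply: leeD; last exact: leeD hm hn.
  by apply: lee_wpmul2l; [rewrite lee_fin ltW|exact: hn].
rewrite -EFinM -!EFinD lee_fin [leLHS](_ : _ = e1 * (C + 2)); last by ring.
by rewrite /e1 divfK// gt_eqF.
Qed.

End grid_consistency.

(** * Dyadic sums and the final estimate *)

Section sigma_growth.
Variable R : realType.
Implicit Types (a p : R) (n m : nat).

Lemma sigma_ge0 a p n : 0 <= sigma a p n.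
Proof.
rewrite /sigma; case: ifP => _; first exact: powR_ge0.
by case: ifP => _; rewrite ?mulr_ge0 ?powR_ge0.
Qed.

Lemma sigma_homo a p m n : 0 < p -> p < 1 -> 0 < a -> (m <= n)%N ->
  sigma a p m <= sigma a p n.
Proof.
move=> p0 p1 a0 mn; have p10 : 0 < p^-1 by rewrite invr_gt0.
have q0 : 0 <= p^-1 - 1 by rewrite subr_ge0 invf_ge1// ltW.
have mn' : m%:R <= n%:R :> R by rewrite ler_nat.
rewrite /sigma; case: ifP => _; first by rewrite ler_powR2// ltW.
case: ifP => _; last by rewrite ler_powR2.
apply: ler_pM; rewrite ?powR_ge0// ler_powR2 ?(ltW p10)// ?ln_ge0 ?ler1n//.
by rewrite ler_ln ?posrE// ler_nat.
Qed.

Lemma sigma_dilate a p k : 0 < p -> p < 1 -> 0 < a -> (0 < k)%N -> exists2 D, 0 < D &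
  forall n, (0 < n)%N -> sigma a p (k * n) <= D * sigma a p n.
Proof.
move=> p0 p1 a0 k0; have k0' : 0 < k%:R :> R by rewrite ltr0n.
have p10 : 0 < p^-1 by rewrite invr_gt0.
have q0 : 0 <= p^-1 - 1 by rewrite subr_ge0 invf_ge1// ltW.
rewrite /sigma; have [_|_] := boolP (is_posnat a || _).
  by exists (k%:R `^ a) => [|n n0]; rewrite ?powR_gt0// natrM powRM.
have [_|_] := eqVneq a (p^-1 - 1); last first.
  by exists (k%:R `^ (p^-1 - 1)) => [|n n0]; rewrite ?powR_gt0// natrM powRM.
exists (k%:R `^ (p^-1 - 1) * k%:R `^ p^-1) => [|n n0]; first by rewrite mulr_gt0 ?powR_gt0.
rewrite natrM powRM// mulrACA ler_wpM2l ?mulr_ge0 ?powR_ge0//.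
have l0 : 0 <= ln n.+1%:R :> R by rewrite ln_ge0// ler1n.
rewrite -powRM// ler_powR2 ?(ltW p10) ?ln_ge0 ?ler1n//.
rewrite mulr_natl -lnXn// ler_ln ?posrE ?exprn_gt0// -natrX ler_nat.
(* Bernoulli's inequality [k n + 1 <= (n + 1)^k] gives [ln (k n + 1) <= k ln (n + 1)]. *)
elim: (k) => [|i ih]; first by rewrite mul0n expn0.
by rewrite expnS; move: ih; set u := (n.+1 ^ i)%N => ih; nia.
Qed.

End sigma_growth.

Section dyadic_sums.
Variable R : realType.
Implicit Types (tau A : nat -> R) (r : R) (n k K nu : nat).

(* The blocks [dyadic_lo k, dyadic_lo k.+1) are {0}, {1}, {2}, {3, 4}, {5, .., 8},
   and so on; each ends at the half of [2 ^ k]. *)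
Definition dyadic_lo k : nat := if k is k'.+1 then (2 ^ k')./2.+1 else 0.

Lemma half_pow2 k : (2 ^ k)./2 = if k is k'.+1 then (2 ^ k')%N else 0%N.
Proof. by case: k => // k; rewrite expnS mul2n doubleK. Qed.

Lemma dyadic_blockP k nu : (dyadic_lo k <= nu < dyadic_lo k.+1)%N ->
  [/\ (nu <= (2 ^ k)./2)%N, (nu.+1 <= 2 ^ k)%N, (2 ^ k <= 4 * nu.+1)%N &
      (0 < nu)%N -> (2 ^ k <= 4 * nu)%N].
Proof.
rewrite /dyadic_lo half_pow2; case: k => [|[|k]].
- by rewrite !ltnS leqn0 => /eqP ->.
- by rewrite half_pow2 expn0 expn1; case: nu => [|[|nu]].
- rewrite half_pow2 !expnS => /andP[h1 h2].
  have k0 : (0 < 2 ^ k)%N by rewrite expn_gt0.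
  by split; lia.
Qed.

Lemma dyadic_block_size k : (2 ^ k <= 4 * (dyadic_lo k.+1 - dyadic_lo k))%N.
Proof.
rewrite /dyadic_lo half_pow2; case: k => [|[|k]] //.
rewrite half_pow2 !expnS; lia.
Qed.

Lemma dyadic_lo_homo k : (dyadic_lo k <= dyadic_lo k.+1)%N.
Proof.
have k0 : (0 < 2 ^ k)%N by rewrite expn_gt0.
by have := dyadic_block_size k; lia.
Qed.

Lemma sum_dyadic_blocks (x : nat -> R) K :
  \sum_(k < K) \sum_(dyadic_lo k <= nu < dyadic_lo k.+1) x nu = \sum_(0 <= nu < dyadic_lo K) x nu.
Proof.
elim: K => [|K ih]; first by rewrite big_ord0 big_geq.
by rewrite big_ord_recr/= ih -big_cat_nat ?dyadic_lo_homo.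
Qed.

(** The size of the piece [T_(2^k) - T_(2^(k-1))] after both differences: the minimum comes from the
    difference of order [beta], [tau] is [sigma^p], and [A] bounds the approximation error at the
    lower index. *)
Definition dyadic_term tau A r n k : R :=
  Num.min 1 ((2 ^+ k / n%:R) `^ r) * tau (2 ^ k)%N * A (2 ^ k)./2.

(** The [k]-th term is spread evenly over its block, which has at least [2^k / 4] elements. On the
    block [2^k <= 4 (nu + 1)], and [A] at the half of [2^k] is at most [A nu], so each share
    [4 / 2^k] of the term is dominated by the summand at [nu]. In [C] the factors are the 4 of the
    share, [4^r] for the powers and [D] for [tau]. *)
Lemma dyadic_compare tau D r : 0 < r -> 0 < D -> (forall n, 0 <= tau n) ->
  (forall m n, (m <= n)%N -> tau m <= tau n) ->
  (forall n, (0 < n)%N -> tau (4 * n)%N <= D * tau n) ->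
  exists2 C, 0 < C & forall A n K, (forall nu, 0 <= A nu) ->
    (forall m k, (m <= k)%N -> A k <= A m) -> (0 < n)%N ->
    \sum_(k < K) dyadic_term tau A r n k <=
    C * ((n%:R `^ r)^-1 * (\sum_(0 <= nu < n.+1) tau nu.+1 * nu.+1%:R `^ (r - 1) * A nu) +
      \sum_(n.+1 <= nu < n.+1 + dyadic_lo K) tau nu * nu%:R^-1 * A nu).
Proof.
move=> r0 D0 tau0 taum tauD.
pose C := 4 * 4 `^ r * D; have r4 : 1 <= 4 `^ r :> R.
  have {1}-> : 1 = (1 : R) `^ r by rewrite powR1.
  by rewrite ler_powR2// ?(ltW r0)// ler1n.
have C0 : 0 < C by rewrite !mulr_gt0// (lt_le_trans ltr01).
exists C => // A n K A0 Am n0.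
have n0' : 0 < n%:R :> R by rewrite ltr0n.
pose x nu := if (nu <= n)%N then (n%:R `^ r)^-1 * (tau nu.+1 * nu.+1%:R `^ (r - 1) * A nu)
  else tau nu * nu%:R^-1 * A nu.
have x0 nu : 0 <= x nu.
  by rewrite /x; case: ifP => _; rewrite ?mulr_ge0 ?invr_ge0 ?powR_ge0.
have elem k nu : (dyadic_lo k <= nu < dyadic_lo k.+1)%N ->
    4 / 2 ^+ k * dyadic_term tau A r n k <= C * x nu.
  move=> /dyadic_blockP[h1 h2 h3 h4].
  have k0 : 0 < 2 ^+ k :> R by rewrite exprn_gt0.
  have V0 : 0 <= tau (2 ^ k)%N * A (2 ^ k)./2 by rewrite mulr_ge0.
  have AA : A (2 ^ k)./2 <= A nu by exact: Am.
  have nu1 : nu.+1%:R <= 2 ^+ k :> R by rewrite -natrX ler_nat.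
  rewrite /dyadic_term /x -[_ * tau _ * _]mulrA; case: leqP => nun.
    have tt : tau (2 ^ k)%N <= D * tau nu.+1 by rewrite (le_trans (taum _ _ h3))// tauD.
    have rr : (2 ^+ k) `^ r / 2 ^+ k <= 4 `^ r * nu.+1%:R `^ (r - 1) :> R.
      have -> : nu.+1%:R `^ (r - 1) = nu.+1%:R `^ r / nu.+1%:R :> R.
        rewrite powRD; last by apply/implyP => _; rewrite pnatr_eq0.
        by rewrite powR_inv1.
      rewrite mulrA -powRM//; apply: ler_pM; rewrite ?powR_ge0 ?invr_ge0 ?(ltW k0)//.
        by rewrite ler_powR2 ?(ltW r0) ?(ltW k0)// -natrX -natrM ler_nat.
      by rewrite lef_pV2 ?posrE.
    apply: (@le_trans _ _ (4 / 2 ^+ k * ((2 ^+ k / n%:R) `^ r * (tau (2 ^ k)%N * A (2 ^ k)./2)))).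
      rewrite ler_wpM2l ?divr_ge0 ?(ltW k0)// ler_wpM2r//.
      by rewrite ge_min lexx orbT.
    have -> : (2 ^+ k / n%:R) `^ r = (2 ^+ k) `^ r * (n%:R `^ r)^-1.
      rewrite powRM ?invr_ge0 ?(ltW k0)//; congr (_ * _).
      by rewrite -[n%:R^-1]powR_inv1// -powRrM mulN1r powRN.
    set N' := (n%:R `^ r)^-1; have N0 : 0 <= N' by rewrite invr_ge0 powR_ge0.
    have -> : 4 / 2 ^+ k * ((2 ^+ k) `^ r * N' * (tau (2 ^ k)%N * A (2 ^ k)./2)) =
       (4 * N') * (((2 ^+ k) `^ r / 2 ^+ k) * (tau (2 ^ k)%N * A (2 ^ k)./2)) by ring.
    have -> : C * (N' * (tau nu.+1 * nu.+1%:R `^ (r - 1) * A nu)) =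
       (4 * N') * ((4 `^ r * nu.+1%:R `^ (r - 1)) * (D * tau nu.+1 * A nu)) by rewrite /C; ring.
    rewrite ler_wpM2l ?mulr_ge0//; apply: ler_pM; rewrite ?divr_ge0 ?powR_ge0 ?(ltW k0)//.
    by apply: ler_pM.
  have nu0 : (0 < nu)%N by rewrite (leq_trans _ nun).
  have tt : tau (2 ^ k)%N <= D * tau nu by rewrite (le_trans (taum _ _ (h4 nu0)))// tauD.
  apply: (@le_trans _ _ (4 / 2 ^+ k * (tau (2 ^ k)%N * A (2 ^ k)./2))).
    by rewrite ler_wpM2l ?divr_ge0 ?(ltW k0)// -[leRHS]mul1r ler_wpM2r// ge_min lexx.
  have -> : C * (tau nu * nu%:R^-1 * A nu) = 4 `^ r * (4 / nu%:R * (D * tau nu * A nu)) by rewrite /C; ring.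
  have nn : 0 <= 4 / nu%:R * (D * tau nu * A nu) by rewrite !mulr_ge0 ?invr_ge0 ?(ltW D0).
  apply: (@le_trans _ _ (4 / nu%:R * (D * tau nu * A nu))); last by rewrite ler_peMl.
  apply: ler_pM; rewrite ?divr_ge0 ?(ltW k0)//; last by apply: ler_pM.
  rewrite ler_wpM2l// lef_pV2 ?posrE ?ltr0n// (le_trans _ nu1)// ler_nat.
  by rewrite leqW.
have block k : dyadic_term tau A r n k <= \sum_(dyadic_lo k <= nu < dyadic_lo k.+1) C * x nu.
  have k0 : 0 < 2 ^+ k :> R by rewrite exprn_gt0.
  have t0 : 0 <= dyadic_term tau A r n k.
    by rewrite !mulr_ge0// le_min ler01 powR_ge0.
  apply: (@le_trans _ _ (\sum_(dyadic_lo k <= nu < dyadic_lo k.+1) 4 / 2 ^+ k * dyadic_term tau A r n k)).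
    rewrite sumr_const_nat; set N' := (_ - _)%N.
    have -> : 4 / 2 ^+ k * dyadic_term tau A r n k *+ N' =
        (4 * N'%:R / 2 ^+ k) * dyadic_term tau A r n k.
      by rewrite -[LHS]mulr_natr; ring.
    rewrite ler_peMl// ler_pdivlMr// mul1r.
    by rewrite -natrX -natrM ler_nat dyadic_block_size.
  by rewrite !big_nat; apply: ler_sum => nu; exact: elem.
apply: (le_trans (ler_sum _ (fun (k : 'I_K) _ => block k))).
rewrite (sum_dyadic_blocks (fun nu => C * x nu)) -mulr_sumr ler_wpM2l ?(ltW C0)//.
apply: (@le_trans _ _ (\sum_(0 <= nu < n.+1 + dyadic_lo K) x nu)).
  rewrite (@big_cat_nat _ _ _ (dyadic_lo K) 0 (n.+1 + dyadic_lo K))//= ?leq_addl//.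
  by rewrite lerDl sumr_ge0.
rewrite (@big_cat_nat _ _ _ n.+1 0 (n.+1 + dyadic_lo K))//= ?leq_addr// mulr_sumr; apply: lerD.
  rewrite le_eqVlt; apply/orP; left; apply/eqP; apply: eq_big_nat => nu /andP[_ h].
  by rewrite /x -ltnS h.
rewrite le_eqVlt; apply/orP; left; apply/eqP; apply: eq_big_nat => nu /andP[h _].
by rewrite /x leqNgt h.
Qed.

End dyadic_sums.

(** * Estimate of one dyadic piece *)

Section dyadic_block_estimate.
Variable R : realType.
Implicit Types (f g : R -> R[i]) (c : int -> R[i]) (p a b h d : R) (n k N M K : nat).
Local Opaque tp bser cesaro AM Ip Agrid.

Lemma Ip_Agrid_sigma p a : 0 < p -> p <= 1 -> 0 < a -> exists2 C, 0 < C &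
  forall M f, (0 < M)%N -> pmeas f ->
  (Ip p (Agrid a M f) <= (C * sigma a p M `^ p)%:E * Ip p f)%E.
Proof.
move=> p0 p1 a0; have [C C0 hC] := foldc_sigma p0 p1 a0; exists C => // M f M0 mf.
have M0' : 0 < M%:R :> R by rewrite ltr0n.
rewrite (Ip_Agrid a M p0 mf).
apply: (le_trans (lee_wpmul2l _ (Ip_AM p0 p1 mf (hC M M0)))); first by rewrite lee_fin powR_ge0.
rewrite muleA -EFinM; apply: lee_wpmul2r; first exact: Ip_ge0.
have s0 : 0 <= sigma a p M `^ p by exact: powR_ge0.
rewrite lee_fin mulrCA; apply: ler_wpM2l; first exact: ltW.
rewrite mulrA ler_piMl// powRN ler_pdivrMr ?powR_gt0// mul1r [leRHS]powRrM.
rewrite ler_powR2 ?powR_ge0 ?(ltW p0)// ler_powR2 ?(ltW a0) ?divr_ge0 ?mulr_ge0 ?pi_ge0 ?ler0n//.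
rewrite ler_pdivrMr ?mulr_gt0 ?pi_gt0// ler_peMr ?ler0n//.
by have := @pi_ge2 R; lra.
Qed.

Lemma Agrid_tp a M N c : 0 < a -> (0 < M)%N ->
  Agrid a M (tp N c) = tp N (fun k : int => ((M%:R / (2 * pi)) `^ a)%:C * dfc a (gstep R M) c k).
Proof. by move=> a0 M0; apply/funext => x; rewrite AgridE AM_tp// tpZ. Qed.

Lemma Agrid_refine p a : 0 < p -> p <= 1 -> 0 < a -> exists2 C, 0 < C &
  exists2 c0, (0 < c0)%N & forall k K c, (k <= K)%N ->
  (Ip p (Agrid a (c0 * 2 ^ K) (tp (2 ^ k) c)) <= C%:E * Ip p (Agrid a (c0 * 2 ^ k) (tp (2 ^ k) c)))%E.
Proof.
move=> p0 p1 a0; have [C [eps [C0 e0 hC]]] := diff_refine p0 p1 a0.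
have pi2 : 0 < 2 * pi :> R by rewrite mulr_gt0// pi_gt0.
(* On the grid of [c0 2^k] points the step times the order [2^k] is [2 pi / c0], which is at most
   [eps]. *)
exists C => //; exists (Num.bound (2 * pi / eps)).+1 => // k K c kK.
set c0 := _.+1; pose m := (2 ^ (K - k))%N.
have m0 : (0 < m)%N by rewrite expn_gt0.
have kp : (0 < 2 ^ k)%N by rewrite expn_gt0.
have M0 : (0 < c0 * 2 ^ k)%N by rewrite muln_gt0.
have ME : (c0 * 2 ^ K = c0 * 2 ^ k * m)%N by rewrite /m -mulnA -expnD subnKC.
have M0' : 0 < (c0 * 2 ^ k)%:R :> R by rewrite ltr0n.
have m0' : 0 < m%:R :> R by rewrite ltr0n.
have MK0 : (0 < c0 * 2 ^ K)%N by rewrite ME muln_gt0 M0.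
rewrite (Ip_Agrid_tp _ c p0 a0 MK0) (Ip_Agrid_tp _ c p0 a0 M0).
have -> : gstep R (c0 * 2 ^ K) = gstep R (c0 * 2 ^ k) / m%:R.
  by rewrite /gstep ME natrM invfM mulrA.
have hN : (2 ^ k)%:R * `|gstep R (c0 * 2 ^ k)| <= eps.
  rewrite ger0_norm ?(ltW (gstep_gt0 R M0))// /gstep.
  have k1 : (2 ^ k)%:R != 0 :> R by rewrite pnatr_eq0 -lt0n.
  have c1 : c0%:R != 0 :> R by rewrite pnatr_eq0.
  have -> : (2 ^ k)%:R * (2 * pi / (c0 * 2 ^ k)%:R) = 2 * pi / c0%:R :> R.
    by rewrite natrM invfM mulrCA; congr (_ * _); rewrite mulrCA mulfV// mulr1.
  rewrite ler_pdivrMr ?ltr0n// [eps * _]mulrC -ler_pdivrMr//.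
  have b1 : 2 * pi / eps < (Num.bound (2 * pi / eps))%:R.
    by apply: Num.Theory.archi_boundP; rewrite divr_ge0 ?ltW.
  by rewrite (le_trans (ltW b1))// ler_nat.
apply: (le_trans (lee_wpmul2l _ (hC _ c m _ kp m0 hN))); first by rewrite lee_fin powR_ge0.
have := Ip_ge0 p (tp (2 ^ k) (dfc a (gstep R (c0 * 2 ^ k)) c)).
move: (Ip p _) => I I0; clear hC hN; clearbody c0 m.
have : (((c0 * 2 ^ K)%:R / (2 * pi)) `^ a) `^ p * m%:R `^ (- (a * p)) <=
    (((c0 * 2 ^ k)%:R / (2 * pi)) `^ a) `^ p :> R.
  rewrite -!powRrM ME natrM [_ * m%:R / _]mulrAC.
  rewrite powRM ?divr_ge0 ?(ltW pi2) ?(ltW M0') ?(ltW m0')//.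
  rewrite -mulrA -powRD; last by apply/implyP => _; rewrite gt_eqF.
  by rewrite subrr powRr0 mulr1.
move: ((_ `^ a) `^ p) ((_ `^ a) `^ p) (m%:R `^ _) => X Y Z XYZ.
rewrite !muleA -!EFinM; apply: lee_wpmul2r => //.
by rewrite lee_fin mulrCA ler_wpM2l ?(ltW C0).
Qed.

(** The fine grid is first exchanged for the one adapted to the order [2^k], so that the operator
    costs [sigma(2^k)] and not [sigma(2^K)]. The inner difference supplies the minimum: a Bernstein
    bound or the plain one. *)
Lemma grid_block p a b : 0 < p -> p < 1 -> 0 < a -> 0 < b ->
  is_posnat b || (p^-1 - 1 < b) -> exists2 C, 0 < C &
  exists2 c0, (0 < c0)%N & forall k K c n d, (k <= K)%N -> (0 < n)%N -> `|d| <= n%:R^-1 ->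
  (Ip p (Agrid a (c0 * 2 ^ K) (tp (2 ^ k) (dfc b d c))) <=
   (C * (Num.min 1 ((2 ^+ k / n%:R) `^ (b * p)) * sigma a p (2 ^ k) `^ p))%:E *
     Ip p (tp (2 ^ k) c))%E.
Proof.
move=> p0 p1 a0 b0 hb; have p1' := ltW p1.
have [C1 C10 [c0 c00 h1]] := Agrid_refine p0 p1' a0.
have [C2 C20 h2] := Ip_Agrid_sigma p0 p1' a0.
have [C3 C30 h3] := diff_small_step p0 p1' b0 hb.
have [B hB] := bsum_dcoef_powR p0 p1' b0 hb; have B0 := bsum_ge0 hB.
have [D D0 hD] := sigma_dilate p0 p1 a0 c00.
have Dp : 0 < D `^ p by rewrite powR_gt0.
have C4 : 0 < C3 + B by rewrite ltr_wpDr.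
exists (C1 * C2 * D `^ p * (C3 + B)); first by rewrite !mulr_gt0.
exists c0 => // k K c n d kK n0 dn.
have kp : (0 < 2 ^ k)%N by rewrite expn_gt0.
have n0' : 0 < n%:R :> R by rewrite ltr0n.
have kp' : 0 < 2 ^+ k :> R by rewrite exprn_gt0.
have M0 : (0 < c0 * 2 ^ k)%N by rewrite muln_gt0 c00.
set mn := Num.min _ _; set s := sigma a p (2 ^ k) `^ p.
have s0 : 0 <= s by exact: powR_ge0.
have mn0 : 0 <= mn by rewrite le_min ler01 powR_ge0.
have step2 : (Ip p (tp (2 ^ k) (dfc b d c)) <= ((C3 + B) * mn)%:E * Ip p (tp (2 ^ k) c))%E.
  have r0 : 0 < 2 ^+ k / n%:R :> R by rewrite divr_gt0.
  have Nd : (2 ^ k)%:R * `|d| <= 2 ^+ k / n%:R by rewrite natrX ler_wpM2l ?(ltW kp').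
  have e1 := h3 (2 ^ k)%N c d _ kp r0 Nd.
  have e2 := Ip_dfc_le d (2 ^ k) c p0 p1' b0 hB.
  have I0 := Ip_ge0 p (tp (2 ^ k) c).
  rewrite /mn; case: (leP 1 ((2 ^+ k / n%:R) `^ (b * p))) => _.
    apply: (le_trans e2); apply: lee_wpmul2r => //.
    by rewrite mulr1 lee_fin lerDr ltW.
  apply: (le_trans e1); apply: lee_wpmul2r => //.
  by rewrite lee_fin ler_wpM2r ?powR_ge0// lerDl.
apply: (le_trans (h1 k K (dfc b d c) kK)).
apply: (@le_trans _ _ (C1%:E * ((C2 * (D `^ p * s))%:E * (((C3 + B) * mn)%:E * Ip p (tp (2 ^ k) c))))%E).
  apply: lee_wpmul2l; first by rewrite lee_fin ltW.
  apply: (le_trans (h2 _ _ M0 (pmeas_tp _ _))).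
  apply: lee_pmul => //; [by rewrite lee_fin mulr_ge0 ?powR_ge0 ?(ltW C20)|exact: Ip_ge0|].
  rewrite lee_fin ler_wpM2l ?(ltW C20)// -powRM ?sigma_ge0 ?(ltW D0)//.
  by rewrite ler_powR2 ?sigma_ge0 ?(ltW p0)// hD.
rewrite !muleA -!EFinM; apply: lee_wpmul2r; first exact: Ip_ge0.
by rewrite lee_fin le_eqVlt; apply/orP; left; apply/eqP; ring.
Qed.

End dyadic_block_estimate.

(** * The telescoping sum *)

Section telescoping.
Variable R : realType.
Implicit Types (f g : R -> R[i]) (c : int -> R[i]) (p a b h d : R) (n k N M K : nat).

Lemma Agrid_sum a M (I : Type) (s : seq I) (F : I -> R -> R[i]) :
  Agrid a M (fun x => \sum_(i <- s) F i x) = (fun x => \sum_(i <- s) Agrid a M (F i) x).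
Proof.
apply/funext => x; rewrite /Agrid /AM -mulr_sumr exchange_big/=; congr (_ * _).
by apply: eq_bigr => j _; rewrite mulr_sumr.
Qed.

Local Opaque tp bser cesaro AM Ip Agrid.

Lemma fdiff_tp b d N c : 0 < b -> fdiff b d (tp N c) = tp N (dfc b d c).
Proof. by move=> b0; apply/funext => x; apply: fdiffE; exact: has_csum_tp_diff. Qed.

Lemma fdiff_tp_sum b d (I : Type) (s : seq I) (N : I -> nat) (c : I -> int -> R[i]) : 0 < b ->
  fdiff b d (fun x => \sum_(i <- s) tp (N i) (c i) x) =
  (fun x => \sum_(i <- s) tp (N i) (dfc b d (c i)) x).
Proof.
move=> b0; apply/funext => x; apply: fdiffE.
have := has_csum_sum s (fun i => has_csum_tp_diff (N i) (c i) d x b0).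
by apply: has_csum_ext => n; rewrite mulr_sumr.
Qed.

Lemma Agrid_const a M c x : 0 < a -> (0 < M)%N -> Agrid a M (tp 0 c) x = 0.
Proof.
move=> a0 M0; rewrite (Agrid_tp _ _ a0 M0) [tp 0 _](_ : _ = tp 0 (fun=> 0)).
  rewrite -[RHS](mul0r (tp 0 (fun=> 0) x)) -tpZ; apply: eq_tpx => k _.
  by rewrite mulr0.
apply: eq_tp => k; rewrite normr_le0 => /eqP k0.
by rewrite /dfc k0 mul0r oppr0 expi0 bser_z0// mul0r mulr0.
Qed.

Lemma Agrid_dfc a b d M N c : 0 < a -> (0 < M)%N ->
  tp N (dfc b d (fun k : int => ((M%:R / (2 * pi)) `^ a)%:C * dfc a (gstep R M) c k)) =
  Agrid a M (tp N (dfc b d c)).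
Proof.
move=> a0 M0; rewrite (Agrid_tp _ _ a0 M0); apply: eq_tp => k _.
by rewrite /dfc; move: (bser a _) (bser b _) (_ `^ a)%:C => X Y Z; rewrite !mulrA [Y * Z]mulrC -[Z * Y * X]mulrA [Y * X]mulrC mulrA.
Qed.

Lemma weyl_grid_cvg_Lp p a f g : 0 < p -> p < 1 -> 0 < a -> weyl_pair a f g ->
  forall e : R, 0 < e ->
  \forall m \near \oo, (Ip p (fun x => Agrid a m.+1 f x - g x)%R <= e%:E)%E.
Proof.
move=> p0 p1 a0 fg e e0; have [mf mg _ _ _] := fg.
have pi0 := @pi_gt0 R.
(* The level at which the first term of [Ip_le_I1] equals [e / 2]. *)
pose eta := (e / (4 * pi)) `^ p^-1.
have q0 : 0 < e / (4 * pi) by rewrite divr_gt0// mulr_gt0.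
have eta0 : 0 < eta by rewrite powR_gt0.
have w0 : 0 < eta `^ (p - 1) by rewrite powR_gt0.
have e10 : 0 < e / 2 / eta `^ (p - 1) by rewrite !divr_gt0.
have := weyl_grid_cvg a0 fg e10; apply: filterS => m hm.
have mF : pmeas (fun x => Agrid a m.+1 f x - g x) by apply: pmeasB => //; exact: pmeas_Agrid.
apply: (le_trans (Ip_le_I1 p0 p1 eta0 mF)).
rewrite [in leRHS](splitr e) EFinD; apply: leeD.
  rewrite lee_fin /eta powRVK// ?(ltW q0)// le_eqVlt; apply/orP; left; apply/eqP.
  have -> : 2 * pi = 4 * pi / 2 :> R by field.
  by rewrite mulrA divfK// gt_eqF// mulr_gt0.
apply: (le_trans (lee_wpmul2l _ hm)); first by rewrite lee_fin ltW.
by rewrite -EFinM lee_fin mulrC divfK// gt_eqF.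
Qed.

(** [(2 ^ k)./2] is [2 ^ (k - 1)] for [k > 0] and 0 for [k = 0], so the sum runs down to [T 0]. *)
Lemma dyadic_telescope (T : nat -> R[i]) K :
  \sum_(k < K.+1) (T (2 ^ k)%N - T (2 ^ k)./2) = T (2 ^ K)%N - T 0%N.
Proof.
elim: K => [|K ih]; first by rewrite big_ord1 half_pow2.
by rewrite big_ord_recr/= ih half_pow2; ring.
Qed.

(** [A nu] stands for the [p]-th power of the best error, up to normalization; the slack [e] is
    there because the infimum need not be attained. *)
Lemma dyadic_pieces p f (A : nat -> R) (e : R) (W : nat -> int -> R[i]) :
  0 < p -> p <= 1 -> pmeas f -> (forall m k, (m <= k)%N -> A k <= A m) ->
  (forall nu, (Ip p (fun x => f x - tp nu (W nu) x)%R <= (A nu + e)%:E)%E) ->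
  exists u : nat -> int -> R[i], forall k,
    tp (2 ^ k) (u k) = (fun x => tp (2 ^ k) (W (2 ^ k)%N) x - tp (2 ^ k)./2 (W (2 ^ k)./2) x) /\
    (Ip p (tp (2 ^ k) (u k)) <= (2 * (A (2 ^ k)./2 + e))%:E)%E.
Proof.
move=> p0 p1 mf Am hW.
have ex k : exists u : int -> R[i],
    tp (2 ^ k) u = (fun x => tp (2 ^ k) (W (2 ^ k)%N) x - tp (2 ^ k)./2 (W (2 ^ k)./2) x) /\
    (Ip p (tp (2 ^ k) u) <= (2 * (A (2 ^ k)./2 + e))%:E)%E.
  have jk : ((2 ^ k)./2 <= 2 ^ k)%N by rewrite -divn2 leq_div.
  have [c' hc'] := tp_widen (W (2 ^ k)./2) jk.
  exists (fun l => W (2 ^ k)%N l - c' l).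
  have E : tp (2 ^ k) (fun l => W (2 ^ k)%N l - c' l) =
      (fun x => tp (2 ^ k) (W (2 ^ k)%N) x - tp (2 ^ k)./2 (W (2 ^ k)./2) x).
    by apply/funext => x; rewrite hc' tpD tpN.
  split; first exact: E.
  rewrite E; set T := tp (2 ^ k) _; set T' := tp _ _.
  have -> : (fun x => T x - T' x) = (fun x => (f x - T' x) - (f x - T x)).
    by apply/funext => x; ring.
  have mT : pmeas T by exact: pmeas_tp.
  have mT' : pmeas T' by exact: pmeas_tp.
  apply: (le_trans (IpB p0 p1 (pmeasB mf mT') (pmeasB mf mT))).
  apply: (le_trans (leeD (hW _) (hW _))).
  by rewrite -EFinD lee_fin; have := Am _ _ jk; lra.
have [u hu] := boolp.choice ex; by exists u.
Qed.

Lemma Ip_fdiff_weyl p a b : 0 < p -> p < 1 -> 0 < a -> 0 < b ->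
  is_posnat b || (p^-1 - 1 < b) -> exists2 C, 0 < C & forall f g (A : nat -> R) n d,
  weyl_pair a f g -> (forall nu, 0 <= A nu) -> (forall m k, (m <= k)%N -> A k <= A m) ->
  (forall nu (e : R), 0 < e -> exists c, (Ip p (fun x => f x - tp nu c x)%R <= (A nu + e)%:E)%E) ->
  (0 < n)%N -> `|d| <= n%:R^-1 -> forall e : R, 0 < e -> exists K,
  (Ip p (fdiff b d g) <= (C * (\sum_(k < K)
      dyadic_term (fun nu => sigma a p nu `^ p) A (b * p) n k) + e)%:E)%E.
Proof.
move=> p0 p1 a0 b0 hb; have p1' := ltW p1.
have [C1 C10 [c0 c00 h1]] := grid_block p0 p1 a0 b0 hb.
have [C2 C20 h2] := Ip_Agrid_sigma p0 p1' a0.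
have [B hB] := bsum_dcoef_powR p0 p1' b0 hb; have B0 := bsum_ge0 hB.
have [D D0 hD] := sigma_dilate p0 p1 a0 c00.
have Dp : 0 < D `^ p by rewrite powR_gt0.
have E0 : 0 <= B * C2 * D `^ p by rewrite !mulr_ge0// ltW.
exists (2 * C1 + B * C2 * D `^ p) => [|f g A n d fg A0 Am hA n0 dn e e0].
  by rewrite ltr_wpDr// mulr_gt0.
have [mf mg foo goo hfg] := fg; have bp0 : 0 < b * p by rewrite mulr_gt0.
have eta0 : 0 < e / 2 / (B + 1) by rewrite !divr_gt0// ltr_wpDl.
have [m0 _ hm0] := weyl_grid_cvg_Lp p0 p1 a0 fg eta0.
(* [m0] makes the grid fine enough for [g]; [n] ensures that [2^K >= n], so that the minimum in the
   last dyadic term is 1. *)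
pose K := (m0 + n)%N; pose M := (c0 * 2 ^ K)%N.
have K2 : (K < 2 ^ K)%N by exact: ltn_expl.
have M0 : (0 < M)%N by rewrite muln_gt0 c00 expn_gt0.
have hM : (Ip p (fun x => Agrid a M f x - g x)%R <= (e / 2 / (B + 1))%:E)%E.
  rewrite -(prednK M0); apply: hm0 => /=; rewrite -ltnS prednK//.
  rewrite (leq_ltn_trans (leq_addr n m0))// (leq_trans K2)//.
  by rewrite leq_pmull.
(* [K + 1] terms come from the telescoping sum; the extra one dominates the error of replacing [f]
   by its approximation of order [2^K]. *)
exists K.+2.
pose mn k := Num.min 1 ((2 ^+ k / n%:R) `^ (b * p)); pose s k := sigma a p (2 ^ k) `^ p.
have s0 k : 0 <= s k by exact: powR_ge0.
have mn0 k : 0 <= mn k by rewrite le_min ler01 powR_ge0.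
(* The total weight with which the slack of the near best approximations enters; the slack [e'] is
   chosen after [K], small against [Q]. *)
pose Q := 2 * C1 * (\sum_(k < K.+1) mn k * s k) + B * C2 * D `^ p * s K.
have Q0 : 0 <= Q.
  apply: addr_ge0; last exact: mulr_ge0.
  apply: mulr_ge0; first by rewrite mulr_ge0// ltW.
  by apply: sumr_ge0 => k _; exact: mulr_ge0.
pose e' := e / 2 / (Q + 1); have e'0 : 0 < e' by rewrite !divr_gt0// ltr_wpDl.
have [W hW] := boolp.choice (fun nu => hA nu e' e'0).
have [u hu] := dyadic_pieces p0 p1' mf Am hW.
pose T := tp (2 ^ K) (W (2 ^ K)%N).
pose v (c : int -> R[i]) (l : int) := ((M%:R / (2 * pi)) `^ a)%:C * dfc a (gstep R M) c l.
have AT : Agrid a M T = tp (2 ^ K) (v (W (2 ^ K)%N)) by exact: Agrid_tp.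
have sumT : Agrid a M T = (fun x => \sum_(k < K.+1) tp (2 ^ k) (v (u k)) x).
  have -> : (fun x => \sum_(k < K.+1) tp (2 ^ k) (v (u k)) x) =
      Agrid a M (fun x => \sum_(k < K.+1) tp (2 ^ k) (u k) x).
    rewrite Agrid_sum; apply/funext => x; apply: eq_bigr => k _.
    by rewrite (Agrid_tp _ _ a0 M0).
  have -> : (fun x => \sum_(k < K.+1) tp (2 ^ k) (u k) x) = (fun x => T x - tp 0 (W 0%N) x).
    apply/funext => x; rewrite /T -(dyadic_telescope (fun nu => tp nu (W nu) x)).
    by apply: eq_bigr => k _; rewrite (hu k).1.
  (* The constant left by the telescoping is annihilated by a difference of positive order. *)
  by rewrite AgridB; apply/funext => x; rewrite Agrid_const// subr0.
have part1 : (Ip p (tp (2 ^ K) (dfc b d (v (W (2 ^ K)%N)))) <=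
    (\sum_(k < K.+1) C1 * (mn k * s k) * (2 * (A (2 ^ k)./2 + e')))%:E)%E.
  rewrite -(fdiff_tp d _ _ b0) -AT sumT (fdiff_tp_sum d _ _ _ b0).
  apply: le_trans (Ip_sum _ p0 p1' _) _; first by move=> k; exact: pmeas_tp.
  rewrite -sumEFin; apply: lee_sum => k _.
  rewrite (Agrid_dfc _ _ _ _ a0 M0).
  have kK : (k <= K)%N by rewrite -ltnS.
  apply: (le_trans (h1 k K (u k) n d kK n0 dn)).
  rewrite [leRHS]EFinM; apply: lee_wpmul2l; last exact: (hu k).2.
  by rewrite lee_fin; apply: mulr_ge0; [exact: ltW|exact: (mulr_ge0 (mn0 k) (s0 k))].
have part2 : (Ip p (fun x => g x - tp (2 ^ K) (v (W (2 ^ K)%N)) x)%R <=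
    (e / 2 / (B + 1) + C2 * (D `^ p * s K) * (A (2 ^ K)%N + e'))%:E)%E.
  rewrite -AT.
  have -> : (fun x => g x - Agrid a M T x) =
      (fun x => Agrid a M (fun x => f x - T x) x - (Agrid a M f x - g x)).
    by rewrite AgridB; apply/funext => x; ring.
  have mT : pmeas (fun x => f x - T x) by apply: pmeasB => //; exact: pmeas_tp.
  have mA : pmeas (Agrid a M f) by exact: pmeas_Agrid.
  apply: (le_trans (IpB p0 p1' (pmeas_Agrid a M mT) (pmeasB mA mg))).
  rewrite [X in (_ <= X%:E)%E]addrC EFinD; apply: leeD; last exact: hM.
  apply: (le_trans (h2 M _ M0 mT)).
  rewrite [X in (_ <= X)%E]EFinM; apply: lee_pmul; [|exact: Ip_ge0| |exact: hW].
    by rewrite lee_fin mulr_ge0 ?powR_ge0 ?(ltW C20).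
  rewrite lee_fin ler_wpM2l ?(ltW C20)// /s -powRM ?sigma_ge0 ?(ltW D0)//.
  by rewrite ler_powR2 ?sigma_ge0 ?(ltW p0)// hD// expn_gt0.
(* [g] is compared with the polynomial obtained by applying [Agrid] to [T]; the series of its
   difference of order [b] is controlled through that of the remainder. *)
apply: (le_trans (Ip_fdiff d (2 ^ K) (v (W (2 ^ K)%N)) p0 p1' b0 mg hB)).
apply: (le_trans (leeD part1 (lee_wpmul2l _ part2))); first by rewrite lee_fin.
rewrite -EFinM -EFinD lee_fin.
pose t k := dyadic_term (fun nu => sigma a p nu `^ p) A (b * p) n k.
have tE k : t k = mn k * s k * A (2 ^ k)./2 by [].
have t0 k : 0 <= t k by rewrite tE !mulr_ge0.
have last : s K * A (2 ^ K)%N <= t K.+1.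
  have mn1 : mn K.+1 = 1.
    have n0' : 0 < n%:R :> R by rewrite ltr0n.
    apply/min_idPl; have {1}-> : 1 = (1 : R) `^ (b * p) by rewrite powR1.
    rewrite ler_powR2 ?(ltW bp0)// ler_pdivlMr// mul1r -natrX ler_nat.
    rewrite (leq_trans (leq_addl m0 n))// (leq_trans (ltnW K2))// leq_exp2l//.
  have le2 : (2 ^ K <= 2 ^ K.+1)%N by rewrite leq_exp2l.
  rewrite tE mn1 mul1r half_pow2; apply: ler_wpM2r; first exact: A0.
  apply: ler_powR2; [exact: ltW|exact: sigma_ge0|exact: sigma_homo].
have eB : B * (e / 2 / (B + 1)) <= e / 2.
  by rewrite mulrCA ler_piMr ?divr_ge0 ?(ltW e0)// ler_pdivrMr ?mul1r ?lerDl ?ltr_wpDl.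
have eQ : Q * e' <= e / 2.
  by rewrite /e' mulrCA ler_piMr ?divr_ge0 ?(ltW e0)// ler_pdivrMr ?mul1r ?lerDl ?ltr_wpDl.
have -> : \sum_(k < K.+1) C1 * (mn k * s k) * (2 * (A (2 ^ k)./2 + e')) =
    2 * C1 * (\sum_(k < K.+1) t k) + 2 * C1 * (\sum_(k < K.+1) mn k * s k) * e'.
  rewrite !mulr_sumr mulr_suml -big_split/=; apply: eq_bigr => k _; rewrite tE; ring.
have -> : \sum_(k < K.+2) dyadic_term (fun nu => sigma a p nu `^ p) A (b * p) n k =
    \sum_(k < K.+1) t k + t K.+1 by rewrite big_ord_recr.
have S0 : 0 <= \sum_(k < K.+1) t k by exact: sumr_ge0.
have h3 := ler_wpM2l E0 last.
have h4 := mulr_ge0 E0 S0.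
have h5 : 0 <= 2 * C1 * t K.+1 by rewrite mulr_ge0// mulr_ge0// ltW.
move: eQ h3 h4 h5 eB; rewrite /Q; clear -e0.
move: (\sum_(k < K.+1) t k) (t K.+1) (\sum_(k < K.+1) mn k * s k) => S1 t1 S2.
move: (s K) (A (2 ^ K)%N) (D `^ p) e' (e / 2 / (B + 1)) => sK AK DK e1 e2.
lra.
Qed.

End telescoping.

(** * Best approximations and quasi-norms *)

Section best_approximation.
Variable R : realType.
Implicit Types (f g : R -> R[i]) (p a b : R) (n nu : nat).
Local Opaque tp bser cesaro AM Ip Agrid.

Lemma lee_poweR (r : R) (x y : \bar R) : 0 <= r -> (0 <= x)%E -> (x <= y)%E ->
  (x `^ r <= y `^ r)%E.
Proof.
move=> r0 x0 xy; apply: gt0_ler_poweR => //; rewrite in_itv/= ?leey ?andbT//.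
exact: le_trans xy.
Qed.

Lemma Lp_normE p f : Lp_norm p f = ((((2 * pi)^-1)%:E * Ip p f) `^ p^-1)%E.
Proof. by []. Qed.

Lemma Lp_norm_fin p f (r : R) : Ip p f = r%:E -> Lp_norm p f = (((2 * pi)^-1 * r) `^ p^-1)%:E.
Proof. by move=> h; rewrite Lp_normE h -EFinM poweR_EFin. Qed.

Lemma pi2_gt0 : 0 < 2 * pi :> R.
Proof. by rewrite mulr_gt0// pi_gt0. Qed.

Lemma Lp_norm_ltyP p f : 0 < p -> (Lp_norm p f < +oo)%E -> exists2 r : R, 0 <= r & Ip p f = r%:E.
Proof.
move=> p0; have := Ip_ge0 p f; rewrite Lp_normE; case: (Ip p f) => [r||] // r0 h.
  by exists r.
move: h; rewrite mulry gtr0_sg ?invr_gt0 ?pi2_gt0// mul1e poweRyr ?invr_eq0 ?gt_eqF//.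
Qed.

Lemma Lp_torus1P f : Lp_torus 1 f -> pmeas f /\ (Ip 1 f < +oo)%E.
Proof.
move=> [f1 f2 f3 foo]; split; first by split.
by have [r _ ->] := Lp_norm_ltyP ltr01 foo; rewrite ltry.
Qed.

Lemma Ip_lty p f : 0 < p -> p < 1 -> pmeas f -> (Ip 1 f < +oo)%E -> (Ip p f < +oo)%E.
Proof.
move=> p0 p1 mf foo; apply: (le_lt_trans (Ip_le_I1 p0 p1 ltr01 mf)).
by rewrite !powR1 mul1r mul1e lte_add_pinfty// ltry.
Qed.

Lemma best_approx_ge0 p f nu : (0 <= best_approx p f nu)%E.
Proof. by apply: le_ereal_inf_tmp => _ [T _ <-]; exact: poweR_ge0. Qed.

Lemma tp0 nu x : tp nu (fun=> 0 : R[i]) x = 0.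
Proof.
by rewrite -[RHS](mul0r (tp nu (fun=> 0) x)) -tpZ; apply: eq_tpx => k _; rewrite mulr0.
Qed.

Lemma best_approx_fin p f nu : 0 < p -> p < 1 -> pmeas f -> (Ip 1 f < +oo)%E ->
  best_approx p f nu \is a fin_num.
Proof.
move=> p0 p1 mf foo; rewrite ge0_fin_numE ?best_approx_ge0//.
apply: (@le_lt_trans _ _ (Lp_norm p f)).
  apply: ge_ereal_inf; exists (Lp_norm p f) => //; exists (tp nu (fun=> 0)).
    by apply/trig_polyP; exists (fun=> 0).
  by congr Lp_norm; apply/funext => x; rewrite tp0 subr0.
have := Ip_lty p0 p1 mf foo; have := Ip_ge0 p f.
by case E : (Ip p f) => [r||] // _ _; rewrite (Lp_norm_fin E) ltry.
Qed.

Lemma best_approx_anti p f m n : (m <= n)%N -> (best_approx p f n <= best_approx p f m)%E.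
Proof.
move=> mn; apply: ereal_inf_le_tmp => _ [T hT <-]; exists T => //.
exact: trig_poly_le hT.
Qed.

Lemma best_approx_near p f nu (e : R) : 0 < p -> p < 1 -> pmeas f -> (Ip 1 f < +oo)%E -> 0 < e ->
  exists c, (Ip p (fun x => f x - tp nu c x)%R <=
    (2 * pi * fine (best_approx p f nu) `^ p + e)%:E)%E.
Proof.
move=> p0 p1 mf foo e0; have fin := best_approx_fin nu p0 p1 mf foo.
set x := fine (best_approx p f nu).
have x0 : 0 <= x by rewrite fine_ge0// best_approx_ge0.
have xE : best_approx p f nu = x%:E by rewrite fineK.
have pi2 := pi2_gt0; have p10 : 0 < p^-1 by rewrite invr_gt0.
(* [y] is the quasi-norm whose [p]-th power exceeds that of the infimum by [e / (2 pi)]; being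
   strictly larger than the infimum, it bounds some competitor. *)
pose w := x `^ p + e / (2 * pi).
have w0 : 0 < w by rewrite ltr_wpDl ?powR_ge0// divr_gt0.
pose y := w `^ p^-1.
have xy : x < y.
  have -> : x = (x `^ p) `^ p^-1 by rewrite -powRrM mulfV ?gt_eqF// powRr1.
  by rewrite /y gt0_ltr_powR// ?nnegrE ?powR_ge0 ?(ltW w0)// ltrDl divr_gt0.
have yx0 : 0 < y - x by rewrite subr_gt0.
have [_ [T /trig_polyP[c ->] <-]] := lb_ereal_inf_adherent yx0 fin.
rewrite -[ereal_inf _]/(best_approx p f nu) xE -EFinD [x + _]addrC subrK => h.
exists c; have [r r0 rE] := Lp_norm_ltyP p0 (lt_trans h (ltry y)).
move: h; rewrite rE (Lp_norm_fin rE) lte_fin lee_fin => h.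
have q0 : 0 <= (2 * pi)^-1 * r by rewrite mulr_ge0// invr_ge0 ltW.
have := ler_powR2 (ltW p0) (powR_ge0 _ _) (ltW h).
rewrite powRVK// /y powRVK ?(ltW w0)// => /(ler_wpM2l (ltW pi2)).
rewrite mulrA mulfV ?gt_eqF// mul1r.
by move=> /le_trans; apply; rewrite /w mulrDr [_ * (e / _)]mulrCA mulfV ?gt_eqF// mulr1.
Qed.

Lemma weyl_pairP a f g : Lp_torus 1 f -> is_weyl_derivative a f g -> weyl_pair a f g.
Proof.
move=> /Lp_torus1P[mf foo] [/Lp_torus1P[mg goo] fg]; split=> // k.
by rewrite fg ik_powE; case: eqP => // _; rewrite mul0r.
Qed.

Definition inverse_bound a p b (E : nat -> \bar R) n : \bar R :=
  (((n%:R `^ (b * p))^-1)%:E *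
     (\sum_(0 <= nu < n.+1) (sigma a p nu.+1 `^ p * nu.+1%:R `^ (b * p - 1))%:E * E nu `^ p)
   + \sum_(n.+1 <= nu <oo) (sigma a p nu `^ p * nu%:R^-1)%:E * E nu `^ p)%E.

Lemma inverse_bound_ge0 a p b E n : (0 <= inverse_bound a p b E n)%E.
Proof.
apply: adde_ge0.
  apply: mule_ge0; first by rewrite lee_fin invr_ge0 powR_ge0.
  by apply: sume_ge0 => nu _; rewrite mule_ge0 ?poweR_ge0// lee_fin mulr_ge0 ?powR_ge0.
apply: nneseries_ge0 => nu _ _.
by rewrite mule_ge0 ?poweR_ge0// lee_fin mulr_ge0 ?powR_ge0 ?invr_ge0.
Qed.

(** Passage from the finite real sums of the dyadic comparison to the extended series; the factor
    [2 pi] undoes the normalization of the quasi-norm contained in [A]. *)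
Lemma inverse_bound_partial a p b (E : nat -> \bar R) (A : nat -> R) n L :
  (forall nu, (E nu `^ p)%E = ((2 * pi)^-1 * A nu)%:E) ->
  (((n%:R `^ (b * p))^-1 *
      (\sum_(0 <= nu < n.+1) sigma a p nu.+1 `^ p * nu.+1%:R `^ (b * p - 1) * A nu) +
    \sum_(n.+1 <= nu < L) sigma a p nu `^ p * nu%:R^-1 * A nu)%:E <=
   (2 * pi)%:E * inverse_bound a p b E n)%E.
Proof.
move=> hE; have pi2 := pi2_gt0.
have pos : (0 <= \sum_(n.+1 <= nu <oo) (sigma a p nu `^ p * nu%:R^-1)%:E * E nu `^ p)%E.
  apply: nneseries_ge0 => nu _ _.
  by rewrite mule_ge0 ?poweR_ge0// lee_fin mulr_ge0 ?powR_ge0 ?invr_ge0.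
have tail : ((\sum_(n.+1 <= nu < L) sigma a p nu `^ p * nu%:R^-1 * A nu)%:E <=
    (2 * pi)%:E * \sum_(n.+1 <= nu <oo) (sigma a p nu `^ p * nu%:R^-1)%:E * E nu `^ p)%E.
  apply: (@le_trans _ _ ((2 * pi)%:E *
      \sum_(n.+1 <= nu < L) (sigma a p nu `^ p * nu%:R^-1)%:E * E nu `^ p)%E).
    under [X in (_ <= _ * X)%E]eq_bigr do rewrite hE -EFinM.
    rewrite sumEFin -EFinM lee_fin mulr_sumr le_eqVlt; apply/orP; left; apply/eqP.
    apply: eq_bigr => nu _; rewrite [RHS]mulrCA; congr (_ * _).
    by rewrite mulrA mulfV ?mul1r// gt_eqF.
  apply: lee_wpmul2l; first by rewrite lee_fin ltW.
  apply: nneseries_lim_ge => nu _ _.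
  by rewrite mule_ge0 ?poweR_ge0// lee_fin mulr_ge0 ?powR_ge0 ?invr_ge0.
rewrite /inverse_bound ge0_muleDr//; last first.
  apply: mule_ge0; first by rewrite lee_fin invr_ge0 powR_ge0.
  by apply: sume_ge0 => nu _; rewrite mule_ge0 ?poweR_ge0// lee_fin mulr_ge0 ?powR_ge0.
rewrite EFinD; apply: leeD => //.
under [X in (_ <= _ * (_ * X))%E]eq_bigr do rewrite hE -EFinM.
rewrite sumEFin -!EFinM lee_fin mulrCA ler_wpM2l ?invr_ge0 ?powR_ge0// mulr_sumr.
rewrite le_eqVlt; apply/orP; left; apply/eqP; apply: eq_bigr => nu _.
by rewrite [RHS]mulrCA; congr (_ * _); rewrite mulrA mulfV ?mul1r// gt_eqF.
Qed.

Lemma Lp_norm_fdiff_weyl p a b : 0 < p -> p < 1 -> 0 < a -> 0 < b ->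
  is_posnat b || (p^-1 - 1 < b) -> exists2 C, 0 < C & forall f g n d,
  Lp_torus 1 f -> is_weyl_derivative a f g -> (0 < n)%N -> `|d| <= n%:R^-1 ->
  (Lp_norm p (fdiff b d g) <= C%:E * inverse_bound a p b (best_approx p f) n `^ p^-1)%E.
Proof.
move=> p0 p1 a0 b0 hb; have [C1 C10 h1] := Ip_fdiff_weyl p0 p1 a0 b0 hb.
have [D D0 hD] := sigma_dilate p0 p1 a0 (isT : (0 < 4)%N).
have bp0 : 0 < b * p by rewrite mulr_gt0.
pose tau nu := sigma a p nu `^ p.
have tau0 nu : 0 <= tau nu by exact: powR_ge0.
have taum m n : (m <= n)%N -> tau m <= tau n.
  move=> mn; apply: ler_powR2; [exact: ltW|exact: sigma_ge0|exact: sigma_homo].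
have Dp0 : 0 < D `^ p by rewrite powR_gt0.
have tauD n : (0 < n)%N -> tau (4 * n)%N <= D `^ p * tau n.
  move=> n0; rewrite /tau -powRM ?sigma_ge0 ?(ltW D0)//.
  by apply: ler_powR2; [exact: ltW|exact: sigma_ge0|exact: hD].
have [C2 C20 h2] := dyadic_compare bp0 Dp0 tau0 taum tauD.
have C0 : 0 < C1 * C2 by rewrite mulr_gt0.
have p10 : 0 < p^-1 by rewrite invr_gt0.
exists ((C1 * C2) `^ p^-1) => [|f g n d hf hg n0 dn]; first by rewrite powR_gt0.
have [mf foo] := Lp_torus1P hf; have fg := weyl_pairP hf hg.
have pi2 := pi2_gt0.
pose A nu := 2 * pi * fine (best_approx p f nu) `^ p.
have fin nu := best_approx_fin nu p0 p1 mf foo.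
have A0 nu : 0 <= A nu by rewrite mulr_ge0 ?powR_ge0// ltW.
have Am m k : (m <= k)%N -> A k <= A m.
  move=> mk; rewrite /A ler_pM2l// ler_powR2 ?(ltW p0)//.
    by rewrite fine_ge0// best_approx_ge0.
  by rewrite fine_le// best_approx_anti.
have hE nu : (best_approx p f nu `^ p)%E = ((2 * pi)^-1 * A nu)%:E.
  by rewrite /A mulrA mulVf ?mul1r ?gt_eqF// -poweR_EFin fineK.
pose S := inverse_bound a p b (best_approx p f) n.
have S0 : (0 <= S)%E by exact: inverse_bound_ge0.
have main : (Ip p (fdiff b d g) <= (C1 * C2 * (2 * pi))%:E * S)%E.
  (* The number [K] of dyadic terms depends on [e], but every partial sum is bounded by the same
     [S], so [e] may tend to 0. *)
  apply/lee_addgt0Pr => e e0.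
  have hA nu (e' : R) : 0 < e' -> exists c, (Ip p (fun x => f x - tp nu c x)%R <= (A nu + e')%:E)%E.
    exact: best_approx_near.
  have [K hK] := h1 f g A n d fg A0 Am hA n0 dn e e0.
  apply: (le_trans hK); rewrite EFinD; apply: leeD2r.
  have cmp := h2 A n K A0 Am n0.
  apply: (@le_trans _ _ ((C1 * C2)%:E * ((2 * pi)%:E * S))%E); last by rewrite muleA -EFinM.
  apply: le_trans (lee_wpmul2l _ (inverse_bound_partial a b n (n.+1 + dyadic_lo K) hE)).
    rewrite -EFinM lee_fin -mulrA ler_pM2l//.
  by rewrite lee_fin ltW.
rewrite Lp_normE.
have -> : (((C1 * C2) `^ p^-1)%:E * S `^ p^-1 = ((C1 * C2)%:E * S) `^ p^-1)%E.
  by rewrite poweRM ?poweR_EFin// lee_fin ltW.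
apply: lee_poweR; [exact: ltW| |].
  by rewrite mule_ge0 ?Ip_ge0// lee_fin invr_ge0 ltW.
apply: (le_trans (lee_wpmul2l _ main)); first by rewrite lee_fin invr_ge0 ltW.
rewrite muleA -EFinM mulrCA mulVf ?mulr1 ?gt_eqF//.
Qed.

End best_approximation.

Unset Implicit Arguments.

Theorem theorem2p10 (R : realType) (p alpha beta : R)
    (hp0 : 0 < p) (hp1 : p < 1) (halpha : 0 < alpha)
    (hbeta : is_posnat beta \/ p^-1 - 1 < beta) :
  exists C : R, 0 < C /\
    forall f falpha : R -> R[i],
      Lp_torus 1 f -> is_weyl_derivative alpha f falpha ->
    forall n : nat, (0 < n)%N ->
    (modulus beta p falpha n%:R^-1 <=
     C%:E *
     (((n%:R `^ (beta * p))^-1)%:E *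
        (\sum_(0 <= nu < n.+1)
           (sigma alpha p nu.+1 `^ p * nu.+1%:R `^ (beta * p - 1))%:E
           * best_approx p f nu `^ p)
      + \sum_(n.+1 <= nu <oo)
           (sigma alpha p nu `^ p * nu%:R^-1)%:E
           * best_approx p f nu `^ p) `^ p^-1)%E.
Proof.
have hb : is_posnat beta || (p^-1 - 1 < beta) by apply/orP.
have b0 : 0 < beta.
  case: hbeta => [/andP[]//|]; apply: le_lt_trans.
  by rewrite subr_ge0 invf_ge1// ltW.
have [C C0 hC] := Lp_norm_fdiff_weyl hp0 hp1 halpha b0 hb.
exists C; split=> // f g hf hg n n0.
apply: ge_ereal_sup => _ [d dn <-].
exact: (hC f g n d hf hg n0 (ltW dn)).
Qed.
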